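(* Let $n\ge4$ and let $Z\in\mathbb{R}^{n\times4}$ be totally positive satisfying Assumption (G). Then there exists an adjoint polynomial $\alpha_{\mathcal{A}_n}$ for $\mathcal{A}_n=\mathcal{A}_n(Z)$ in the homogeneous coordinate ring $R$ of $\mathrm{Gr}_{\mathbb{C}}(2,4)$, and it is unique up to scaling.
   Context: $Z$ totally positive: all $4\times4$ minors positive; rows $Z_1,\dots,Z_n$ are points of $\mathbb{P}^3$, indices cyclic mod $n$. $\mathcal{A}_n\subset\mathrm{Gr}_{\mathbb{R}}(2,4)$ is the image of the totally nonnegative Grassmannian $\mathrm{Gr}(2,n)_{\ge0}$ (row spans of rank-2 real $2\times n$ matrices with all $2\times2$ minors $\geq0$ up to common sign) under $\mathrm{rowspan}(X)\mapsto\mathrm{rowspan}(XZ)$. $\langle AB\,ij\rangle$ is the determinant of the matrix with rows $A,B,Z_i,Z_j$ (a linear form in Plücker coordinates). Assumption (G): no line $AB$ has more than $4$ of $\langle AB\,i(i+1)\rangle$, $i\in[n]$, vanishing. The algebraic boundary $\partial_a\mathcal{A}_n$ is the union of $D_i=\{AB\in\mathrm{Gr}_{\mathbb{C}}(2,4):\langle AB\,i(i+1)\rangle=0\}$, $i\in[n]$; its closed strata are obtained starting from $D_1,\dots,D_n$ by repeatedly taking irreducible components of intersections of strata. The residual arrangement $\mathcal{R}(\mathcal{A}_n)$ is the union of all closed strata of $\partial_a\mathcal{A}_n$ that do not intersect $\mathcal{A}_n$. $R=\mathbb{C}[p_{12},p_{13},p_{14},p_{23},p_{24},p_{34}]/\langle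 p_{12}p_{34}-p_{13}p_{24}+p_{14}p_{23}\rangle$ with degree-$d$ part $R_d$. An adjoint polynomial for $\mathcal{A}_n$ is a nonzero form $\alpha\in R_{n-4}$ with $\alpha(Y)=0$ for all $Y\in\mathcal{R}(\mathcal{A}_n)$. *)

(* Defs.v *)
From HB Require Import structures.
From mathcomp Require Import all_boot all_order all_algebra.
From Stdlib Require Rdefinitions.
From mathcomp Require Import Rstruct complex.
From mathcomp Require Import mpoly.

Set Implicit Arguments.
Unset Strict Implicit.
Unset Printing Implicit Defensive.

Import Order.TTheory GRing.Theory Num.Theory.
Local Open Scope ring_scope.

Notation R := Rdefinitions.R.

Definition C : fieldType := (complex R : fieldType).
Definition RtoC (x : R) : C := Complex x 0.

Definition minor2 (K : comNzRingType) (M : 'M[K]_(2,4)) (a b : 'I_4) : K :=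
  M 0 a * M 1 b - M 0 b * M 1 a.

Definition plucker_pair (k : 'I_6) : 'I_4 * 'I_4 :=
  match val k with
  | 0 => (inord 0, inord 1)
  | 1 => (inord 0, inord 2)
  | 2 => (inord 0, inord 3)
  | 3 => (inord 1, inord 2)
  | 4 => (inord 1, inord 3)
  | _ => (inord 2, inord 3)
  end.

Definition plucker (M : 'M[C]_(2,4)) : 'I_6 -> C :=
  fun k => minor2 M (plucker_pair k).1 (plucker_pair k).2.

(* Subsets of the affine cone C^6 (points of P^5 given by representatives). *)
Definition cset := ('I_6 -> C) -> Prop.
Definition csub (S T : cset) : Prop := forall v, S v -> T v.

(* Gr_C(2,4): Plücker vectors of rank-2 complex 2x4 matrices
   (i.e. the affine cone over Gr(2,4) with the origin removed). *)
Definition Gr : cset := fun v => exists M : 'M[C]_(2,4), \rank M = 2%N /\ v = plucker M.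

(* The Plücker relation and the ring R = C[p]/<p12 p34 - p13 p24 + p14 p23>. *)
Definition pluckerRel : {mpoly C[6]} :=
  'X_(inord 0) * 'X_(inord 5) - 'X_(inord 1) * 'X_(inord 4)
  + 'X_(inord 2) * 'X_(inord 3).

Definition zeroR (f : {mpoly C[6]}) : Prop := exists q : {mpoly C[6]}, f = q * pluckerRel.

Definition zclosed (S : cset) : Prop :=
  exists F : {mpoly C[6]} -> Prop,
    forall v, S v <-> (Gr v /\ forall f, F f -> f.@[v] = 0).

Definition irreducible (S : cset) : Prop :=
  [/\ zclosed S, exists v, S v &
      forall S1 S2 : cset, zclosed S1 -> zclosed S2 ->
        csub S (fun v => S1 v \/ S2 v) -> csub S S1 \/ csub S S2].

Definition irr_component (Y X : cset) : Prop :=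
  [/\ irreducible Y, csub Y X &
      forall W, irreducible W -> csub Y W -> csub W X -> csub W Y].

Section WithZ.
Variables (n : nat) (Z : 'M[R]_(n,4)).

Definition ZC : 'M[C]_(n,4) := map_mx RtoC Z.

Definition bracket (M : 'M[C]_(2,4)) (i j : 'I_n) : C :=
  \det (col_mx M (col_mx (row i ZC) (row j ZC)) : 'M[C]_4).

Definition totally_positive : Prop :=
  forall f : 'I_4 -> 'I_n, (forall a b : 'I_4, (a < b)%N -> (f a < f b)%N) ->
    0 < \det (\matrix_(i < 4, j < 4) Z (f i) j).

Definition assumptionG : Prop :=
  forall M : 'M[C]_(2,4), \rank M = 2%N ->
    leq #|[set i : 'I_n | bracket M i (ordS i) == 0]| 4.

Definition Dbound (i : 'I_n) : cset :=
  fun v => exists M : 'M[C]_(2,4),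
    [/\ \rank M = 2%N, v = plucker M & bracket M i (ordS i) = 0].

Inductive stratum : cset -> Prop :=
  | stratum_base i : stratum (Dbound i)
  | stratum_comp S T Y : stratum S -> stratum T ->
      irr_component Y (fun v => S v /\ T v) -> stratum Y.

(* A_n(Z): Plücker vectors of X Z, for X a real 2 x n matrix of rank 2 whose
   2x2 minors are all >= 0 or all <= 0 (a point of Gr(2,n)_{>=0}). *)
Definition colminor (X : 'M[R]_(2,n)) (a b : 'I_n) : R :=
  X 0 a * X 1 b - X 0 b * X 1 a.

Definition Ampl : cset :=
  fun v => exists X : 'M[R]_(2,n),
    [/\ \rank X = 2%N,
        (forall a b : 'I_n, (a < b)%N -> 0 <= colminor X a b) \/
        (forall a b : 'I_n, (a < b)%N -> colminor X a b <= 0) &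
        v = plucker (map_mx RtoC (X *m Z))].

Definition residual : cset :=
  fun v => exists Y : cset, [/\ stratum Y, forall w, Y w -> ~ Ampl w & Y v].

(* adjoint polynomial: a nonzero element of R_{n-4} (represented by a
   homogeneous polynomial of degree n-4 not in the Plücker ideal)
   vanishing on the residual arrangement *)
Definition adjoint (a : {mpoly C[6]}) : Prop :=
  [/\ a \is (n - 4)%N.-homog, ~ zeroR a & forall v, residual v -> a.@[v] = 0].

End WithZ.

(* Main.v *)
Require Import Defs.
From HB Require Import structures.
From mathcomp Require Import all_boot all_order all_algebra.
From Stdlib Require Rdefinitions.
From Stdlib Require Import FunctionalExtensionality PropExtensionality Classical.
From mathcomp Require Import Rstruct complex.
From mathcomp Require Import mpoly.
From mathcomp Require Import zify ring lra.
Set Implicit Arguments.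
Unset Strict Implicit.
Unset Printing Implicit Defensive.

Import Order.TTheory GRing.Theory Num.Theory.
Local Open Scope ring_scope.

(* Write l_i(AB) = <AB i(i+1)> and index by b the plane spanned by Z_b, Z_(b+1), Z_(b+2).

   A stratum misses the amplituhedron iff it lies in the locus of lines meeting three pairwise
   disjoint edges Z_i Z_(i+1), or in the locus of lines in a plane b meeting an edge disjoint from the
   vertices of b: a stratum Y in neither is the locus H cut out by all the incidence conditions (with
   edges, vertices, planes b) that hold on Y, since the finitely many possible H are irreducible,
   and each of them contains a line Z_a Z_b.  Irreducibility is always read off a polynomial
   parametrization.

   Existence.  For a line AB off all D_i put
     U_A = sum_b <A b(b+1)(b+2)> / (l_b l_(b+1)) Z_(b+1).
   The sum defining A /\ B /\ U_A telescopes, so U_A and U_B lie on AB and U_A /\ U_B is a multiple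
   of A /\ B.  Clearing denominators gives W = alpha * (A /\ B) where W is an explicit bivector with
   polynomial coordinates all of whose terms vanish on the bad loci; pairing with an edge exhibits
   alpha as a form of degree n - 4, and alpha does not vanish at Z_a Z_b for a, b not adjacent.

   Uniqueness.  Let beta be another adjoint.  On the pencil of lines joining a point A of the edge i
   to the edge j, both forms have degree n - 4 and the n - 4 zeros where the line meets a third edge;
   Assumption (G) makes these distinct for general A.  So beta = c_ij alpha on D_i /\ D_j; comparing
   at the lines Z_a Z_b, all c_ij equal one c.  Then beta - c alpha has n - 3 zeros on a general
   pencil in D_i, hence vanishes on each D_i, and by the same count on all of Gr(2,4). *)

(** * Bivectors and 4x4 determinants *)

(** Vanishing on bad lines is read off [W], not off [alpha]. The formula for [alpha] is the pairing
    of [W] with one edge [o], divided by [l_o], and its terms need not vanish one by one on a bad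
    line that meets the edge [o]. The terms of [W] do, and [W = alpha * (A /\ B)] with [A /\ B]
    nonzero passes this on to [alpha]. The coefficients of [W] have degree [n - 3], one more than
    [alpha].

    Strata arise inductively as irreducible components, so they are not enumerated. The induction
    carries an alternative: the stratum is bad, or it contains its incidence hull and meets the
    amplituhedron. Irreducibility turns alternatives for single lines into alternatives for the
    whole stratum, and maximality of a component identifies it with its hull.

    Bad lines avoid the amplituhedron by Cauchy-Binet: at a point [X Z] the form [l_i] is a sum of
    minors of [X] weighted by determinants of constant sign, so [l_i = 0] forces every nonzero minor
    to use column [i] or [i+1]. Two columns cannot serve three disjoint edges. *)

Section Wedge.
Variable F : comNzRingType.
Implicit Types (A B : 'rV[F]_4) (v w : 'I_6 -> F).

Definition co A k : F := A 0 (inord k).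

Definition wedge A B : 'I_6 -> F := fun k =>
  A 0 (plucker_pair k).1 * B 0 (plucker_pair k).2 -
  A 0 (plucker_pair k).2 * B 0 (plucker_pair k).1.

(* The product of two bivectors in the fourth exterior power; by Laplace expansion [br] is the
   4x4 determinant. *)
Definition pairing v w : F :=
  v (inord 0) * w (inord 5) - v (inord 1) * w (inord 4) + v (inord 2) * w (inord 3)
  + v (inord 3) * w (inord 2) - v (inord 4) * w (inord 1) + v (inord 5) * w (inord 0).

Definition br A B Y W := pairing (wedge A B) (wedge Y W).

Lemma wedgeE A B :
  (wedge A B (inord 0) = co A 0 * co B 1 - co A 1 * co B 0) *
  (wedge A B (inord 1) = co A 0 * co B 2 - co A 2 * co B 0) *
  (wedge A B (inord 2) = co A 0 * co B 3 - co A 3 * co B 0) *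
  (wedge A B (inord 3) = co A 1 * co B 2 - co A 2 * co B 1) *
  (wedge A B (inord 4) = co A 1 * co B 3 - co A 3 * co B 1) *
  (wedge A B (inord 5) = co A 2 * co B 3 - co A 3 * co B 2).
Proof. by rewrite /wedge /plucker_pair /= !inordK. Qed.

Lemma ord6_ind (P : 'I_6 -> Prop) :
  P (inord 0) -> P (inord 1) -> P (inord 2) -> P (inord 3) -> P (inord 4) -> P (inord 5) ->
  forall k, P k.
Proof.
move=> p0 p1 p2 p3 p4 p5 k; rewrite -(inord_val k).
by case: k => -[|[|[|[|[|[|]]]]]].
Qed.

Lemma ord4_ind (P : 'I_4 -> Prop) :
  P (inord 0) -> P (inord 1) -> P (inord 2) -> P (inord 3) -> forall k, P k.
Proof.
move=> p0 p1 p2 p3 k; rewrite -(inord_val k).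
by case: k => -[|[|[|[|]]]].
Qed.

Lemma rV4_eq A B : co A 0 = co B 0 -> co A 1 = co B 1 -> co A 2 = co B 2 ->
  co A 3 = co B 3 -> A = B.
Proof. by move=> *; apply/rowP; apply: ord4_ind. Qed.

Lemma coD A B k : co (A + B) k = co A k + co B k. Proof. by rewrite /co !mxE. Qed.
Lemma coN A k : co (- A) k = - co A k. Proof. by rewrite /co !mxE. Qed.
Lemma coZ a A k : co (a *: A) k = a * co A k. Proof. by rewrite /co !mxE. Qed.
Lemma co0 k : co 0 k = 0. Proof. by rewrite /co !mxE. Qed.
Definition coE := (coD, coN, coZ, co0).

Lemma wedgeDl A A' B k : wedge (A + A') B k = wedge A B k + wedge A' B k.
Proof. rewrite /wedge !mxE; ring. Qed.
Lemma wedgeDr A B B' k : wedge A (B + B') k = wedge A B k + wedge A B' k.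
Proof. rewrite /wedge !mxE; ring. Qed.
Lemma wedgeZl a A B k : wedge (a *: A) B k = a * wedge A B k.
Proof. rewrite /wedge !mxE; ring. Qed.
Lemma wedgeZr a A B k : wedge A (a *: B) k = a * wedge A B k.
Proof. rewrite /wedge !mxE; ring. Qed.
Lemma wedgevv A k : wedge A A k = 0.
Proof. rewrite /wedge; ring. Qed.
Lemma wedgeC A B k : wedge A B k = - wedge B A k.
Proof. rewrite /wedge; ring. Qed.
Lemma wedge0l A k : wedge 0 A k = 0.
Proof. rewrite /wedge !mxE; ring. Qed.
Lemma wedge0r A k : wedge A 0 k = 0.
Proof. rewrite /wedge !mxE; ring. Qed.

Lemma brDa A A' B Y W : br (A + A') B Y W = br A B Y W + br A' B Y W.
Proof. rewrite /br /pairing !wedgeDl; ring. Qed.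
Lemma brDb A B B' Y W : br A (B + B') Y W = br A B Y W + br A B' Y W.
Proof. rewrite /br /pairing !wedgeDr; ring. Qed.
Lemma brDc A B Y Y' W : br A B (Y + Y') W = br A B Y W + br A B Y' W.
Proof. rewrite /br /pairing !wedgeDl; ring. Qed.
Lemma brDd A B Y W W' : br A B Y (W + W') = br A B Y W + br A B Y W'.
Proof. rewrite /br /pairing !wedgeDr; ring. Qed.
Lemma brZa a A B Y W : br (a *: A) B Y W = a * br A B Y W.
Proof. rewrite /br /pairing !wedgeZl; ring. Qed.
Lemma brZb a A B Y W : br A (a *: B) Y W = a * br A B Y W.
Proof. rewrite /br /pairing !wedgeZr; ring. Qed.
Lemma brZc a A B Y W : br A B (a *: Y) W = a * br A B Y W.
Proof. rewrite /br /pairing !wedgeZl; ring. Qed.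
Lemma brZd a A B Y W : br A B Y (a *: W) = a * br A B Y W.
Proof. rewrite /br /pairing !wedgeZr; ring. Qed.
Definition brE := (brDa, brDb, brDc, brDd, brZa, brZb, brZc, brZd).

Lemma br_aabb A B Y : (br A A B Y = 0) * (br A B A Y = 0) * (br A B Y A = 0) *
  (br B A A Y = 0) * (br B A Y A = 0) * (br B Y A A = 0).
Proof. by rewrite /br /pairing !wedgeE; do !split; ring. Qed.
Lemma br_swap12 A B Y W : br A B Y W = - br B A Y W.
Proof. rewrite /br /pairing !wedgeE; ring. Qed.
Lemma br_swap23 A B Y W : br A B Y W = - br A Y B W.
Proof. rewrite /br /pairing !wedgeE; ring. Qed.
Lemma br_swap34 A B Y W : br A B Y W = - br A B W Y.
Proof. rewrite /br /pairing !wedgeE; ring. Qed.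

Lemma br_swap13 A B Y W : br A B Y W = - br Y B A W.
Proof. rewrite /br /pairing !wedgeE; ring. Qed.
Lemma br_swap14 A B Y W : br A B Y W = - br W B Y A.
Proof. rewrite /br /pairing !wedgeE; ring. Qed.

(** Cramer's rule for five vectors of a four-dimensional space, division-free so that it holds
    without independence. A vanishing coefficient puts [X] in a plane spanned by three of the other
    vectors, once these are independent. *)
Lemma br_cramer A B Y W X :
  br A B Y W *: X = br X B Y W *: A + br A X Y W *: B + br A B X W *: Y + br A B Y X *: W.
Proof.
by apply: rV4_eq; rewrite !coE /br /pairing !wedgeE; ring.
Qed.

(** Coordinates of a bivector in the basis of the six products of four vectors: each is the pairing
    with the complementary product, scaled by the determinant. *)
Lemma bivector_expand e1 e2 e3 e4 v k :
  br e1 e2 e3 e4 * v k =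
    pairing v (wedge e3 e4) * wedge e1 e2 k - pairing v (wedge e2 e4) * wedge e1 e3 k
  + pairing v (wedge e2 e3) * wedge e1 e4 k + pairing v (wedge e1 e4) * wedge e2 e3 k
  - pairing v (wedge e1 e3) * wedge e2 e4 k + pairing v (wedge e1 e2) * wedge e3 e4 k.
Proof.
by elim/ord6_ind: k; rewrite /br /pairing !wedgeE; ring.
Qed.

End Wedge.

Section Det4.
Variable F : comNzRingType.

Lemma det4_br (X : 'M[F]_4) :
  \det X = br (row (inord 0) X) (row (inord 1) X) (row (inord 2) X) (row (inord 3) X).
Proof.
(* Entries are indexed by naturals so that the ordinals from [inord] and those from cofactor
   expansion become identical terms for [ring]. *)
pose f a b := X (inord a) (inord b).
have fE i j : X i j = f (val i) (val j) by rewrite /f !inord_val.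
rewrite /br /pairing !wedgeE /co !mxE !fE /= !inordK //.
rewrite (expand_det_row _ ord0) !big_ord_recl big_ord0 /cofactor.
rewrite !(@expand_det_row _ 3 _ ord0) !big_ord_recl !big_ord0 /cofactor.
rewrite !(@expand_det_row _ 2 _ ord0) !big_ord_recl !big_ord0 /cofactor.
rewrite !det_mx11 !mxE !fE /= /bump /=.
ring.
Qed.

Lemma det_col_br (M : 'M[F]_(2, 4)) (a b : 'rV[F]_4) :
  \det (col_mx M (col_mx a b) : 'M[F]_4) = br (row 0 M) (row 1 M) a b.
Proof.
rewrite det4_br.
have e0 : inord 0 = lshift 2 (0 : 'I_2) by apply/val_inj; rewrite /= inordK.
have e1 : inord 1 = lshift 2 (1 : 'I_2) by apply/val_inj; rewrite /= inordK.
have e2 : inord 2 = rshift 2 (lshift 1 (0 : 'I_1)) by apply/val_inj; rewrite /= inordK.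
have e3 : inord 3 = rshift 2 (rshift 1 (0 : 'I_1)) by apply/val_inj; rewrite /= inordK.
congr br; apply/rowP => j; rewrite !mxE ?e0 ?e1 ?e2 ?e3.
- by rewrite (unsplitK (inl _)).
- by rewrite (unsplitK (inl _)).
- by rewrite (unsplitK (inr _)) mxE (unsplitK (inl _)).
- by rewrite (unsplitK (inr _)) mxE (unsplitK (inr _)).
Qed.

Lemma wedge_rows (M : 'M[F]_(2, 4)) k : wedge (row 0 M) (row 1 M) k =
  minor2 M (plucker_pair k).1 (plucker_pair k).2.
Proof. by rewrite /wedge /minor2 !mxE. Qed.

End Det4.

Section Rank2.
Variables (F : fieldType) (m : nat).
Implicit Type X : 'M[F]_(2, m).

Lemma ord2_sum (G : 'I_2 -> F) : \sum_(i < 2) G i = G 0 + G 1.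
Proof.
rewrite !big_ord_recl big_ord0 addr0; congr (G _ + G _); exact/val_inj.
Qed.

Lemma minor_rank2 X a b : X 0 a * X 1 b - X 0 b * X 1 a != 0 -> \rank X = 2%N.
Proof.
move=> nz; apply/eqP; rewrite -/(row_free X); apply/inj_row_free => u uX.
have ea : u 0 0 * X 0 a + u 0 1 * X 1 a = 0.
  by have /rowP/(_ a) := uX; rewrite !mxE ord2_sum.
have eb : u 0 0 * X 0 b + u 0 1 * X 1 b = 0.
  by have /rowP/(_ b) := uX; rewrite !mxE ord2_sum.
have u0 : u 0 0 = 0.
  apply: (mulIf nz); rewrite mul0r.
  have -> : u 0 0 * (X 0 a * X 1 b - X 0 b * X 1 a) =
    (u 0 0 * X 0 a + u 0 1 * X 1 a) * X 1 b - (u 0 0 * X 0 b + u 0 1 * X 1 b) * X 1 a by ring.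
  by rewrite ea eb; ring.
have u1 : u 0 1 = 0.
  apply: (mulIf nz); rewrite mul0r.
  have -> : u 0 1 * (X 0 a * X 1 b - X 0 b * X 1 a) =
    (u 0 0 * X 0 b + u 0 1 * X 1 b) * X 0 a - (u 0 0 * X 0 a + u 0 1 * X 1 a) * X 0 b by ring.
  by rewrite ea eb; ring.
apply/rowP => j; rewrite !mxE.
case: j => -[|[|//]] lj; [rewrite -[RHS]u0 | rewrite -[RHS]u1]; congr (u _ _); exact/val_inj.
Qed.

Lemma rank2_minor X : \rank X = 2%N -> exists a b, X 0 a * X 1 b - X 0 b * X 1 a != 0.
Proof.
move=> rX; apply: NNPP => no.
have z a b : X 0 a * X 1 b = X 0 b * X 1 a.
  apply/eqP; rewrite -subr_eq0; apply/negPn/negP => nz; apply: no; by exists a, b.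
have fX : row_free X by rewrite /row_free rX.
have inj (u : 'rV_2) : u *m X = 0 -> u = 0.
  by move/eqP; rewrite mulmx_free_eq0 // => /eqP.
case: (classic (exists b, X 1 b != 0)) => [[b nzb]|allz]; last first.
  have /rowP/(_ 1) : delta_mx 0 1 = 0 :> 'rV[F]_2.
    apply: inj; apply/rowP => j; rewrite -rowE !mxE.
    by apply/eqP/negPn/negP => nz; apply: allz; exists j.
  by rewrite !mxE !eqxx => /eqP; rewrite oner_eq0.
(* If all minors vanish, [X 1 b] times the first row equals [X 0 b] times the second; this is that
   relation. *)
pose u : 'rV[F]_2 := \row_j (if j == 0 then X 1 b else - X 0 b).
have /rowP/(_ 0) : u = 0.
  apply: inj; apply/rowP => j; rewrite !mxE ord2_sum !mxE /= mulrC z; ring.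
by rewrite !mxE /= => /eqP; rewrite (negbTE nzb).
Qed.

End Rank2.

(** * Lines of projective three-space meeting given lines *)

Section Geometry.
Variable F : fieldType.
Implicit Types (A B p q r s : 'rV[F]_4) (v : 'I_6 -> F).

Lemma br0_dep A B p q : br A B p q = 0 ->
  exists a b c d, (a, b, c, d) <> (0, 0, 0, 0) /\ a *: A + b *: B + c *: p + d *: q = 0.
Proof.
move=> z.
pose X : 'M[F]_4 := \matrix_(i, j) (nth 0 [:: A; B; p; q] i 0 j).
have : \det X == 0.
  rewrite det4_br; apply/eqP; rewrite -[RHS]z; congr br; apply/rowP => j; by rewrite !mxE inordK.
case/det0P => u unz uX.
exists (co u 0), (co u 1), (co u 2), (co u 3); split.
  case=> u0 u1 u2 u3; case/negP: unz; apply/eqP; apply: rV4_eq; by rewrite co0.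
rewrite -{}uX; apply/rowP => j; rewrite !mxE.
have -> : \sum_(k < 4) u 0 k * X k j = \sum_(k < 4) u 0 (inord k) * X (inord k) j.
  by apply: eq_bigr => k _; rewrite inord_val.
by rewrite !big_ord_recl big_ord0 /= /bump /= !mxE !inordK //= addr0 !addrA.
Qed.

Lemma wedge_nz_free p q k : wedge p q k <> 0 -> forall x y, x *: p + y *: q = 0 -> x = 0 /\ y = 0.
Proof.
move=> nz x y e.
have e1 : x * wedge p q k = 0.
  have : wedge (x *: p + y *: q) q k = 0 by rewrite e wedge0l.
  by rewrite wedgeDl !wedgeZl wedgevv mulr0 addr0.
have e2 : y * wedge p q k = 0.
  have : wedge p (x *: p + y *: q) k = 0 by rewrite e wedge0r.
  by rewrite wedgeDr !wedgeZr wedgevv mulr0 add0r.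
by split; apply: (mulIf (introN eqP nz)); rewrite mul0r.
Qed.

Lemma br_free A B p q : br A B p q <> 0 ->
  forall x y z w, x *: A + y *: B + z *: p + w *: q = 0 -> [/\ x = 0, y = 0, z = 0 & w = 0].
Proof.
move=> /eqP nz x y z w e; split; apply: (mulIf nz); rewrite mul0r.
- have : br (x *: A + y *: B + z *: p + w *: q) B p q = 0 by rewrite e -(scale0r 0) brZa mul0r.
  by rewrite !brE !br_aabb !mulr0 !addr0.
- have : br A (x *: A + y *: B + z *: p + w *: q) p q = 0 by rewrite e -(scale0r 0) brZb mul0r.
  by rewrite !brE !br_aabb !mulr0 !addr0 add0r.
- have : br A B (x *: A + y *: B + z *: p + w *: q) q = 0 by rewrite e -(scale0r 0) brZc mul0r.
  by rewrite !brE !br_aabb !mulr0 !addr0 !add0r.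
- have : br A B p (x *: A + y *: B + z *: p + w *: q) = 0 by rewrite e -(scale0r 0) brZd mul0r.
  by rewrite !brE !br_aabb !mulr0 !add0r.
Qed.

Lemma scalerI (a : F) A B : a != 0 -> a *: A = B -> A = a^-1 *: B.
Proof. by move=> nz <-; rewrite scalerA mulVf // scale1r. Qed.

(** A linear relation between [A], [B], [p], [q] exhibits a common point of the two lines, which
    replaces whichever of [A], [B] has a nonzero coefficient. Scalars stay in the coefficients, so
    the bivectors are equal and not only proportional. *)
Lemma meet_line A B p q k : wedge p q k <> 0 -> br A B p q = 0 ->
  exists x y C, wedge A B = wedge (x *: p + y *: q) C.
Proof.
move=> nz /br0_dep[a [b [c [d [nzr e]]]]].
have [a0|anz] := eqVneq a 0.
  have [b0|bnz] := eqVneq b 0.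
    move: e; rewrite a0 b0 !scale0r !add0r => /(wedge_nz_free nz)[c0 d0].
    by case: nzr; rewrite a0 b0 c0 d0.
  have -> : B = b^-1 *: (- (c *: p + d *: q)).
    by apply: scalerI bnz _; apply/eqP; rewrite -addr_eq0 -e a0 scale0r add0r addrA.
  exists (b^-1 * c), (b^-1 * d), A.
  apply: functional_extensionality => l.
  rewrite [LHS]wedgeC wedgeZl -scaleN1r wedgeZl !(wedgeDl, wedgeZl).
  ring.
have -> : A = a^-1 *: (- (b *: B + c *: p + d *: q)).
  by apply: scalerI anz _; apply/eqP; rewrite -addr_eq0 -e !addrA.
exists (- (a^-1 * c)), (- (a^-1 * d)), B.
apply: functional_extensionality => l.
rewrite -scaleN1r !(wedgeDl, wedgeZl) wedgevv; ring.
Qed.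

(** The relation between the first point, [B], [r] and [s] is solved for [B]. If [B] had coefficient
    zero, the first point would lie on both skew lines. *)
Lemma meet_two x y p q r s B k : br p q r s <> 0 -> wedge (x *: p + y *: q) B k <> 0 ->
  br (x *: p + y *: q) B r s = 0 ->
  exists z w, wedge (x *: p + y *: q) B = wedge (x *: p + y *: q) (z *: r + w *: s).
Proof.
set A := x *: p + y *: q => nz nzA /br0_dep[a [b [c [d [nzr e]]]]].
have [b0|bnz] := eqVneq b 0.
  have [|ax ay c0 d0] := br_free nz (x := a * x) (y := a * y) (z := c) (w := d).
    by rewrite -e b0 scale0r addr0 /A scalerDr !scalerA.
  have anz : a != 0 by apply/eqP => a0; apply: nzr; rewrite a0 b0 c0 d0.
  case: nzA; rewrite /A.
  have -> : x = 0 by apply: (mulfI anz); rewrite ax mulr0.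
  have -> : y = 0 by apply: (mulfI anz); rewrite ay mulr0.
  by rewrite !scale0r addr0 wedge0l.
clearbody A.
have -> : B = b^-1 *: (- (a *: A + c *: r + d *: s)).
  by apply: scalerI bnz _; apply/eqP; rewrite -addr_eq0 -e !addrA [b *: B + _]addrC.
exists (- (b^-1 * c)), (- (b^-1 * d)).
apply: functional_extensionality => l.
rewrite -scaleN1r !(wedgeDr, wedgeZr) wedgevv; ring.
Qed.

End Geometry.

(** * Polynomial functions and density *)

Section PolynomialFunctions.
Variable F : fieldType.
Hypothesis char0 : forall n, n.+1%:R != 0 :> F.

Lemma natr_inj (m k : nat) : m%:R = k%:R :> F -> m = k.
Proof.
wlog le : m k / (m <= k)%N => [th|].
  by case/orP: (leq_total m k) => le e; [|symmetry]; apply: th.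
move/eqP; rewrite -subr_eq0 -opprB oppr_eq0 -natrB //.
case e : (k - m)%N => [|j]; last by rewrite (negbTE (char0 j)).
move=> _; lia.
Qed.

Lemma poly_everywhere0 (p : {poly F}) : (forall t, p.[t] = 0) -> p = 0.
Proof.
move=> z; apply/eqP/negPn/negP => nz.
have := @max_poly_roots _ p [seq i%:R | i <- iota 0 (size p)] nz.
rewrite size_map size_iota ltnn; move=> h; suff: false by [].
apply: h; first by apply/allP => x _; rewrite rootE z.
by rewrite map_inj_uniq ?iota_uniq //; apply: natr_inj.
Qed.

Definition polyfun (h : F -> F) := exists p : {poly F}, forall t, h t = p.[t].

Lemma polyfun_cst c : polyfun (fun=> c).
Proof. by exists c%:P => t; rewrite hornerC. Qed.
Lemma polyfunD f g : polyfun f -> polyfun g -> polyfun (fun t => f t + g t).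
Proof. by move=> [p hp] [q hq]; exists (p + q) => t; rewrite hornerD hp hq. Qed.
Lemma polyfunM f g : polyfun f -> polyfun g -> polyfun (fun t => f t * g t).
Proof. by move=> [p hp] [q hq]; exists (p * q) => t; rewrite hornerM hp hq. Qed.

Lemma polyfun_density f g t0 : polyfun f -> polyfun g -> g t0 != 0 ->
  (forall t, g t != 0 -> f t = 0) -> forall t, f t = 0.
Proof.
move=> [p hp] [q hq] nz z t.
have pq : p * q = 0.
  apply: poly_everywhere0 => s; rewrite hornerM -hp -hq.
  by have [->|/z ->] := eqVneq (g s) 0; rewrite ?mulr0 ?mul0r.
move/eqP: pq; rewrite mulf_eq0 => /orP[]/eqP e; first by rewrite hp e horner0.
by move: nz; rewrite hq e horner0 eqxx.
Qed.

Section Lines.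
Variable V : lmodType F.
Implicit Types f g : V -> F.

(** Polynomial on every affine line. This weak notion needs no coordinates on [V], is stable under
    the ring operations, and suffices for density arguments because two points always lie on a
    line. *)
Definition linepoly f := forall u w, polyfun (fun t => f (u + t *: w)).

Lemma linepoly_ext f g : f =1 g -> linepoly f -> linepoly g.
Proof. by move=> e h u w; have [p hp] := h u w; exists p => t; rewrite -e. Qed.
Lemma linepoly_cst c : linepoly (fun=> c).
Proof. move=> u w; exact: polyfun_cst. Qed.
Lemma linepolyD f g : linepoly f -> linepoly g -> linepoly (fun u => f u + g u).
Proof. by move=> hf hg u w; apply: polyfunD. Qed.
Lemma linepolyM f g : linepoly f -> linepoly g -> linepoly (fun u => f u * g u).
Proof. by move=> hf hg u w; apply: polyfunM. Qed.
Lemma linepolyN f : linepoly f -> linepoly (fun u => - f u).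
Proof.
move=> hf; apply: (linepoly_ext (f := fun u => -1 * f u)); first by move=> u; rewrite mulN1r.
exact/linepolyM/hf/linepoly_cst.
Qed.
Lemma linepolyB f g : linepoly f -> linepoly g -> linepoly (fun u => f u - g u).
Proof. by move=> hf hg; apply/linepolyD/linepolyN. Qed.
Lemma linepolyX f k : linepoly f -> linepoly (fun u => f u ^+ k).
Proof.
move=> hf; elim: k => [|k IH].
  by apply: (linepoly_ext (f := fun=> 1)); [move=> u; rewrite expr0|apply: linepoly_cst].
apply: (linepoly_ext (f := fun u => f u * f u ^+ k)); first by move=> u; rewrite exprS.
exact: linepolyM.
Qed.
Lemma linepoly_sum (I : Type) (r : seq I) (P : pred I) (f : I -> V -> F) :
  (forall i, linepoly (f i)) -> linepoly (fun u => \sum_(i <- r | P i) f i u).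
Proof.
move=> hf; elim: r => [|i r IH].
  by apply: (linepoly_ext (f := fun=> 0)); [move=> u; rewrite big_nil|apply: linepoly_cst].
apply: (linepoly_ext (f := fun u => (if P i then f i u else 0) + \sum_(i <- r | P i) f i u)).
  by move=> u; rewrite big_cons; case: (P i); rewrite ?add0r.
by apply: linepolyD => //; case: (P i) => //; apply: linepoly_cst.
Qed.
Lemma linepoly_prod (I : Type) (r : seq I) (P : pred I) (f : I -> V -> F) :
  (forall i, linepoly (f i)) -> linepoly (fun u => \prod_(i <- r | P i) f i u).
Proof.
move=> hf; elim: r => [|i r IH].
  by apply: (linepoly_ext (f := fun=> 1)); [move=> u; rewrite big_nil|apply: linepoly_cst].
apply: (linepoly_ext (f := fun u => (if P i then f i u else 1) * \prod_(i <- r | P i) f i u)).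
  by move=> u; rewrite big_cons; case: (P i); rewrite ?mul1r.
by apply: linepolyM => //; case: (P i) => //; apply: linepoly_cst.
Qed.
Lemma linepoly_affine f : (forall u w t, f (u + t *: w) = f u + t * f w) -> linepoly f.
Proof.
move=> h u w; exists ((f u)%:P + 'X * (f w)%:P) => t.
by rewrite h !hornerE.
Qed.

(** On the line joining [u] to [u0] this is the one-variable statement that a polynomial ring is a
    domain. *)
Lemma linepoly_density f g u0 : linepoly f -> linepoly g -> g u0 != 0 ->
  (forall u, g u != 0 -> f u = 0) -> forall u, f u = 0.
Proof.
move=> hf hg nz z u.
have e0 : u + 0 *: (u0 - u) = u by rewrite scale0r addr0.
have e1 : u + 1 *: (u0 - u) = u0 by rewrite scale1r addrC subrK.
rewrite -e0.
apply: (polyfun_density (t0 := 1) (hf u (u0 - u)) (hg u (u0 - u))); first by rewrite e1.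
by move=> t; apply: z.
Qed.

(** Finitely many nonempty open conditions on a vector space hold simultaneously somewhere; this
    supplies every general point below. *)
Lemma linepoly_prod_nz (I : eqType) (r : seq I) (P : pred I) (f : I -> V -> F) :
  (forall i, linepoly (f i)) -> (forall i, i \in r -> P i -> exists u, f i u != 0) ->
  exists u, \prod_(i <- r | P i) f i u != 0.
Proof.
move=> hf; elim: r => [|i r IH] nz; first by exists 0; rewrite big_nil oner_neq0.
case: IH => [j jr Pj|u0 hu0]; first by apply: nz => //; rewrite inE jr orbT.
case Pi : (P i); last by exists u0; rewrite big_cons Pi.
apply: NNPP => no; have [|u1] := nz i _ Pi; first by rewrite inE eqxx.
move=> /eqP[]; apply: (linepoly_density (hf i) (linepoly_prod (f := f) r P hf) hu0) => u gu.
apply/eqP/negPn/negP => fu; apply: no; exists u.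
by rewrite big_cons Pi mulf_neq0.
Qed.

Lemma linepoly_meval m (f : {mpoly F[m]}) (phi : V -> 'I_m -> F) :
  (forall k, linepoly (fun u => phi u k)) -> linepoly (fun u => f.@[phi u]).
Proof.
move=> h.
apply: (linepoly_ext (f := fun u => \sum_(mo <- msupp f) f@_mo * \prod_i phi u i ^+ mo i)).
  by move=> u; rewrite mevalE.
apply: linepoly_sum => mo; apply: linepolyM; first exact: linepoly_cst.
by apply: linepoly_prod => i; apply: linepolyX.
Qed.

End Lines.
End PolynomialFunctions.

Lemma C_char0 n : n.+1%:R != 0 :> C.
Proof.
have e : n.+1%:R = Complex (n.+1%:R : R) 0 :> C.
  elim: n => [|n IH] //.
  rewrite -[n.+2]addn1 natrD IH; transitivity (Complex (n.+1%:R + 1 : R) (0 + 0)) => //.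
  by rewrite addr0 natrD.
by rewrite e; apply/eqP => -[] /eqP; rewrite pnatr_eq0.
Qed.

Lemma Gr_nz v : Gr v -> exists k, v k != 0.
Proof.
case=> M [/rank2_minor[a [b nz]] ->]; apply: NNPP => no.
have z k : plucker M k = 0 by apply/eqP/negPn/negP => nzk; apply: no; exists k.
move: (z (inord 0)) (z (inord 1)) (z (inord 2)) (z (inord 3)) (z (inord 4)) (z (inord 5)).
rewrite /plucker /minor2 /plucker_pair /= !inordK //=.
move=> z0 z1 z2 z3 z4 z5; case/negP: nz; apply/eqP.
elim/ord4_ind: a; elim/ord4_ind: b; rewrite ?subrr //.
all: by apply: oppr_inj; rewrite opprB oppr0.
Qed.

Lemma plucker_wedge M : plucker M = wedge (row 0 M) (row 1 M).
Proof. by apply: functional_extensionality => k; rewrite wedge_rows. Qed.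

Lemma wedge_Gr A B k : wedge A B k != 0 -> Gr (wedge A B).
Proof.
pose M : 'M[C]_(2, 4) := \matrix_(i, j) (if i == 0 then A 0 j else B 0 j).
have eM : wedge A B = plucker M.
  by rewrite plucker_wedge; congr wedge; apply/rowP => j; rewrite !mxE.
move=> nz; exists M; split=> //.
by apply: minor_rank2; move: nz; rewrite eM; apply.
Qed.

Lemma GrP v : Gr v -> exists A B, v = wedge A B.
Proof. by case=> M [_ ->]; exists (row 0 M), (row 1 M); apply: plucker_wedge. Qed.

(** A polynomial image of a vector space is irreducible. The map may take the value 0, which is not
    a point of the Grassmannian, so [phi u] is required to lie in [S] only where it is nonzero. *)
Lemma irreducible_param (V : lmodType C) (phi : V -> 'I_6 -> C) (S : cset) :
  (forall k, linepoly (fun u => phi u k)) -> zclosed S -> (exists v, S v) ->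
  (forall u k, phi u k != 0 -> S (phi u)) -> (forall v, S v -> exists u, v = phi u) ->
  irreducible S.
Proof.
move=> lp zS neS into onto; split=> // S1 S2 [F1 h1] [F2 h2] sub; apply: NNPP => no.
have out (T : cset) F' : (forall v, T v <-> Gr v /\ forall f, F' f -> f.@[v] = 0) ->
    ~ csub S T -> exists f u, F' f /\ f.@[phi u] != 0.
  move=> hT nsub; apply: NNPP => nof; apply: nsub => v Sv; apply/hT.
  case: zS => FS hS; split; first by case/hS: Sv.
  move=> f Ff; apply/eqP/negPn/negP => nz; apply: nof.
  by have [u e] := onto v Sv; exists f, u; rewrite -e.
have [f1 [u1 [F1f nz1]]] := out _ _ h1 (fun h => no (or_introl h)).
have [f2 [u2 [F2f nz2]]] := out _ _ h2 (fun h => no (or_intror h)).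
have [k [u0 nz0]] : exists k u, phi u k != 0.
  case: neS => v Sv; have [u e] := onto v Sv.
  have [k nz] : exists k, v k != 0 by case: zS => FS hS; apply: Gr_nz; case/hS: Sv.
  by exists k, u; rewrite -e.
(* Three open conditions: [phi u] is outside [S1], outside [S2], and nonzero. *)
pose f (i : nat) u := if i is 0 then f1.@[phi u] else if i is 1 then f2.@[phi u] else phi u k.
have [] := @linepoly_prod_nz _ C_char0 _ _ [:: 0; 1; 2]%N predT f.
- by case=> [|[|i]]; rewrite /f //; apply: linepoly_meval.
- by case=> [|[|i]] _ _; [exists u1|exists u2|exists u0].
move=> u; rewrite !big_cons big_nil /= mulr1 !mulf_eq0 !negb_or => /and3P[n1 n2 nk].
case: (sub _ (into _ _ nk)); first by move/h1 => [_ /(_ _ F1f)/eqP]; rewrite (negbTE n1).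
by move/h2 => [_ /(_ _ F2f)/eqP]; rewrite (negbTE n2).
Qed.

(** Uniqueness of base [N] digits, which keeps distinct monomials distinct under Kronecker
    substitution. *)
Lemma digits_inj N k (f g : nat -> nat) : (forall i, (f i < N)%N) -> (forall i, (g i < N)%N) ->
  (\sum_(i < k) f i * N ^ i = \sum_(i < k) g i * N ^ i)%N -> forall i, (i < k)%N -> f i = g i.
Proof.
elim: k f g => [|k IH] f g hf hg // e.
have shift (h : nat -> nat) : (\sum_(i < k.+1) h i * N ^ i = (\sum_(i < k) h i.+1 * N ^ i) * N + h 0)%N.
  rewrite big_ord_recl /= expn0 muln1 addnC; congr addn.
  by rewrite big_distrl /=; apply: eq_bigr => i _; rewrite /bump /= add1n expnS mulnCA mulnC.
move: e; rewrite !shift => e.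
have e0 : f 0%N = g 0%N.
  by have := congr1 (modn ^~ N) e; rewrite !modnMDl !modn_small.
have N0 : (0 < N)%N by apply: leq_ltn_trans (hf 0%N).
move: e; rewrite e0 => /addIn/eqP; rewrite eqn_pmul2r // => /eqP e.
case=> [|i] // lt; exact: (IH (fun i => f i.+1) (fun i => g i.+1)).
Qed.

(** * Polynomials vanishing on the Grassmannian *)

Section Vanishing.
Variable F : fieldType.
Hypothesis char0 : forall n, n.+1%:R != 0 :> F.

(* Kronecker substitution [X_i := t ^ (N ^ i)]. *)
Lemma mpoly_everywhere0 n (p : {mpoly F[n]}) : (forall v, p.@[v] = 0) -> p = 0.
Proof.
move=> z; pose N := msize p; pose e (m : 'X_{1..n}) := (\sum_(i < n) m i * N ^ i)%N.
have bound m i : m \in msupp p -> (m i < N)%N.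
  move=> mp; apply: leq_ltn_trans (msize_mdeg_lt mp).
  by rewrite mdegE (bigD1 i) //= leq_addr.
have einj : {in msupp p &, injective e}.
  move=> m1 m2 h1 h2 e12; apply/mnmP => i.
  pose f (m : 'X_{1..n}) (j : nat) := if insub j is Some i then m (i : 'I_n) else 0%N.
  have fE m (j : 'I_n) : f m j = m j by rewrite /f valK.
  have N0 : (0 < N)%N by apply: leq_ltn_trans (bound _ i h1).
  have fb m : m \in msupp p -> forall j, (f m j < N)%N.
    by move=> mp j; rewrite /f; case: insub => [?|] //; apply: bound.
  rewrite -!fE; apply: (@digits_inj N n) => //; try exact: fb.
  have fe m : (\sum_(j < n) f m j * N ^ j)%N = e m by apply: eq_bigr => j _; rewrite fE.
  by rewrite !fe.
pose q : {poly F} := \sum_(m <- msupp p) p@_m *: 'X^(e m).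
have q0 : q = 0.
  apply: (poly_everywhere0 char0) => t; rewrite -[RHS](z (fun i : 'I_n => t ^+ (N ^ i))) mevalE.
  rewrite /q horner_sum; apply: eq_bigr => m _; rewrite hornerZ hornerXn; congr (_ * _).
  rewrite /e; elim/big_ind2: _ => //; first by move=> a b c d <- <-; rewrite exprD.
  by move=> i _; rewrite -exprM mulnC.
apply/mpolyP => m; rewrite mcoeff0.
have [mp|mp] := boolP (m \in msupp p); last by rewrite memN_msupp_eq0.
have := congr1 (fun r : {poly F} => r`_(e m)) q0.
rewrite coef0 /q coef_sum (bigD1_seq m) //=.
rewrite coefZ coefXn eqxx mulr1 big_seq_cond big1 ?addr0 //.
move=> m' /andP[mp' ne]; rewrite coefZ coefXn; case: eqP => [h|_]; last by rewrite mulr0.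
by rewrite (einj _ _ mp mp' h) eqxx in ne.
Qed.

Lemma mpoly_ext n (p q : {mpoly F[n]}) : (forall v, p.@[v] = q.@[v]) -> p = q.
Proof.
move=> e; apply/eqP; rewrite -subr_eq0; apply/eqP/mpoly_everywhere0 => v.
by rewrite mevalB e subrr.
Qed.

Lemma meval_homog n d (f : {mpoly F[n]}) c v : f \is d.-homog ->
  f.@[fun i => c * v i] = c ^+ d * f.@[v].
Proof.
move=> /dhomogP hf; rewrite !mevalE big_distrr /= !big_seq; apply: eq_bigr => m /hf <-.
rewrite mulrCA; congr (_ * _); rewrite /= mdegE -prodrXr -big_split /=.
by apply: eq_bigr => i _; rewrite exprMn.
Qed.

Section Congruence.
Variables (n : nat) (h : {mpoly F[n]}).

Definition mcong (p q : {mpoly F[n]}) := exists r, p - q = r * h.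

Lemma mcong_refl p : mcong p p. Proof. by exists 0; rewrite subrr mul0r. Qed.
Lemma mcongD p q p' q' : mcong p q -> mcong p' q' -> mcong (p + p') (q + q').
Proof. by move=> [r e] [r' e']; exists (r + r'); rewrite mulrDl -e -e'; ring. Qed.
Lemma mcongM p q p' q' : mcong p q -> mcong p' q' -> mcong (p * p') (q * q').
Proof.
move=> [r e] [r' e']; exists (r * p' + q * r').
rewrite (_ : p * p' - q * q' = (p - q) * p' + q * (p' - q')); last by ring.
by rewrite e e'; ring.
Qed.
Lemma mcong_comp m (f : {mpoly F[m]}) (lp lq : m.-tuple {mpoly F[n]}) :
  (forall i, mcong (tnth lp i) (tnth lq i)) -> mcong (f \mPo lp) (f \mPo lq).
Proof.
move=> hc; rewrite !comp_mpolyE; elim/big_ind2: _ => [||mo _]; first exact: mcong_refl.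
  by move=> *; apply: mcongD.
rewrite -!mul_mpolyC; apply: mcongM; first exact: mcong_refl.
elim/big_ind2: _ => [||i _]; [exact: mcong_refl|by move=> *; apply: mcongM|].
by elim: (mo i) => [|k IH]; rewrite ?expr0 ?exprS; [apply: mcong_refl|apply: mcongM].
Qed.
End Congruence.

(** The Plücker relation over any field [F]; for [F = C] it is [pluckerRel]. *)
Definition plRel : {mpoly F[6]} :=
  'X_(inord 0) * 'X_(inord 5) - 'X_(inord 1) * 'X_(inord 4)
  + 'X_(inord 2) * 'X_(inord 3).

Definition plmult (f : {mpoly F[6]}) := exists q : {mpoly F[6]}, f = q * plRel.

Lemma plRel_eval v : plRel.@[v] =
  v (inord 0) * v (inord 5) - v (inord 1) * v (inord 4) + v (inord 2) * v (inord 3).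
Proof. by rewrite /plRel mevalD mevalB !mevalM !mevalXU. Qed.

(** [X_5] is not a zero divisor modulo the relation: setting [X_5 = 0] in [X_5 g = q * plRel] kills
    the left side, while [plRel] becomes the nonzero [X_2 X_3 - X_1 X_4]. So [q] is divisible by
    [X_5]. *)
Lemma plmult_cancelX (g : {mpoly F[6]}) : plmult ('X_(inord 5) * g) -> plmult g.
Proof.
case=> q e.
pose lp : 6.-tuple {mpoly F[6]} := [tuple 'X_i | i < 6].
pose lq : 6.-tuple {mpoly F[6]} := [tuple (if i == 5%N :> nat then 0 else 'X_i) | i < 6].
have [r hr] : mcong ('X_(inord 5)) (q \mPo lp) (q \mPo lq).
  apply: mcong_comp => i; rewrite !tnth_mktuple.
  case: eqP => [e5|_]; last exact: mcong_refl.
  have -> : i = inord 5 by apply: val_inj; rewrite /= inordK.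
  by exists 1; rewrite subr0 mul1r.
have q0 : q \mPo lq = 0.
  have : (q \mPo lq) * (plRel \mPo lq) = 0.
    apply: mpoly_ext => v; pose w i := (tnth lq i).@[v].
    transitivity (q * plRel).@[w].
      by rewrite [LHS]mevalM [RHS]mevalM; congr (_ * _); apply: comp_mpoly_meval.
    by rewrite -e [LHS]mevalM mevalXU /w tnth_mktuple inordK // !meval0 mul0r.
  move/eqP; rewrite mulf_eq0 => /orP[/eqP//|/eqP z].
  (* A point where [X_2 X_3 - X_1 X_4] takes the value 1. *)
  pose v (i : 'I_6) : F := nth 0 [:: 0; 0; 1; 1] i.
  have [w wE] : exists2 w : 'I_6 -> F, (forall i, w i = if i == 5%N :> nat then 0 else v i) &
      plRel.@[w] = 0.
    exists (fun i => (tnth lq i).@[v]) => [i|]; last by rewrite -comp_mpoly_meval z meval0.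
    by rewrite tnth_mktuple; case: ifP => _; rewrite ?meval0 ?mevalXU.
  have w1 : w (inord 1) = 0 by rewrite wE /v inordK.
  have w2 : w (inord 2) = 1 by rewrite wE /v inordK.
  have w3 : w (inord 3) = 1 by rewrite wE /v inordK.
  have w5 : w (inord 5) = 0 by rewrite wE /v inordK.
  rewrite plRel_eval w1 w2 w3 w5.
  have key (K : comNzRingType) (a b : K) : a * 0 - 0 * b + 1 * 1 = 1 by ring.
  by rewrite key => /eqP; rewrite oner_eq0.
have lpE : q \mPo lp = q by rewrite comp_mpoly_id.
exists r; apply: (@mulfI _ ('X_(inord 5) : {mpoly F[6]})).
  apply/eqP => z; have := congr1 (meval (fun=> 1)) z; rewrite mevalXU meval0 => /eqP.
  by rewrite oner_eq0.
by rewrite e -lpE -[q \mPo lp]subr0 -q0 hr; ring.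
Qed.

(** Modulo the relation [X_5 X_0 = X_1 X_4 - X_2 X_3], so [X_5 ^ d * f] is congruent to [f] after a
    substitution that parametrizes decomposable bivectors. The substituted polynomial vanishes
    identically, and the powers of [X_5] are then cancelled. *)
Lemma plmult_vanish d (f : {mpoly F[6]}) : f \is d.-homog ->
  (forall A B, f.@[wedge A B] = 0) -> plmult f.
Proof.
move=> hf z.
pose X k : {mpoly F[6]} := 'X_(inord k).
suff : plmult (X 5 ^+ d * f).
  by elim: d {hf} => [|d IH]; rewrite ?expr0 ?mul1r // exprS -mulrA => /plmult_cancelX.
pose lp : 6.-tuple {mpoly F[6]} := [tuple X 5 * 'X_i | i < 6].
pose lq : 6.-tuple {mpoly F[6]} :=
  [tuple (if i == 0%N :> nat then X 1 * X 4 - X 2 * X 3 else X 5 * 'X_i) | i < 6].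
have [r hr] : mcong plRel (f \mPo lp) (f \mPo lq).
  apply: mcong_comp => i; rewrite !tnth_mktuple.
  case: eqP => [e0|_]; last exact: mcong_refl.
  have -> : i = inord 0 by apply: val_inj; rewrite /= inordK.
  by exists 1; rewrite mul1r /plRel -!/(X _) opprB addrA addrAC mulrC.
have q0 : f \mPo lq = 0.
  apply: mpoly_ext => v; rewrite comp_mpoly_meval meval0.
  pose u k := v (inord k).
  (* The standard chart where the last Plücker coordinate is nonzero, cleared of denominators:
     [wedge A B] is the substituted point. *)
  pose A : 'rV[F]_4 := \row_j nth 0 [:: u 2; u 4; u 5; 0] j.
  pose B : 'rV[F]_4 := \row_j nth 0 [:: - u 1; - u 3; 0; u 5] j.
  rewrite -[RHS](z A B); apply: meval_eq => k; rewrite tnth_mktuple.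
  elim/ord6_ind: k; rewrite ?inordK //= wedgeE /co !mxE !inordK //= /X
    ?mevalB !mevalM !mevalXU -!/(u _); ring.
exists r; rewrite -hr q0 subr0; apply: mpoly_ext => v.
rewrite mevalM rmorphXn /= mevalXU comp_mpoly_meval -(meval_homog _ _ hf).
by apply: meval_eq => i; rewrite tnth_mktuple mevalM !mevalXU.
Qed.

End Vanishing.

Lemma zeroR_vanish d (f : {mpoly C[6]}) : f \is d.-homog ->
  (forall A B, f.@[wedge A B] = 0) -> zeroR f.
Proof. exact (@plmult_vanish C C_char0 d f). Qed.
(** * Cyclic indices and pencils *)

Lemma ordS_cases n (i : 'I_n) :
  (nat_of_ord (ordS i) = i.+1 /\ (i.+1 < n)%N) \/ (nat_of_ord (ordS i) = 0%N /\ i.+1 = n).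
Proof.
have := ltn_ord i; rewrite leq_eqVlt => /orP[/eqP e|lt]; [right|left]; split=> //=.
  by rewrite {1}e modnn.
by rewrite modn_small.
Qed.

Definition nadj n (i j : 'I_n) := [&& i != j, ordS i != j & i != ordS j].

Lemma ordS_neq n (i : 'I_n) : (4 <= n)%N ->
  [/\ i != ordS i, i != ordS (ordS i) & i != ordS (ordS (ordS i))].
Proof.
move=> n4; move: (ordS_cases i); move: (ltn_ord (ordS i)); move: (ordS i) => j.
move: (ordS_cases j); move: (ltn_ord (ordS j)); move: (ordS j) => k.
move: (ordS_cases k); move: (ltn_ord (ordS k)); move: (ordS k) => l.
rewrite -!val_eqE /=; move: (ltn_ord i) => *; split; lia.
Qed.

(* [lia] is exponential in the number of disequalities, so [ords] first tries the atomic goals by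
   injectivity of [ordS] and the absence of cycles of length at most 3. *)
Ltac ord_lia :=
  repeat match goal with H : is_true ?b |- _ =>
    lazymatch b with (4 <= _)%N => fail | _ => move: H end end;
  try match goal with H : is_true (4 <= _)%N |- _ => generalize H end;
  clear;
  repeat match goal with
  | |- context [@ordS ?n ?i] => is_var i; let j := fresh "j" in
     move: (ordS_cases i); move: (ltn_ord (ordS i)); move: (ltn_ord i); move: (ordS i) => j
  end;
  rewrite -?val_eqE /=;
  intros; lia.

Ltac ords :=
  repeat match goal with
  | H : is_true (nadj _ _) |- _ => move: H; rewrite /nadj => /and3P[? ? ?]
  | H : is_true (_ && _) |- _ => case/andP: H => ? ?
  | H : is_true (~~ (_ || _)) |- _ => rewrite negb_or in H
  | H : is_true (ordS _ != ordS _) |- _ => rewrite (inj_eq (@ordS_inj _)) in H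
  end;
  rewrite /nadj /uniq /= ?in_cons ?in_nil ?orbF ?andbT ?negb_or ?(inj_eq (@ordS_inj _));
  repeat (apply/andP; split);
  first [ assumption | by rewrite eq_sym
        | match goal with H : is_true (4 <= _)%N |- is_true (?x != ?y) =>
            first [by case: (ordS_neq x H) | by rewrite eq_sym; case: (ordS_neq y H)] end
        | ord_lia ].

Section Pencils.
Variable F : fieldType.
Implicit Types (A B : 'rV[F]_4) (f : {mpoly F[6]}).

Lemma size_mulS (p q : {poly F}) i j :
  (size p <= i.+1)%N -> (size q <= j.+1)%N -> (size (p * q)%R <= (i + j).+1)%N.
Proof.
move=> hp hq; apply: leq_trans (size_polyMleq p q) _.
move: (size p) (size q) hp hq => a b; lia.
Qed.

Lemma size_expS (p : {poly F}) k : (size p <= 2)%N -> (size (p ^+ k)%R <= k.+1)%N.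
Proof.
move=> sp; elim: k => [|k IH]; first by rewrite expr0 size_polyC oner_neq0.
rewrite exprS -[k.+1]add1n; exact: size_mulS.
Qed.

Lemma meval_line_size n d (f : {mpoly F[n]}) (v w : 'I_n -> F) : f \is d.-homog ->
  exists2 p : {poly F}, (size p <= d.+1)%N & forall t, f.@[fun i => v i + t * w i] = p.[t].
Proof.
move=> /dhomogP hf.
exists (\sum_(m <- msupp f) (f@_m)%:P * \prod_(i < n) ((v i)%:P + 'X * (w i)%:P) ^+ m i).
  rewrite big_seq; apply: (big_ind (fun p : {poly F} => (size p <= d.+1)%N)).
  - by rewrite size_poly0.
  - by move=> p q hp hq; apply: leq_trans (size_polyD _ _) _; rewrite geq_max hp hq.
  move=> m /hf <-; rewrite mul_polyC; apply: leq_trans (size_scale_leq _ _) _.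
  rewrite /= mdegE.
  elim/big_rec2: _ => [|i a p _ IH]; first by rewrite size_polyC oner_neq0.
  apply: size_mulS IH; apply: size_expS.
  apply: leq_trans (size_polyD _ _) _; rewrite geq_max size_polyC.
  rewrite (leq_trans (leq_b1 _)) //= mulrC mul_polyC.
  by apply: leq_trans (size_scale_leq _ _) _; rewrite size_polyX.
move=> t; rewrite mevalE horner_sum; apply: eq_bigr => m _.
rewrite hornerM hornerC horner_prod; congr (_ * _); apply: eq_bigr => i _.
by rewrite horner_exp !hornerE.
Qed.

Lemma meval_pencil_size d f A B0 B1 : f \is d.-homog ->
  exists2 p : {poly F}, (size p <= d.+1)%N & forall t, f.@[wedge A (B0 + t *: B1)] = p.[t].
Proof.
move=> hf; have [p sp hp] := meval_line_size (wedge A B0) (wedge A B1) hf.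
by exists p => // t; rewrite -hp; apply: meval_eq => k; rewrite wedgeDr wedgeZr.
Qed.

Section Roots.
Variables (I : finType) (K : {set I}) (a b : I -> F).
Hypothesis bnz : forall k, k \in K -> b k != 0.
Hypothesis dist : forall k l, k \in K -> l \in K -> k != l -> a k * b l - a l * b k != 0.

(** In the applications [a k + t * b k] is [l_k] along a pencil. Then [bnz] says that the pencil
    meets [D_k] at a finite parameter, and [dist] that these parameters differ. *)
Let rts := [seq - (a k / b k) | k <- enum K].

Lemma rts_uniq : uniq rts.
Proof.
rewrite map_inj_in_uniq ?enum_uniq // => k l; rewrite !mem_enum => hk hl /oppr_inj/eqP e.
apply/eqP/negPn/negP => ne; have := dist hk hl ne.
by rewrite eqr_div ?bnz // in e; rewrite subr_eq0 (eqP e) mulrC [_ * a l]mulrC eqxx.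
Qed.

Lemma rts_size : size rts = #|K|. Proof. by rewrite size_map -cardE. Qed.

Lemma rtsP t : t \in rts -> exists2 k, k \in K & a k + t * b k = 0.
Proof.
case/mapP => k; rewrite mem_enum => hk ->; exists k => //.
by rewrite mulNr divfK ?bnz // subrr.
Qed.

Lemma pencil_zero d f A B0 B1 : f \is d.-homog -> (d < #|K|)%N ->
  (forall k t, k \in K -> a k + t * b k = 0 -> f.@[wedge A (B0 + t *: B1)] = 0) ->
  forall t, f.@[wedge A (B0 + t *: B1)] = 0.
Proof.
move=> hf dK z t; have [p sp hp] := meval_pencil_size A B0 B1 hf.
rewrite hp (@roots_geq_poly_eq0 _ p rts) ?horner0 ?rts_uniq ?rts_size //.
  by apply/allP => s /rtsP[k hk e]; rewrite rootE -hp (z k).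
exact: leq_trans sp dK.
Qed.

(** Two polynomials of degree at most [d] with [d] common zeros are proportional: the combination
    that cancels at a further point [u] has one zero too many. *)
Lemma pencil_prop d f g A B0 B1 : f \is d.-homog -> g \is d.-homog -> (d <= #|K|)%N ->
  (forall k t, k \in K -> a k + t * b k = 0 ->
     f.@[wedge A (B0 + t *: B1)] = 0 /\ g.@[wedge A (B0 + t *: B1)] = 0) ->
  forall t u, f.@[wedge A (B0 + t *: B1)] * g.@[wedge A (B0 + u *: B1)] =
    f.@[wedge A (B0 + u *: B1)] * g.@[wedge A (B0 + t *: B1)].
Proof.
move=> hf hg dK z t u.
have [p sp hp] := meval_pencil_size A B0 B1 hf; have [q sq hq] := meval_pencil_size A B0 B1 hg.
rewrite !hp !hq.
have [/rtsP[k hk e]|ur] := boolP (u \in rts).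
  by have [] := z k u hk e; rewrite hp hq => -> ->; rewrite mulr0 mul0r.
suff e : q.[u] *: p - p.[u] *: q = 0.
  have := congr1 (horner^~ t) e; rewrite hornerD hornerN !hornerZ horner0 => /eqP.
  by rewrite subr_eq0 => /eqP <-; rewrite mulrC.
apply: (@roots_geq_poly_eq0 _ _ (u :: rts)).
- apply/andP; split; first by rewrite rootE hornerD hornerN !hornerZ mulrC subrr.
  apply/allP => s /rtsP[k hk e]; have [] := z k s hk e; rewrite hp hq => zp zq.
  by rewrite rootE hornerD hornerN !hornerZ zp zq !mulr0 subrr.
- by rewrite /= ur rts_uniq.
rewrite /= rts_size; apply: leq_trans (_ : (d.+1 <= _)%N) => //.
apply: leq_trans (size_polyD _ _) _; rewrite size_polyN geq_max.
by rewrite !(leq_trans (size_scale_leq _ _)).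
Qed.
End Roots.
End Pencils.

Section LineVectors.
Variables (F : fieldType) (V : lmodType F).

Definition linevec (a : V -> 'rV[F]_4) := forall j, linepoly (fun u => a u 0 j).

Lemma linevec_cst a : linevec (fun=> a).
Proof. move=> j; exact: linepoly_cst. Qed.
Lemma linevecD a b : linevec a -> linevec b -> linevec (fun u => a u + b u).
Proof.
move=> ha hb j; apply: (linepoly_ext (f := fun u => a u 0 j + b u 0 j)).
  by move=> u; rewrite mxE.
exact: linepolyD.
Qed.
Lemma linevecZ f a : linepoly f -> linevec a -> linevec (fun u => f u *: a u).
Proof.
move=> hf ha j; apply: (linepoly_ext (f := fun u => f u * a u 0 j)).
  by move=> u; rewrite mxE.
exact: linepolyM.
Qed.
Lemma linevec_linear (a : V -> 'rV[F]_4) :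
  (forall u w t, a (u + t *: w) = a u + t *: a w) -> linevec a.
Proof. by move=> h j; apply: linepoly_affine => u w t; rewrite h !mxE. Qed.

Lemma linepoly_wedge a b k : linevec a -> linevec b -> linepoly (fun u => wedge (a u) (b u) k).
Proof.
by move=> ha hb; rewrite /wedge; apply: linepolyB; [exact: linepolyM (ha _) (hb _)|exact: linepolyM (ha _) (hb _)].
Qed.

Lemma linepoly_br a b c d : linevec a -> linevec b -> linevec c -> linevec d ->
  linepoly (fun u => br (a u) (b u) (c u) (d u)).
Proof.
move=> ha hb hc hd; rewrite /br /pairing.
by repeat (apply: linepolyB || apply: linepolyD); apply: linepolyM; apply: linepoly_wedge.
Qed.

Lemma linepoly_mevalw (f : {mpoly F[6]}) a b : linevec a -> linevec b ->
  linepoly (fun u => f.@[wedge (a u) (b u)]).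
Proof. by move=> ha hb; apply: linepoly_meval => k; apply: linepoly_wedge. Qed.

Lemma linepoly_mul_nz (f g : V -> F) : (forall n, n.+1%:R != 0 :> F) ->
  linepoly f -> linepoly g -> (exists u, f u != 0) -> (exists u, g u != 0) ->
  exists u, f u * g u != 0.
Proof.
move=> char0 hf hg nf ng.
have [||u] := @linepoly_prod_nz F char0 V _ [:: true; false] predT (fun b => if b then f else g).
- by case.
- by case.
by rewrite !big_cons big_nil /= mulr1 => nz; exists u.
Qed.
End LineVectors.

Section Projections.
Variable F : fieldType.

Lemma linepoly_id : linepoly (fun u : F^o => u : F).
Proof. by apply: linepoly_affine. Qed.
Lemma linepoly_fst (V W : lmodType F) (f : V -> F) : linepoly f -> linepoly (fun u : V * W => f u.1).
Proof. by move=> h u w; apply: h. Qed.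
Lemma linepoly_snd (V W : lmodType F) (f : W -> F) : linepoly f -> linepoly (fun u : V * W => f u.2).
Proof. by move=> h u w; apply: h. Qed.

Let T2 : lmodType F := (F^o * F^o)%type.
Let T3 : lmodType F := (T2 * F^o)%type.

Lemma linepoly_pair : linepoly (fun u : T2 => u.1 : F) /\ linepoly (fun u : T2 => u.2 : F).
Proof. by split; [exact: (@linepoly_fst F^o F^o _ linepoly_id)|exact: (@linepoly_snd F^o F^o _ linepoly_id)]. Qed.

Lemma linepoly_triple : [/\ linepoly (fun u : T3 => u.1.1 : F), linepoly (fun u : T3 => u.1.2 : F) &
  linepoly (fun u : T3 => u.2 : F)].
Proof.
have [h1 h2] := linepoly_pair.
by split; [apply: (@linepoly_fst T2 F^o _ h1)|apply: (@linepoly_fst T2 F^o _ h2)|exact: (@linepoly_snd T2 F^o _ linepoly_id)].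
Qed.

Lemma linepoly_pair2 : [/\ linepoly (fun u : T2 * T2 => u.1.1 : F), linepoly (fun u : T2 * T2 => u.1.2 : F),
  linepoly (fun u : T2 * T2 => u.2.1 : F) & linepoly (fun u : T2 * T2 => u.2.2 : F)].
Proof.
have [h1 h2] := linepoly_pair.
by split; [apply: (@linepoly_fst T2 T2 _ h1)|apply: (@linepoly_fst T2 T2 _ h2)|
  apply: (@linepoly_snd T2 T2 _ h1)|apply: (@linepoly_snd T2 T2 _ h2)].
Qed.

Lemma linepoly_triple2 :
  [/\ linepoly (fun u : T3 * T3 => u.1.1.1 : F), linepoly (fun u : T3 * T3 => u.1.1.2 : F) &
      linepoly (fun u : T3 * T3 => u.1.2 : F)] /\
  [/\ linepoly (fun u : T3 * T3 => u.2.1.1 : F), linepoly (fun u : T3 * T3 => u.2.1.2 : F) &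
      linepoly (fun u : T3 * T3 => u.2.2 : F)].
Proof.
have [h1 h2 h3] := linepoly_triple.
by split; split; [apply: (@linepoly_fst T3 T3 _ h1)|apply: (@linepoly_fst T3 T3 _ h2)|apply: (@linepoly_fst T3 T3 _ h3)|
  apply: (@linepoly_snd T3 T3 _ h1)|apply: (@linepoly_snd T3 T3 _ h2)|apply: (@linepoly_snd T3 T3 _ h3)].
Qed.

Lemma linevec_snd (V : lmodType F) : linevec (fun u : V * 'rV[F]_4 => u.2).
Proof. by apply: linevec_linear. Qed.
Lemma linevec_id : linevec (fun u : 'rV[F]_4 => u).
Proof. by apply: linevec_linear. Qed.
End Projections.

Ltac lpoly := repeat first
  [ apply: linepoly_br | apply: linepoly_mevalw | apply: linepolyB | apply: linepolyM
  | apply: linevecD | apply: linevecZ | apply: linepolyD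
  | exact: linepoly_cst | exact: linevec_cst
  | by apply: linevec_linear | by apply: linepoly_affine ].

Lemma ordS_surj n (i : 'I_n) : exists i', i = ordS i'.
Proof. by exists (ord_pred i); rewrite ord_predK. Qed.

Lemma card_notin (T : finType) (e : seq T) : (#|T| - size e <= #|[set k | k \notin e]|)%N.
Proof.
rewrite cardsE -(cardC (mem e)) leq_subLR leq_add //; exact: card_size.
Qed.

Lemma br_wedge_nz (F : fieldType) (A B p q : 'rV[F]_4) :
  br A B p q != 0 -> exists k, wedge A B k != 0.
Proof.
move=> nz; apply: NNPP => no; case/negP: nz.
have z k : wedge A B k = 0 by apply/eqP/negPn/negP => h; apply: no; exists k.
by rewrite /br /pairing !z; apply/eqP; ring.
Qed.

Section Lines.
Variables (F : fieldType) (n : nat) (z : 'I_n -> 'rV[F]_4).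

Definition lf i A B := br A B (z i) (z (ordS i)).

(* The closed conditions cutting out the strata that miss the amplituhedron: three pairwise skew
   lines [z_i z_(i+1)], or a plane [z_b z_(b+1) z_(b+2)] and a line disjoint from its vertices. *)
Definition bad3 i j k A B :=
  [/\ nadj i j, nadj i k & nadj j k] /\ [/\ lf i A B = 0, lf j A B = 0 & lf k A B = 0].
Definition badQ b c A B :=
  [/\ c != b, c != ordS b, c != ordS (ordS b) & ordS c != b] /\
  [/\ lf b A B = 0, lf (ordS b) A B = 0, br A B (z b) (z (ordS (ordS b))) = 0 & lf c A B = 0].
Definition bad A B := (exists i j k, bad3 i j k A B) \/ (exists b c, badQ b c A B).
End Lines.


(** * Uniqueness of the adjoint *)

Section Uniqueness.
Variables (F : fieldType) (n : nat) (z : 'I_n -> 'rV[F]_4).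
Hypothesis char0 : forall n, n.+1%:R != 0 :> F.
Hypothesis n4 : (4 <= n)%N.
Hypothesis gen : forall a b c d, uniq [:: a; b; c; d] -> br (z a) (z b) (z c) (z d) != 0.
Hypothesis five : forall A B m (e : seq 'I_n), wedge A B m != 0 -> uniq e -> size e = 5%N ->
  (forall i, i \in e -> lf z i A B = 0) -> False.
Local Notation s := ordS.
Local Notation lf := (lf z).
Implicit Types (A B : 'rV[F]_4) (i j k l : 'I_n).

Definition ln i (x y : F) := x *: z i + y *: z (s i).

Lemma lf_lnl i x y B : lf i (ln i x y) B = 0.
Proof. by rewrite /lf /ln !brE !br_aabb !mulr0 addr0. Qed.
Lemma lf_lnr i x y A : lf i A (ln i x y) = 0.
Proof. by rewrite /lf /ln !brE !br_aabb !mulr0 addr0. Qed.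

Lemma br_skew i j : nadj i j -> br (z i) (z (s i)) (z j) (z (s j)) != 0.
Proof. by move=> ij; apply: gen; ords. Qed.

Lemma ln_skew i j x y u w : nadj i j -> (x != 0) || (y != 0) -> (u != 0) || (w != 0) ->
  exists m, wedge (ln i x y) (ln j u w) m != 0.
Proof.
move=> ij xy uw; case/orP: xy => a; case/orP: uw => b;
  [pose p := z (s i); pose q := z (s j)|pose p := z (s i); pose q := z j
  |pose p := z i; pose q := z (s j)|pose p := z i; pose q := z j];
  apply: (@br_wedge_nz _ _ _ p q);
  rewrite /p /q /ln !brE !br_aabb !mulr0 ?addr0 ?add0r !mulf_neq0 //; apply: gen; ords.
Qed.

(** Edges that cut the pencil from a point of edge [i] to edge [j] in a bad line. The neighbours of
    [j] are excluded, since the pencil meets them at the ends of edge [j]. The neighbours of [i]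
    remain: meeting one of them puts the line into the plane of two consecutive edges. *)
Definition Kset i j := [set k : 'I_n | [&& k != i, k != j, k != s j & s k != j]].

Lemma card_Kset i j : (n - 4 <= #|Kset i j|)%N.
Proof.
have [j' ej] := ordS_surj j.
have := card_notin [:: i; j; s j; j']; rewrite card_ord /=; move/leq_trans; apply.
apply/subset_leq_card/subsetP => k; rewrite !inE ej (inj_eq (@ordS_inj _)).
by rewrite !negb_or.
Qed.

Lemma pencil_bnz i j k : nadj i j -> k \in Kset i j ->
  exists x y, br (ln i x y) (z (s j)) (z k) (z (s k)) != 0.
Proof.
rewrite inE => ij /and4P[h1 h2 h3 h4].
have [e|ne] := eqVneq (s k) i.
  exists 0, 1; rewrite /ln scale0r scale1r add0r; apply: gen; move: ij h1 h2 h3 h4; rewrite -e.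
  by move=> *; ords.
by exists 1, 0; rewrite /ln scale0r scale1r addr0; apply: gen; ords.
Qed.

(** Resultant of [l_k] and [l_l] along the pencil; it vanishes when they have a common zero,
    possibly at the end [z (s j)]. *)
Definition pdet i j k l x y :=
  br (ln i x y) (z j) (z k) (z (s k)) * br (ln i x y) (z (s j)) (z l) (z (s l)) -
  br (ln i x y) (z j) (z l) (z (s l)) * br (ln i x y) (z (s j)) (z k) (z (s k)).

Lemma pdet0 i j k l x y : pdet i j k l x y = 0 -> exists u w, (u != 0) || (w != 0) /\
  lf k (ln i x y) (ln j u w) = 0 /\ lf l (ln i x y) (ln j u w) = 0.
Proof.
rewrite /pdet /lf => e.
set ak := br _ (z j) (z k) _ in e; set bk := br _ (z (s j)) (z k) _ in e.
set al := br _ (z j) (z l) _ in e; set bl := br _ (z (s j)) (z l) _ in e.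
have E u w m : br (ln i x y) (ln j u w) (z m) (z (s m)) =
  u * br (ln i x y) (z j) (z m) (z (s m)) + w * br (ln i x y) (z (s j)) (z m) (z (s m)).
  by rewrite [in LHS]/(ln j _ _) brDb !brZb.
have [bk0|nbk] := eqVneq bk 0; have [ak0|nak] := eqVneq ak 0.
- have [bl0|nbl] := eqVneq bl 0.
    exists 0, 1; rewrite oner_eq0 orbT; split=> //; rewrite !E -/ak -/bk -/al -/bl ak0 bk0 bl0.
    by split; ring.
  exists bl, (- al); rewrite nbl; split=> //; rewrite !E -/ak -/bk -/al -/bl ak0 bk0.
  by split; ring.
- exists bk, (- ak); rewrite oppr_eq0 nak orbT; split=> //; rewrite !E -/ak -/bk -/al -/bl.
  by split; [ring|rewrite -[RHS]oppr0 -e; ring].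
- exists bk, (- ak); rewrite nbk; split=> //; rewrite !E -/ak -/bk -/al -/bl.
  by split; [ring|rewrite -[RHS]oppr0 -e; ring].
exists bk, (- ak); rewrite nbk; split=> //; rewrite !E -/ak -/bk -/al -/bl.
by split; [ring|rewrite -[RHS]oppr0 -e; ring].
Qed.

(** The step where Assumption (G) acts, through [five]. If the zeros for [k] and [l] coincided for
    every point of edge [i], an end of that edge would carry a line meeting five edges, unless [k]
    and [l] are the two neighbours of [i]. That case is excluded by a midpoint of the edge. *)
Lemma pdet_nz i j k l : nadj i j -> k \in Kset i j -> l \in Kset i j -> k != l ->
  exists x y, pdet i j k l x y != 0.
Proof.
rewrite !inE => ij /and4P[k1 k2 k3 k4] /and4P[l1 l2 l3 l4] kl.
have [i' ei] := ordS_surj i.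
apply: NNPP => no.
have p0 x y : pdet i j k l x y = 0.
  by apply/eqP/negPn/negP => h; apply: no; exists x, y.
have five' x y e : (x != 0) || (y != 0) -> uniq e -> size e = 5%N ->
    (forall u w m, lf k (ln i x y) (ln j u w) = 0 -> lf l (ln i x y) (ln j u w) = 0 ->
       m \in e -> lf m (ln i x y) (ln j u w) = 0) -> False.
  move=> xy ue se h; have [u [w [uw [hk hl]]]] := pdet0 (p0 x y).
  have [m nz] := ln_skew ij xy uw.
  by apply: (five nz ue se) => m' hm'; apply: h.
(* At [z i] the edges [i'] and [i] are both met automatically; with [j], [k], [l] this makes five.
   [side1] is the same at the other end. *)
have side0 : (k != i') && (l != i') -> False.
  move=> /andP[ki li]; apply: (@five' 1 0 [:: i'; i; j; k; l]) => //.
  - by rewrite oner_eq0.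
  - by rewrite ei in ij k1 l1 *; ords.
  move=> u w m hk hl; rewrite !inE => /orP[/eqP->|/orP[/eqP->|/orP[/eqP->|/orP[]/eqP->]]] //.
  - by rewrite /lf -ei /ln scale1r scale0r addr0 br_aabb.
  - exact: lf_lnl.
  - exact: lf_lnr.
have side1 : (k != s i) && (l != s i) -> False.
  move=> /andP[ki li]; apply: (@five' 0 1 [:: i; s i; j; k; l]) => //.
  - by rewrite oner_eq0 orbT.
  - by ords.
  move=> u w m hk hl; rewrite !inE => /orP[/eqP->|/orP[/eqP->|/orP[/eqP->|/orP[]/eqP->]]] //.
  - exact: lf_lnl.
  - by rewrite /lf /ln scale1r scale0r add0r br_aabb.
  - exact: lf_lnr.
(* Now [k] and [l] are the two neighbours of [i]. At an interior point of edge [i], the second point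
   [B] lies in both planes spanned by edge [i] and a neighbour. These planes meet only in edge [i],
   which is skew to edge [j]. *)
have [u [w [uw [hk hl]]]] := pdet0 (p0 1 1).
have [hi' hi] : lf i' (ln i 1 1) (ln j u w) = 0 /\ lf (s i) (ln i 1 1) (ln j u w) = 0.
  have [e1|n1] := eqVneq k i'.
    have [e2|n2] := eqVneq l (s i); first by rewrite -e1 -e2.
    by case: side1; rewrite n2 e1 andbT; rewrite ei; clear -n4; ords.
  have [e2|n2] := eqVneq l i'; last by case: side0; rewrite n1 n2.
  have [e3|n3] := eqVneq k (s i); first by rewrite -e2 -e3.
  by case: side1; rewrite n3 e2 /=; rewrite ei; clear -n4; ords.
pose B := ln j u w; rewrite -/B in hi hi'.
have b1 : br (z i) (z (s i)) (z (s (s i))) B = 0.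
  move: hi; rewrite /lf /(ln i) !scale1r brDa br_aabb addr0 => h.
  by rewrite br_swap34 br_swap23 h !oppr0.
have b2 : br (z i) (z (s i)) B (z i') = 0.
  move: hi'; rewrite /lf /(ln i) !scale1r brDa -ei br_aabb add0r => h.
  by rewrite br_swap12 br_swap23 br_swap34 h !oppr0.
pose d := br (z i) (z (s i)) (z (s (s i))) (z i').
have dnz : d != 0 by apply: gen; rewrite ei; clear -n4; ords.
have := br_cramer (z i) (z (s i)) (z (s (s i))) (z i') B.
rewrite b1 b2 !scale0r !addr0 -/d.
set c1 := br B _ _ _; set c2 := br _ B _ _ => e.
have [|_ _ du dw] := br_free (elimN eqP (br_skew ij)) (x := - c1) (y := - c2) (z := d * u) (w := d * w).
  rewrite -addrA -!scalerA -scalerDr -/(ln j u w) -/B e !scaleNr -opprD addrC subrr //.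
case/orP: uw => /negP[]; apply/eqP/(mulfI dnz); by rewrite mulr0.
Qed.


Definition vanish_bad (f : {mpoly F[6]}) := forall A B, bad z A B -> f.@[wedge A B] = 0.

(** For [k] next to [i], meeting edge [k] from a point of edge [i] other than their common vertex
    puts the line into the plane of both, hence the conditions on [x] and [y]. For the other [k] the
    three edges are disjoint. *)
Lemma pencil_bad i j k x y t : nadj i j -> k \in Kset i j -> x != 0 -> y != 0 ->
  br (ln i x y) (z j) (z k) (z (s k)) + t * br (ln i x y) (z (s j)) (z k) (z (s k)) = 0 ->
  bad z (ln i x y) (z j + t *: z (s j)).
Proof.
rewrite inE => ij /and4P[k1 k2 k3 k4] x0 y0; set B := _ + _ *: _ => e.
have eB : B = ln j 1 t by rewrite /ln scale1r.
have hk : lf k (ln i x y) B = 0 by rewrite /lf /B brDb brZb.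
have [eki|nki] := eqVneq k (s i).
  right; exists i, j; split; first by rewrite eki in k1 k2 k3 k4 *; split; ords.
  rewrite eki in hk; split; rewrite ?lf_lnl ?hk ?eB ?lf_lnr //.
  move: hk; rewrite /lf [in X in X -> _]/ln brDa !brZa br_aabb mulr0 addr0 => /eqP.
  rewrite mulf_eq0 (negbTE x0) /= => /eqP hk.
  by rewrite -eB /ln brDa !brZa br_aabb mulr0 add0r br_swap13 hk oppr0 mulr0.
have [ski|nski] := eqVneq (s k) i.
  right; exists k, j; split; first by rewrite -ski in ij k1 *; split; ords.
  split; rewrite ?ski ?lf_lnl ?hk ?eB ?lf_lnr //.
  move: hk; rewrite /lf ski [in X in X -> _]/ln brDa !brZa br_aabb mulr0 add0r => /eqP.
  rewrite mulf_eq0 (negbTE y0) /= => /eqP hk.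
  by rewrite -eB /ln brDa !brZa br_aabb mulr0 addr0 br_swap14 hk oppr0 mulr0.
left; exists i, j, k; split; first by split; ords.
by split=> //; rewrite ?lf_lnl // eB lf_lnr.
Qed.

Section Ratio.
Variables f g : {mpoly F[6]}.
Hypotheses (fh : f \is (n - 4)%N.-homog) (gh : g \is (n - 4)%N.-homog).
Hypotheses (fbad : vanish_bad f) (gbad : vanish_bad g).

(** Proportionality is cross-multiplied into a polynomial identity, so that it passes by density
    from general points of edge [i] to all of them. *)
Lemma ratio_line i j x y t u : nadj i j ->
  f.@[wedge (ln i x y) (z j + t *: z (s j))] * g.@[wedge (ln i x y) (z j + u *: z (s j))] =
  f.@[wedge (ln i x y) (z j + u *: z (s j))] * g.@[wedge (ln i x y) (z j + t *: z (s j))].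
Proof.
move=> ij; pose V := (F^o * F^o)%type.
pose b k (v : V) := br (ln i v.1 v.2) (z (s j)) (z k) (z (s k)).
(* The open conditions on the point of edge [i]: it is not a vertex, and the zeros along the pencil
   are finite and distinct. *)
pose G (v : V) := (v.1 * v.2) * ((\prod_(k in Kset i j) b k v) *
  (\prod_(m : 'I_n * 'I_n | [&& m.1 \in Kset i j, m.2 \in Kset i j & m.1 != m.2])
     pdet i j m.1 m.2 v.1 v.2)).
have lnl : linevec (fun v : V => ln i v.1 v.2) by rewrite /ln; lpoly.
have lb k : linepoly (b k) by rewrite /b; lpoly.
have lp (m : 'I_n * 'I_n) : linepoly (fun v : V => pdet i j m.1 m.2 v.1 v.2).
  by rewrite /pdet; apply: linepolyB; apply: linepolyM; apply: linepoly_br; first [exact: linevec_cst | exact: lnl].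
have lb' := linepoly_prod (index_enum _) (fun k => k \in Kset i j) lb.
have lp' := linepoly_prod (index_enum _)
  (fun m : 'I_n * 'I_n => [&& m.1 \in Kset i j, m.2 \in Kset i j & m.1 != m.2]) lp.
have lxy : linepoly (fun v : V => v.1 * v.2 : F) by lpoly.
have lG : linepoly G by apply: linepolyM => //; apply: linepolyM.
have [v0 nz] : exists v, G v != 0.
  apply: linepoly_mul_nz => //; first exact: linepolyM.
    by exists (1, 1); rewrite mulr1 oner_neq0.
  apply: linepoly_mul_nz => //; apply: linepoly_prod_nz => //.
    by move=> k _ hk; have [x' [y' h]] := pencil_bnz ij hk; exists (x', y').
  move=> [k l] _ /and3P[/= hk hl kl].
  by have [x' [y' h]] := pdet_nz ij hk hl kl; exists (x', y').
pose H (v : V) := f.@[wedge (ln i v.1 v.2) (z j + t *: z (s j))] *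
    g.@[wedge (ln i v.1 v.2) (z j + u *: z (s j))] -
  f.@[wedge (ln i v.1 v.2) (z j + u *: z (s j))] *
    g.@[wedge (ln i v.1 v.2) (z j + t *: z (s j))].
suff : H (x, y) = 0 by rewrite /H => /eqP; rewrite subr_eq0 => /eqP.
apply: (linepoly_density char0 (g := G) (u0 := v0)) => //.
  by rewrite /H; lpoly.
move=> [x' y']; rewrite /G /= !mulf_eq0 !negb_or => /andP[/andP[nx ny]].
move=> /andP[/prodf_neq0 nb /prodf_neq0 np].
apply/eqP; rewrite subr_eq0; apply/eqP.
apply: (pencil_prop (K := Kset i j) (a := fun k => br (ln i x' y') (z j) (z k) (z (s k)))
   (b := fun k => br (ln i x' y') (z (s j)) (z k) (z (s k)))) fh gh _ _ _ _ => //.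
- by move=> k l hk hl kl; apply: (np (k, l)); rewrite /= hk hl.
- exact: card_Kset.
by move=> k w hk e; split; [apply: fbad|apply: gbad]; apply: pencil_bad e.
Qed.

Lemma meval_swap d (h : {mpoly F[6]}) A B : h \is d.-homog ->
  h.@[wedge B A] = (-1) ^+ d * h.@[wedge A B].
Proof.
move=> hh; rewrite -(meval_homog _ _ hh); apply: meval_eq => k.
by rewrite wedgeC mulN1r.
Qed.

Lemma ln10 i : ln i 1 0 = z i.
Proof. by rewrite /ln scale1r scale0r addr0. Qed.
Lemma ln01 i : ln i 0 1 = z (s i).
Proof. by rewrite /ln scale1r scale0r add0r. Qed.
Lemma ln1 i t : ln i 1 t = z i + t *: z (s i).
Proof. by rewrite /ln scale1r. Qed.

Lemma nadj_sym i j : nadj i j -> nadj j i.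
Proof. by move=> ij; ords. Qed.

Definition pt (h : {mpoly F[6]}) i j := h.@[wedge (z i) (z j)].

Lemma meval_sub c A B : (g - c *: f).@[wedge A B] = g.@[wedge A B] - c * f.@[wedge A B].
Proof. by rewrite mevalB mevalZ. Qed.

Lemma sub_homog c : (g - c *: f) \is (n - 4)%N.-homog.
Proof. by rewrite rpredB // rpredZ. Qed.

(** One nonzero value of [f] fixes the ratio: it is carried along edge [i] with [z j] fixed, then
    along edge [j], and extended to all coordinates by homogeneity. *)
Lemma ratio_prop c i j : nadj i j -> pt f i j != 0 -> pt g i j = c * pt f i j ->
  forall x y u w, (g - c *: f).@[wedge (ln i x y) (ln j u w)] = 0.
Proof.
move=> ij nz eqc; set h := g - c *: f.
have hh : h \is (n - 4)%N.-homog := sub_homog c.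
have step1 r : h.@[wedge (ln i 1 r) (z j)] = 0.
  have := ratio_line 1 0 r 0 (nadj_sym ij).
  rewrite ln10 scale0r addr0 -ln1 !(meval_swap _ (z j) fh) !(meval_swap _ (z j) gh).
  rewrite -/(pt f i j) -/(pt g i j) eqc /h meval_sub.
  set e := _ ^+ _; have enz : e != 0 by rewrite expf_neq0 // oppr_eq0 oner_neq0.
  set p := f.@[_]; set q := g.@[_] => eqn.
  apply: (mulfI nz); apply: (mulfI enz); apply: (mulfI enz).
  rewrite !mulr0 -[RHS](subrr (e * p * (e * (c * pt f i j)))) {1}eqn.
  by ring.
(* [ratio_line] transports the ratio only from a line where [f] is nonzero. These lines are dense
   because [v = 0] gives the nonzero value at [z i], [z j]. *)
have step2 r t : h.@[wedge (ln i 1 r) (ln j 1 t)] = 0.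
  pose V := (F^o : lmodType F).
  have lnl : linevec (fun v : V => ln i 1 v) by rewrite /ln; lpoly.
  apply: (linepoly_density char0 (V := V) (f := fun v => h.@[wedge (ln i 1 v) (ln j 1 t)])
    (g := fun v => f.@[wedge (ln i 1 v) (z j)]) (u0 := 0)) => [|||v fnz].
  - exact: linepoly_mevalw lnl (linevec_cst _).
  - exact: linepoly_mevalw lnl (linevec_cst _).
  - by rewrite ln10.
  have := ratio_line 1 v t 0 ij; rewrite scale0r addr0 -ln1 => eqn.
  have /eqP := step1 v; rewrite /h meval_sub subr_eq0 => /eqP eg.
  apply: (mulfI fnz); rewrite mulr0 /h meval_sub.
  rewrite mulrBr -eqn eg; ring.
move=> x y u w; pose V := (F^o * F^o * F^o * F^o)%type.
have l1 : linevec (fun v : V => ln i v.1.1.1 v.1.1.2) by rewrite /ln; lpoly.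
have l2 : linevec (fun v : V => ln j v.1.2 v.2) by rewrite /ln; lpoly.
apply: (linepoly_density char0 (V := V)
  (f := fun v => h.@[wedge (ln i v.1.1.1 v.1.1.2) (ln j v.1.2 v.2)])
  (g := fun v => v.1.1.1 * v.1.2) (u0 := (1, 0, 1, 0)) _ _ _ _ (x, y, u, w)).
- exact: linepoly_mevalw l1 l2.
- by apply: (linepolyM (f := fun v : V => v.1.1.1) (g := fun v : V => v.1.2));
    apply: linepoly_affine.
- by rewrite /= mulr1 oner_neq0.
move=> [[[x' y'] u'] w'] /=; rewrite mulf_eq0 negb_or => /andP[xn un].
rewrite (_ : h.@[_] = h.@[fun m => x' * u' * wedge (ln i 1 (y' / x')) (ln j 1 (w' / u')) m]).
  by rewrite (meval_homog _ _ hh) step2 mulr0.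
apply: meval_eq => m; rewrite -mulrA -wedgeZr -wedgeZl; congr (wedge _ _ m).
  by rewrite ln1 scalerDr scalerA mulrC divfK.
by rewrite ln1 scalerDr scalerA mulrC divfK.
Qed.

Hypothesis fnz : forall i j, nadj i j -> pt f i j != 0.

(** The lines [z i z j], [z i z (s j)] and [z (s i) z (s j)] all lie on [D_i /\ D_j], so they share
    one ratio. Such moves reach every nonadjacent pair from the pair of vertices 0 and 2. *)
Lemma ratio_const : exists c, forall i j, nadj i j ->
  forall x y u w, (g - c *: f).@[wedge (ln i x y) (ln j u w)] = 0.
Proof.
have n0 : (0 < n)%N by apply: leq_trans n4.
pose o : 'I_n := Ordinal n0.
pose c := pt g o (s (s o)) / pt f o (s (s o)); exists c.
pose P i j := nadj i j -> pt g i j = c * pt f i j.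
have near i j x y u w : P i j -> nadj i j -> 
    g.@[wedge (ln i x y) (ln j u w)] = c * f.@[wedge (ln i x y) (ln j u w)].
  move=> Pij ij; have := ratio_prop ij (fnz ij) (Pij ij) x y u w.
  by rewrite meval_sub => /eqP; rewrite subr_eq0 => /eqP.
have P02 : P o (s (s o)).
  by move=> h; rewrite /c divfK // fnz.
have shift2 i j : P i j -> P (s i) (s j).
  move=> Pij h; have ij : nadj i j by ords.
  by have := near _ _ 0 1 0 1 Pij ij; rewrite !ln01.
have shift1 i j : nadj i j -> P i j -> P i (s j).
  move=> ij Pij h.
  by have := near _ _ 1 0 0 1 Pij ij; rewrite ln01 ln10.
have P0 m (j : 'I_n) : nat_of_ord j = m.+2 -> P o j.
  elim: m j => [|m IH] j ej.
    suff -> : j = s (s o) by [].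
    apply/val_inj; rewrite /= ej.
    by rewrite !modn_small //; lia.
  have [j' e] := ordS_surj j.
  have ej' : nat_of_ord j' = m.+2.
    by have := ordS_cases j'; rewrite -e ej; case=> [[[]]|[]].
  have oj' : nadj o j' -> P o j by move=> h; rewrite e; apply: shift1 => //; apply: IH.
  by apply: oj'; rewrite /nadj -e -!val_eqE /= ej ej' modn_small //; apply: leq_trans n4.
have Pall m (i j : 'I_n) : nat_of_ord i = m -> P i j.
  elim: m i j => [|m IH] i j ei.
    have -> : i = o by apply/val_inj.
    move=> oj; have [m em] : exists m, nat_of_ord j = m.+2.
      move: oj; rewrite /nadj -!val_eqE /= modn_small; last by lia.
      move=> h; exists (j - 2)%N; lia.
    exact: P0 em oj.
  have [i' e] := ordS_surj i; have [j' ->] := ordS_surj j; rewrite e; apply: shift2; apply: IH.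
  by have := ordS_cases i'; rewrite -e ei; case=> [[[]]|[]].
move=> i j ij x y u w; apply: ratio_prop => //; first exact: fnz.
exact: (Pall i i j).
Qed.

End Ratio.

Lemma card_nadj i : (n - 3 <= #|[set j | nadj i j]|)%N.
Proof.
have [i' ei] := ordS_surj i.
have := card_notin [:: i; s i; i']; rewrite card_ord /=; move/leq_trans; apply.
apply/subset_leq_card/subsetP => k; rewrite !inE !negb_or => /and3P[h1 h2 h3].
by rewrite ei in h1 h2 *; ords.
Qed.

(** Through a fixed point, a general pencil meets the [n - 3] edges not adjacent to [i] at distinct
    lines, one more than the degree. Keeping [r] variable lets genericity be tested at [r = 0],
    where the point is the vertex [z i]. It is applied to edge [i] itself and then to an arbitrary
    direction [Y]. *)
Lemma pencil_spread (h : {mpoly F[6]}) i Y : h \is (n - 4)%N.-homog ->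
  (forall j r B, nadj i j -> lf j (z i + r *: Y) B = 0 -> h.@[wedge (z i + r *: Y) B] = 0) ->
  forall r B, h.@[wedge (z i + r *: Y) B] = 0.
Proof.
move=> hh hz r B; pose V := (F^o * 'rV[F]_4 * 'rV[F]_4)%type.
pose A (v : V) := z i + (v.1.1 : F) *: Y.
pose a k (v : V) := br (A v) v.1.2 (z k) (z (s k)).
pose b k (v : V) := br (A v) v.2 (z k) (z (s k)).
have lA : linevec A.
  apply: linevecD; first exact: linevec_cst.
  by apply: (linevecZ (f := fun v : V => v.1.1)); [apply: linepoly_affine|apply: linevec_cst].
have l12 : linevec (fun v : V => v.1.2) by apply: linevec_linear.
have l2 : linevec (fun v : V => v.2) by apply: linevec_linear.
have la k : linepoly (a k) by apply: linepoly_br => //; apply: linevec_cst.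
have lb k : linepoly (b k) by apply: linepoly_br => //; apply: linevec_cst.
pose D (m : 'I_n * 'I_n) v := a m.1 v * b m.2 v - a m.2 v * b m.1 v.
have lD m : linepoly (D m) by apply: linepolyB; apply: linepolyM.
pose PD (m : 'I_n * 'I_n) := [&& nadj i m.1, nadj i m.2 & m.1 != m.2].
pose G v := (\prod_(k | nadj i k) b k v) * \prod_(m | PD m) D m v.
have lb' := linepoly_prod (index_enum _) (nadj i) lb.
have lD' := linepoly_prod (index_enum _) PD lD.
have A0 p q : A (0, p, q) = z i by rewrite /A /= scale0r addr0.
have [v0 nz] : exists v, G v != 0.
  apply: linepoly_mul_nz => //; apply: linepoly_prod_nz => //.
    by move=> k _ ik; exists (0, 0, z (s i)); rewrite /b A0 /=; apply: br_skew.
  move=> [j k] _ /and3P[/= ij ik jk].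
  (* [B0] is a vertex on one of the two edges, so one product in [D] vanishes; the choice of
     vertices keeps the other a product of determinants of distinct vertices. *)
  have [e|ne] := eqVneq j (s k).
    exists (0, z k, z (s j)); rewrite /D /a /b !A0 /= br_aabb mul0r subr0.
    by rewrite mulf_neq0 //; apply: gen; rewrite e in ij jk *; ords.
  exists (0, z j, z (s k)); rewrite /D /a /b !A0 /= br_aabb mul0r sub0r oppr_eq0.
  by rewrite mulf_neq0 //; apply: gen; ords.
suff : h.@[wedge (A (r, B, 0)) (r, B, 0 : 'rV[F]_4).1.2] = 0 by [].
apply: (linepoly_density char0 (f := fun v : V => h.@[wedge (A v) v.1.2]) (g := G) (u0 := v0)) => //.
- exact: linepoly_mevalw lA l12.
- exact: linepolyM lb' lD'.
move=> v; rewrite /G mulf_eq0 negb_or => /andP[/prodf_neq0 nb /prodf_neq0 nD].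
have := pencil_zero (K := [set j | nadj i j]) (a := a^~ v) (b := b^~ v) _ _ (A := A v)
   (B0 := v.1.2) (B1 := v.2) hh _ _ 0; rewrite scale0r addr0; apply.
- by move=> k; rewrite inE; apply: nb.
- by move=> k l; rewrite !inE => hk hl kl; apply: (nD (k, l)); rewrite /PD /= hk hl.
- by apply: leq_trans (card_nadj i); lia.
move=> k t; rewrite inE => ik e; apply: (hz k) => //.
by rewrite /lf brDb brZb.
Qed.

(** For [n = 4] the form is a constant and need not vanish at the zero bivector, so one known zero
    is required. *)
Lemma meval_wedge0 (h : {mpoly F[6]}) A B i j : h \is (n - 4)%N.-homog ->
  h.@[wedge (z i) (z j)] = 0 -> (forall m, wedge A B m = 0) -> h.@[wedge A B] = 0.
Proof.
move=> hh hz w0; have := meval_homog 0 (wedge (z i) (z j)) hh; rewrite hz mulr0 => <-.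
by apply: meval_eq => k; rewrite w0 mul0r.
Qed.

Lemma vanish_spread (h : {mpoly F[6]}) : h \is (n - 4)%N.-homog ->
  (forall i j, nadj i j -> forall x y u w, h.@[wedge (ln i x y) (ln j u w)] = 0) ->
  forall A B, h.@[wedge A B] = 0.
Proof.
move=> hh hz.
have n0 : (0 < n)%N by apply: leq_trans n4.
pose o : 'I_n := Ordinal n0.
have oo : nadj o (s (s o)).
  rewrite /nadj -!val_eqE /= (@modn_small 1) ?(@modn_small 2); try lia.
  by case: (n =P 3)=> [e|ne]; [move: n4; rewrite e|rewrite modn_small; lia].
have z0 : h.@[wedge (z o) (z (s (s o)))] = 0 by have := hz _ _ oo 1 0 1 0; rewrite !ln10.
have wz A B : (forall m, wedge A B m <> 0 -> h.@[wedge A B] = 0) -> h.@[wedge A B] = 0.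
  move=> H; have [[k nk]|no] := classic (exists m, wedge A B m <> 0); first exact: H nk.
  apply: meval_wedge0 hh z0 _ => k; apply: NNPP => nk; apply: no; by exists k.
have D1 i r B : h.@[wedge (ln i 1 r) B] = 0.
  rewrite ln1; apply: pencil_spread => // j r' B' ij; rewrite -ln1 => e.
  apply: wz => k nk.
  have [u [w ->]] := meet_two (elimN eqP (br_skew ij)) nk e.
  exact: hz.
have D2 i x y B : h.@[wedge (ln i x y) B] = 0.
  pose V := (F^o * F^o)%type.
  have l1 : linevec (fun v : V => ln i v.1 v.2) by rewrite /ln; lpoly.
  apply: (linepoly_density char0 (f := fun v : V => h.@[wedge (ln i v.1 v.2) B])
    (g := fun v : V => v.1) (u0 := (1, 0)) _ _ _ _ (x, y)).
  - exact: linepoly_mevalw l1 (linevec_cst _).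
  - by apply: linepoly_affine.
  - by rewrite /= oner_neq0.
  move=> [x' y'] /= nx.
  rewrite (_ : h.@[_] = h.@[fun m => x' * wedge (ln i 1 (y' / x')) B m]).
    by rewrite (meval_homog _ _ hh) D1 mulr0.
  apply: meval_eq => m; rewrite -wedgeZl; congr (wedge _ _ m).
  by rewrite ln1 scalerDr scalerA mulrC divfK.
(* With [Y = A - z o] and [r = 1] the fixed point is the arbitrary [A]; lines meeting an edge are
   already handled by [D2]. *)
move=> A B; rewrite (_ : A = z o + 1 *: (A - z o)); last by rewrite scale1r addrC subrK.
apply: pencil_spread => // j r B' ij e; apply: wz => k nk.
have [m nzm] := br_wedge_nz (gen (a := j) (b := s j) (c := s (s j)) (d := s (s (s j))) ltac:(by ords)).
by have [x [y [C ->]]] := meet_line (elimN eqP nzm) e; apply: D2.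
Qed.

Theorem adjoint_unique (f g : {mpoly F[6]}) :
  f \is (n - 4)%N.-homog -> g \is (n - 4)%N.-homog -> vanish_bad f -> vanish_bad g ->
  (forall i j, nadj i j -> f.@[wedge (z i) (z j)] != 0) ->
  exists c, forall A B, (g - c *: f).@[wedge A B] = 0.
Proof.
move=> fh gh fb gb fnz; have [c hc] := ratio_const fh gh fb gb fnz.
exists c; apply: vanish_spread => //; exact: sub_homog.
Qed.

End Uniqueness.

(** * Existence of the adjoint *)

Section LinearForms.
Variable F : fieldType.
Implicit Types (A B p q r : 'rV[F]_4) (v w : 'I_6 -> F).

Lemma sum6 (G : 'I_6 -> F) : \sum_k G k =
  G (inord 0) + G (inord 1) + G (inord 2) + G (inord 3) + G (inord 4) + G (inord 5).
Proof.
have -> : \sum_k G k = \sum_(k < 6) G (inord k) by apply: eq_bigr => k _; rewrite inord_val.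
by rewrite !big_ord_recl big_ord0 /= /bump /= addr0 !addrA.
Qed.

Definition linform w : {mpoly F[6]} := \sum_k w k *: 'X_k.

Lemma linform_eval w v : (linform w).@[v] = \sum_k w k * v k.
Proof. by rewrite /linform raddf_sum; apply: eq_bigr => k _; rewrite /= mevalZ mevalXU. Qed.

Lemma linform_homog w : linform w \is 1.-homog.
Proof. by apply: rpred_sum => k _; apply: rpredZ; rewrite dhomogX /= mdeg1. Qed.

Definition hodge w : 'I_6 -> F := fun k =>
  nth 0 [:: w (inord 5); - w (inord 4); w (inord 3); w (inord 2); - w (inord 1); w (inord 0)] k.

Lemma hodge_eval w v : (linform (hodge w)).@[v] = pairing v w.
Proof. rewrite linform_eval sum6 /hodge /= !inordK //= /pairing; ring. Qed.

Definition covec p q r : 'rV[F]_4 := \row_j br (delta_mx 0 j) p q r.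

Lemma covecE p q r : 
  (co (covec p q r) 0 = wedge q r (inord 5) * co p 1 - wedge q r (inord 4) * co p 2 + wedge q r (inord 3) * co p 3) *
  (co (covec p q r) 1 = - wedge q r (inord 5) * co p 0 + wedge q r (inord 2) * co p 2 - wedge q r (inord 1) * co p 3) *
  (co (covec p q r) 2 = wedge q r (inord 4) * co p 0 - wedge q r (inord 2) * co p 1 + wedge q r (inord 0) * co p 3) *
  (co (covec p q r) 3 = - wedge q r (inord 3) * co p 0 + wedge q r (inord 1) * co p 1 - wedge q r (inord 0) * co p 2).
Proof.
have E (a b : nat) : (a < 4)%N -> (b < 4)%N -> co (delta_mx 0 (inord a) : 'rV[F]_4) b = (a == b)%:R.
  by move=> ha hb; rewrite /co mxE eqxx -val_eqE /= !inordK // eq_sym.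
by do !split; rewrite {1}/co mxE /br /pairing !(wedgeE _ p) !(wedgeE q) !E //=; ring.
Qed.

(** The 2x2 determinant of two plane equations at [A] and [B] is linear in [wedge A B]. This makes
    [mform] below a form of degree one. *)
Lemma covec_wedge A B p q r p' q' r' :
  (linform (wedge (covec p q r) (covec p' q' r'))).@[wedge A B] =
  br A p q r * br B p' q' r' - br A p' q' r' * br B p q r.
Proof.
rewrite linform_eval sum6 ![wedge (covec _ _ _) _ _]wedgeE !covecE.
rewrite /br /pairing.
move: (wedge q r _) (wedge q r _) (wedge q r _) (wedge q r _) (wedge q r _) (wedge q r _) => a0 a1 a2 a3 a4 a5.
move: (wedge q' r' _) (wedge q' r' _) (wedge q' r' _) (wedge q' r' _) (wedge q' r' _) (wedge q' r' _) => b0 b1 b2 b3 b4 b5.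
rewrite !wedgeE; ring.
Qed.
End LinearForms.

Lemma prod_homog n (F : fieldType) (I : finType) (e : seq I) (x : I -> {mpoly F[n]}) : uniq e ->
  (forall i, x i \is 1.-homog) -> \prod_(i | i \notin e) x i \is (#|I| - size e)%N.-homog.
Proof.
move=> ue hx.
have -> : (#|I| - size e)%N = (\sum_(i | i \notin e) 1)%N.
  rewrite sum1_card -(card_uniqP ue) -(cardC (mem e)) addKn.
  by apply: eq_card => i.
elim/big_rec2: _ => [|i d p _ IH]; first exact: dhomog1.
exact: dhomogM.
Qed.

Lemma prod_split (F : comNzRingType) (I : finType) (e : seq I) (x : I -> F) : uniq e ->
  \prod_i x i = (\prod_(i <- e) x i) * \prod_(i | i \notin e) x i.
Proof. by move=> ue; rewrite (bigID (mem e)) /= big_uniq. Qed.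

Lemma mem4E (T : eqType) (x a b c d : T) : x \in [:: a; b; c; d] ->
  [\/ x = a, x = b, x = c | x = d].
Proof.
rewrite !inE => /or4P[]/eqP; [exact: Or41|exact: Or42|exact: Or43|exact: Or44].
Qed.
Lemma mem3E (T : eqType) (x a b c : T) : x \in [:: a; b; c] -> [\/ x = a, x = b | x = c].
Proof. by rewrite !inE => /or3P[]/eqP; [exact: Or31|exact: Or32|exact: Or33]. Qed.

Lemma meval_homog_zero (F : fieldType) d (f : {mpoly F[6]}) A B : f \is d.-homog -> (0 < d)%N ->
  (forall k, wedge A B k = 0) -> f.@[wedge A B] = 0.
Proof.
move=> hf d0 w0; transitivity f.@[fun k => 0 * wedge A B k].
  by apply: meval_eq => k; rewrite mul0r.
by rewrite (meval_homog _ _ hf) expr0n -leqn0 leqNgt d0 mul0r.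
Qed.

Section Existence.
Variables (F : fieldType) (n : nat) (z : 'I_n -> 'rV[F]_4).
Hypothesis char0 : forall n, n.+1%:R != 0 :> F.
Hypothesis n4 : (4 <= n)%N.
Hypothesis gen : forall a b c d, uniq [:: a; b; c; d] -> br (z a) (z b) (z c) (z d) != 0.
Local Notation s := ordS.
Local Notation lf := (lf z).
Implicit Types (A B : 'rV[F]_4) (i j k l a b c : 'I_n).

Variable o : 'I_n.

Definition lform i := linform (hodge (wedge (z i) (z (s i)))).
Definition pl b A := br A (z b) (z (s b)) (z (s (s b))).
Definition pcov b := covec (z b) (z (s b)) (z (s (s b))).
(** The linear form of lines meeting the intersection of the planes [b] and [c]. *)
Definition mform b c := linform (wedge (pcov b) (pcov c)).
Definition kap b := br (z b) (z (s b)) (z (s (s b))) (z (s (s (s b)))).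

Lemma lform_eval i A B : (lform i).@[wedge A B] = lf i A B.
Proof. exact: hodge_eval. Qed.
Lemma mform_eval b c A B : (mform b c).@[wedge A B] = pl b A * pl c B - pl c A * pl b B.
Proof. exact: covec_wedge. Qed.

Lemma mform_anti b c A B : (mform c b).@[wedge A B] = - (mform b c).@[wedge A B].
Proof. by rewrite !mform_eval; ring. Qed.

(** Consecutive planes meet in the edge [s b]. The resulting factor cancels one of the two factors
    [l_(b+1)] in the denominator, which is why [sform] treats neighbours separately. *)
Lemma mform_next b A B : (mform b (s b)).@[wedge A B] = kap b * lf (s b) A B.
Proof.
rewrite mform_eval /pl /kap /lf.
have key p q r t : br A p q r * br B q r t - br A q r t * br B p q r = br p q r t * br A B q r.
  by rewrite /br /pairing !wedgeE; ring.
exact: key.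
Qed.

Lemma mform_plane b c A B : lf b A B = 0 -> lf (s b) A B = 0 -> br A B (z b) (z (s (s b))) = 0 ->
  (mform b c).@[wedge A B] = 0.
Proof.
rewrite /lf => e1 e2 e3; rewrite mform_eval /pl.
have key p q r p' q' r' : br A p q r * br B p' q' r' - br A p' q' r' * br B p q r =
   br A B p q * br r p' q' r' - br A B p r * br q p' q' r' + br A B q r * br p p' q' r'.
  by rewrite /br /pairing !wedgeE; ring.
by rewrite key e1 e2 e3; ring.
Qed.

(* The polynomial whose value is [M_bc / (l_b l_(b+1) l_c l_(c+1))] times the product of the [l_i]
   with [i] outside [e], where [M_bc] and [l_i] are [mform b c] and [lform i]. *)
Definition sform (e : seq 'I_n) b c : {mpoly F[6]} :=
  let P (e' : seq 'I_n) := \prod_(i | i \notin e ++ e') lform i in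
  if b == c then 0
  else if c == s b then kap b *: P [:: b; s b; s (s b)]
  else if b == s c then - (kap c *: P [:: c; s c; s (s c)])
  else mform b c * P [:: b; s b; c; s c].

(** The pairing of [W] with edge [o], with [l_o] removed from each term. A term whose product lacks
    [l_o] has [z (s b)] or [z (s c)] on edge [o], so its coefficient is zero. *)
Definition adj : {mpoly F[6]} :=
  \sum_b \sum_c br (z (s b)) (z (s c)) (z o) (z (s o)) *: sform [:: o] b c.

Lemma ends_zero (x y o' : 'I_n) : [|| x == o', x == s o', y == o' | y == s o'] ->
  br (z x) (z y) (z o') (z (s o')) = 0.
Proof. by case/or4P => /eqP->; rewrite br_aabb. Qed.

Lemma adj_homog : adj \is (n - 4)%N.-homog.
Proof.
have lh i : lform i \is 1.-homog by apply: linform_homog.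
have ph (e : seq 'I_n) : uniq e -> \prod_(i | i \notin e) lform i \is (n - size e)%N.-homog.
  by move=> ue; have := prod_homog ue lh; rewrite card_ord.
apply: rpred_sum => b _; apply: rpred_sum => c _; rewrite /sform /=.
have [bc|nbc] := eqVneq b c; first by rewrite scaler0 dhomog0.
have [cb|ncb] := eqVneq c (s b).
  have [oi|no] := boolP (o \in [:: b; s b; s (s b)]).
    by rewrite ends_zero ?scale0r ?dhomog0 // cb; case/mem3E: oi => ->; rewrite !eqxx ?orbT.
  apply/rpredZ/rpredZ; apply: (ph [:: o; b; s b; s (s b)]).
  by rewrite cons_uniq no; ords.
have [bc'|nbc'] := eqVneq b (s c).
  have [oi|no] := boolP (o \in [:: c; s c; s (s c)]).
    by rewrite ends_zero ?scale0r ?dhomog0 // bc'; case/mem3E: oi => ->; rewrite !eqxx ?orbT.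
  apply: rpredZ; rewrite rpredN; apply/rpredZ; apply: (ph [:: o; c; s c; s (s c)]).
  by rewrite cons_uniq no; ords.
have [oi|no] := boolP (o \in [:: b; s b; c; s c]).
  by rewrite ends_zero ?scale0r ?dhomog0 //; case/mem4E: oi => ->; rewrite !eqxx ?orbT.
apply: rpredZ.
have u5 : uniq [:: o; b; s b; c; s c] by rewrite cons_uniq no; ords.
(* Five distinct indices ensure that [n - 5] is not a truncated subtraction. *)
have n5 : (5 <= n)%N by have := max_card (mem [:: o; b; s b; c; s c]); rewrite (card_uniqP u5) card_ord.
have -> : (n - 4 = 1 + (n - 5))%N by lia.
apply: dhomogM; [exact: linform_homog|exact: (ph _ u5)].
Qed.

Section AtLine.
Variables A B : 'rV[F]_4.
Local Notation v := (wedge A B).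
Local Notation ell i := (lf i A B).
Local Notation S b c := ((sform [::] b c).@[v]).
Local Notation So b c := ((sform [:: o] b c).@[v]).

Lemma pform_eval (e : seq 'I_n) : (\prod_(i | i \notin e) lform i).@[v] = \prod_(i | i \notin e) ell i.
Proof. by rewrite rmorph_prod; apply: eq_bigr => i _; apply: lform_eval. Qed.

Lemma sform_eval e b c : (sform e b c).@[v] =
  if b == c then 0
  else if c == s b then kap b * \prod_(i | i \notin e ++ [:: b; s b; s (s b)]) ell i
  else if b == s c then - (kap c * \prod_(i | i \notin e ++ [:: c; s c; s (s c)]) ell i)
  else (mform b c).@[v] * \prod_(i | i \notin e ++ [:: b; s b; c; s c]) ell i.
Proof.
rewrite /sform; case: ifP => _; first by rewrite meval0.
case: ifP => _; first by rewrite mevalZ pform_eval.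
case: ifP => _; first by rewrite mevalN mevalZ pform_eval.
by rewrite mevalM pform_eval.
Qed.

Lemma sform_antisym b c : S c b = - S b c.
Proof.
rewrite !sform_eval eq_sym; have [|nbc] := eqVneq b c; first by rewrite oppr0.
have [cb|ncb] := eqVneq c (s b).
  have [bc'|nbc'] := eqVneq b (s c); last by [].
  by move: n4 (ordS_neq c n4); rewrite cb in bc' *; case: (ordS_neq b n4); rewrite -bc' eqxx.
have [bc'|nbc'] := eqVneq b (s c); first by rewrite opprK.
rewrite mform_anti mulNr; congr (- (_ * _)); apply: eq_bigl => i; rewrite !inE !negb_or.
by do ![case: (_ == _) => //].
Qed.

Lemma sform_pairing b c : br (z (s b)) (z (s c)) (z o) (z (s o)) * S b c =
  ell o * (br (z (s b)) (z (s c)) (z o) (z (s o)) * So b c).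
Proof.
have split (e : seq 'I_n) : o \notin e ->
    \prod_(i | i \notin e) ell i = ell o * \prod_(i | i \notin o :: e) ell i.
  move=> no; rewrite (bigD1 o) //=; congr (_ * _).
  by apply: eq_bigl => i; rewrite in_cons negb_or andbC.
rewrite !sform_eval; have [|nbc] := eqVneq b c; first by rewrite !mulr0.
have [cb|ncb] := eqVneq c (s b).
  have [oi|no] := boolP (o \in [:: b; s b; s (s b)]); last by rewrite split // cat1s; ring.
  by rewrite ends_zero ?mul0r ?mulr0 // cb; case/mem3E: oi => ->; rewrite !eqxx ?orbT.
have [bc'|nbc'] := eqVneq b (s c).
  have [oi|no] := boolP (o \in [:: c; s c; s (s c)]); last by rewrite split // cat1s; ring.
  by rewrite ends_zero ?mul0r ?mulr0 // bc'; case/mem3E: oi => ->; rewrite !eqxx ?orbT.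
have [oi|no] := boolP (o \in [:: b; s b; c; s c]); last by rewrite split // cat1s; ring.
by rewrite ends_zero ?mul0r ?mulr0 //; case/mem4E: oi => ->; rewrite !eqxx ?orbT.
Qed.

(** The bivector [W]. The sum runs over ordered pairs, so every pair of planes counts twice. *)
Definition wvec q := \sum_b \sum_c S b c * wedge (z (s b)) (z (s c)) q.

Lemma wvec_pairing : \sum_b \sum_c br (z (s b)) (z (s c)) (z o) (z (s o)) * S b c = ell o * adj.@[v].
Proof.
rewrite /adj raddf_sum mulr_sumr; apply: eq_bigr => b _.
rewrite raddf_sum mulr_sumr; apply: eq_bigr => c _.
by rewrite sform_pairing /= mevalZ.
Qed.

Lemma pairing_wvec : pairing wvec (wedge (z o) (z (s o))) = ell o * adj.@[v].
Proof.
have E u w : pairing u w = \sum_k u k * hodge w k :> F.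
  by rewrite -hodge_eval linform_eval; apply: eq_bigr => k _; rewrite mulrC.
rewrite -wvec_pairing E /wvec.
under eq_bigr do rewrite mulr_suml.
rewrite exchange_big; apply: eq_bigr => b _ /=.
under eq_bigr do rewrite mulr_suml.
rewrite exchange_big; apply: eq_bigr => c _ /=.
by rewrite /br E mulr_suml; apply: eq_bigr => k _; rewrite [RHS]mulrC mulrA.
Qed.

Section Generic.
Hypothesis lnz : forall i, ell i != 0.

Lemma sform_generic b c : S b c * (ell b * ell (s b) * ell c * ell (s c)) =
  (mform b c).@[v] * \prod_i ell i.
Proof.
rewrite sform_eval; have [<-|nbc] := eqVneq b c.
  by rewrite mul0r mform_eval; ring.
have [cb|ncb] := eqVneq c (s b).
  rewrite cb mform_next (prod_split (e := [:: b; s b; s (s b)])); last by ords.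
  by rewrite !big_cons big_nil /=; ring.
have [bc'|nbc'] := eqVneq b (s c).
  rewrite bc' mform_anti mform_next (prod_split (e := [:: c; s c; s (s c)])); last by ords.
  by rewrite !big_cons big_nil /=; ring.
rewrite (prod_split (e := [:: b; s b; c; s c])); last by ords.
by rewrite !big_cons big_nil /=; ring.
Qed.

Let inv b := (ell b * ell (s b))^-1.
Let U X := \sum_b (pl b X * inv b) *: z (s b).

Lemma br_sumc (p q r : 'rV[F]_4) (f : 'I_n -> F) (x : 'I_n -> 'rV[F]_4) :
  br p q (\sum_b f b *: x b) r = \sum_b f b * br p q (x b) r.
Proof.
elim/big_rec2: _ => [|b t u _ IH]; first by rewrite -(scale0r 0) brZc mul0r.
by rewrite brDc brZc IH.
Qed.

Lemma wedge_suml (p : 'rV[F]_4) (f : 'I_n -> F) (x : 'I_n -> 'rV[F]_4) q :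
  wedge (\sum_b f b *: x b) p q = \sum_b f b * wedge (x b) p q.
Proof.
elim/big_rec2: _ => [|b t u _ IH]; first by rewrite wedge0l.
by rewrite wedgeDl wedgeZl IH.
Qed.

(* The summand is [g b - g (b+1)] with [g b = <X b (b+1) Y> / l_b], so the cyclic sum telescopes. *)
Lemma span_telescope X Y : X = A \/ X = B -> br A B (U X) Y = 0.
Proof.
move=> hX; rewrite br_sumc.
pose g b := br X (z b) (z (s b)) Y / ell b.
have -> : \sum_b pl b X * inv b * br A B (z (s b)) Y = \sum_b (g b - g (s b)).
  apply: eq_bigr => b _.
  have key p q r : br X p q r * br A B q Y = br X p q Y * br A B q r - br X q r Y * br A B p q.
    by case: hX => ->; rewrite /br /pairing !wedgeE; ring.
  rewrite mulrAC /pl key /inv /g /lf; field.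
  by rewrite !lnz.
rewrite sumrB [X in X - _](reindex_inj (@ordS_inj n)) subrr //.
Qed.

(** Cramer's rule against edge [o]: the coefficients along that edge vanish by telescoping, and
    [ell o] is invertible. *)
Lemma span_line X : X = A \/ X = B -> exists x y, U X = x *: A + y *: B.
Proof.
move=> hX; have e := br_cramer A B (z o) (z (s o)) (U X).
have h Y : br A B (U X) Y = 0 by apply: span_telescope.
have h' : br A B (z o) (U X) = 0 by rewrite br_swap34 h oppr0.
move: e; rewrite h h' !scale0r !addr0 => e.
exists ((ell o)^-1 * br (U X) B (z o) (z (s o))), ((ell o)^-1 * br A (U X) (z o) (z (s o))).
by rewrite -!scalerA -scalerDr -e scalerA mulVf ?lnz // scale1r.
Qed.

Lemma wvec_generic q : wvec q = adj.@[v] * v q.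
Proof.
pose P := \prod_i ell i.
have Pnz : P != 0 by apply/prodf_neq0 => i _; apply: lnz.
have [x [y eA]] := span_line (or_introl erefl).
have [x' [y' eB]] := span_line (or_intror erefl).
have e2 r : wvec r = P * ((wedge (U A) (U B) r) *+ 2).
  have -> : wedge (U A) (U B) r =
      \sum_b \sum_c (pl b A * inv b) * (pl c B * inv c) * wedge (z (s b)) (z (s c)) r.
    rewrite wedge_suml; apply: eq_bigr => b _.
    rewrite wedgeC wedge_suml -sumrN mulr_sumr; apply: eq_bigr => c _.
    by rewrite [wedge (z (s c)) _ _]wedgeC; ring.
  (* Adding the double sum to its transpose antisymmetrizes the coefficients, producing
     [mform b c]. *)
  rewrite mulr2n [X in _ + X]exchange_big -big_split /= mulr_sumr; apply: eq_bigr => b _.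
  rewrite -big_split /= mulr_sumr; apply: eq_bigr => c _.
  rewrite [wedge (z (s c)) _ _]wedgeC.
  have := sform_generic b c; rewrite -/P mform_eval => e.
  have -> : S b c = (pl b A * pl c B - pl c A * pl b B) * P * (inv b * inv c).
    by rewrite -e /inv; field; rewrite !lnz.
  by ring.
have [d hd] : exists d, forall r, wvec r = d * v r.
  exists (P * (x * y' - y * x') *+ 2) => r; rewrite e2 eA eB.
  rewrite !(wedgeDl, wedgeDr, wedgeZl, wedgeZr) !wedgevv (wedgeC B A).
  ring.
suff -> : adj.@[v] = d by apply: hd.
(* Both sides are paired with edge [o] to identify the proportionality factor. *)
apply: (mulfI (lnz o)); rewrite -pairing_wvec /pairing !hd /lf /br /pairing; ring.
Qed.
End Generic.
End AtLine.

Lemma uniq5_le (e : seq 'I_n) : uniq e -> (size e <= n)%N.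
Proof. by move=> ue; have := max_card (mem e); rewrite (card_uniqP ue) card_ord. Qed.

Lemma generic_line : exists u : 'rV[F]_4 * 'rV[F]_4, \prod_i lf i u.1 u.2 != 0.
Proof.
apply: (linepoly_prod_nz char0 (f := fun i (u : 'rV[F]_4 * 'rV[F]_4) => lf i u.1 u.2)) => [i|i _ _].
  apply: linepoly_br; try exact: linevec_cst; by apply: linevec_linear.
by exists (z (s (s i)), z (s (s (s i)))); apply: gen; ords.
Qed.

Lemma wvecE A B q : wvec A B q = adj.@[wedge A B] * wedge A B q.
Proof.
have [u0 nz] := generic_line; pose V := ('rV[F]_4 * 'rV[F]_4)%type.
have l1 : linevec (fun u : V => u.1) by apply: linevec_linear.
have l2 : linevec (fun u : V => u.2) by apply: linevec_linear.
suff : wvec (A, B).1 (A, B).2 q - adj.@[wedge (A, B).1 (A, B).2] * wedge (A, B).1 (A, B).2 q = 0.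
  by move/eqP; rewrite subr_eq0 => /eqP.
apply: (linepoly_density char0 (u0 := u0) (g := fun u : V => \prod_i lf i u.1 u.2)
  (f := fun u : V => wvec u.1 u.2 q - adj.@[wedge u.1 u.2] * wedge u.1 u.2 q)) => //.
- apply: linepolyB; last by apply: linepolyM; [exact: linepoly_mevalw|exact: linepoly_wedge].
  apply: linepoly_sum => b; apply: linepoly_sum => c.
  by apply: linepolyM; [exact: linepoly_mevalw|exact: linepoly_cst].
- apply: linepoly_prod => i; apply: linepoly_br => //; exact: linevec_cst.
move=> u /prodf_neq0 lnz; rewrite wvec_generic ?subrr // => i; exact: lnz.
Qed.

Lemma prod_zero A B (e : seq 'I_n) i : i \notin e -> lf i A B = 0 ->
  \prod_(i | i \notin e) lf i A B = 0.
Proof. by move=> ie l0; rewrite (bigD1 i) //= l0 mul0r. Qed.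

(** If all terms of [W] vanish, [wvecE] gives the claim at a nonzero bivector. At the zero bivector
    positive degree is used, hence [5 <= n]. *)
Lemma adj_zero A B : (forall b c, (sform [::] b c).@[wedge A B] = 0) ->
  (5 <= n)%N -> adj.@[wedge A B] = 0.
Proof.
move=> S0 n5; have [[q nz]|no] := classic (exists q, wedge A B q != 0).
  apply: (mulIf nz); rewrite mul0r -wvecE /wvec big1 // => b _; rewrite big1 // => c _.
  by rewrite S0 mul0r.
apply: (meval_homog_zero adj_homog) => [|m]; first by rewrite subn_gt0.
by apply: NNPP => nz; apply: no; exists m; exact/eqP.
Qed.

Lemma nadj_next i : nadj i (s i) = false. Proof. by rewrite /nadj eqxx andbF. Qed.
Lemma nadj_prev i : nadj (s i) i = false. Proof. by rewrite /nadj eqxx !andbF. Qed.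
Lemma nadj_irr i : nadj i i = false. Proof. by rewrite /nadj eqxx. Qed.

(** Pigeonhole: among three pairwise nonadjacent indices two would fall into the same block. The
    blocks are the index groups omitted from a product in [sform]. *)
Lemma bad3_cover i j k e1 e2 : nadj i j -> nadj i k -> nadj j k ->
  (i \in e1 ++ e2) && (j \in e1 ++ e2) && (k \in e1 ++ e2) ->
  (forall x y, x \in e1 -> y \in e1 -> nadj x y -> False) ->
  (forall x y, x \in e2 -> y \in e2 -> nadj x y -> False) -> False.
Proof.
rewrite !mem_cat => ij ik jk /andP[/andP[/orP[i1|i2] /orP[j1|j2]] /orP[k1|k2]] h1 h2;
  solve [exact: h1 ij | exact: h1 ik | exact: h1 jk | exact: h2 ij | exact: h2 ik | exact: h2 jk].
Qed.

Lemma pair_nadj b x y : x \in [:: b; s b] -> y \in [:: b; s b] -> nadj x y -> False.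
Proof.
by rewrite !inE => /orP[]/eqP-> /orP[]/eqP->; rewrite ?nadj_next ?nadj_prev ?nadj_irr.
Qed.

Lemma bad3_sform i j k A B b c : bad3 z i j k A B -> (sform [::] b c).@[wedge A B] = 0.
Proof.
move=> [[ij ik jk] [li lj lk]].
have out (e1 e2 : seq 'I_n) : (forall x y, x \in e1 -> y \in e1 -> nadj x y -> False) ->
  (forall x y, x \in e2 -> y \in e2 -> nadj x y -> False) ->
  \prod_(i | i \notin e1 ++ e2) lf i A B = 0.
  move=> h1 h2; have [ie|ie] := boolP (i \in e1 ++ e2); last exact: prod_zero ie li.
  have [je|je] := boolP (j \in e1 ++ e2); last exact: prod_zero je lj.
  have [ke|ke] := boolP (k \in e1 ++ e2); last exact: prod_zero ke lk.
  by case: (bad3_cover ij ik jk _ h1 h2); rewrite ie je ke.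
have one (y0 x y : 'I_n) : x \in [:: y0] -> y \in [:: y0] -> nadj x y -> False.
  by rewrite !mem_seq1 => /eqP-> /eqP->; rewrite nadj_irr.
rewrite sform_eval; case: ifP => // _; case: ifP => _.
  by rewrite (out [:: b; s b] [:: s (s b)]) ?mulr0 //; [exact: pair_nadj|exact: one].
case: ifP => _.
  by rewrite (out [:: c; s c] [:: s (s c)]) ?mulr0 ?oppr0 //; [exact: pair_nadj|exact: one].
by rewrite (out [:: b; s b] [:: c; s c]) ?mulr0 //; exact: pair_nadj.
Qed.

(** If [b] or [c] is [b0], the factor [mform] vanishes on the plane, except in neighbouring terms.
    In all other terms, omitting both [b0] and [s b0] leaves only indices adjacent to these two as
    further omitted ones, so the factor at [c0] stays. *)
Lemma badQ_sform b0 c0 A B b c : badQ z b0 c0 A B -> (sform [::] b c).@[wedge A B] = 0.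
Proof.
move=> [[c1 c2 c3 c4] [l1 l2 l3 l4]].
have out (e : seq 'I_n) : (b0 \in e -> s b0 \in e -> c0 \in e -> False) ->
  \prod_(i | i \notin e) lf i A B = 0.
  move=> h; have [ie|ie] := boolP (b0 \in e); last exact: prod_zero ie l1.
  have [je|je] := boolP (s b0 \in e); last exact: prod_zero je l2.
  have [ke|ke] := boolP (c0 \in e); last exact: prod_zero ke l4.
  by case: h.
have adj3 b' : \prod_(i | i \notin [:: b'; s b'; s (s b')]) lf i A B = 0.
  have [n1 n2 n3] := ordS_neq b' n4.
  apply: out => /mem3E[] e1; rewrite {}e1 in c1 c2 c3 c4 *.
  - by move=> _ /mem3E[] e3; [move: c1|move: c2|move: c3]; rewrite e3 eqxx.
  - by move=> _ /mem3E[] e3; [move: c4|move: c1|move: c2]; rewrite e3 eqxx.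
  move/mem3E=> [/esym e2|/ordS_inj/esym e2|/ordS_inj/ordS_inj/esym e2].
  - by rewrite {1}e2 eqxx in n3.
  - by rewrite {1}e2 eqxx in n2.
  - by rewrite {1}e2 eqxx in n1.
rewrite sform_eval; have [//|nbc] := eqVneq b c.
have [cb|ncb] := eqVneq c (s b); first by rewrite adj3 mulr0.
have [bc'|nbc'] := eqVneq b (s c); first by rewrite adj3 mulr0 oppr0.
have [e|nb] := eqVneq b b0; first by rewrite e mform_plane ?mul0r.
have [e|nc] := eqVneq c b0; first by rewrite e mform_anti mform_plane ?oppr0 ?mul0r.
have [n1 n2 _] := ordS_neq b n4; have [m1 m2 _] := ordS_neq c n4.
suff -> : \prod_(i | i \notin [::] ++ [:: b; s b; c; s c]) lf i A B = 0 by rewrite mulr0.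
apply: out => /mem4E[] e1; [by rewrite e1 eqxx in nb| |by rewrite e1 eqxx in nc|];
  rewrite {}e1 in c1 c2 c3 c4 *.
- move/mem4E=> [/esym e2|/ordS_inj/esym e2|e2|/ordS_inj e2]; first by rewrite {1}e2 eqxx in n2.
  + by rewrite {1}e2 eqxx in n1.
  + by move/mem4E=> [] e3; [move: c4|move: c1|move: c2|move: c3]; rewrite e3 -?e2 eqxx.
  by rewrite e2 eqxx in ncb.
- move/mem4E=> [e2|/ordS_inj e2|/esym e2|/ordS_inj/esym e2].
  + by move/mem4E=> [] e3; [move: c2|move: c3|move: c4|move: c1]; rewrite e3 -?e2 eqxx.
  + by rewrite e2 eqxx in nbc'.
  + by rewrite {1}e2 eqxx in m2.
  by rewrite {1}e2 eqxx in m1.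
Qed.

Lemma adj_bad A B : bad z A B -> adj.@[wedge A B] = 0.
Proof.
move=> [[i [j [k h]]]|[b [c h]]]; apply: adj_zero => [b' c'|].
- exact: bad3_sform h.
- have [[ij ik jk] _] := h; apply: (@uniq5_le [:: i; s i; j; s j; k]); ords.
- exact: badQ_sform h.
have [[h1 h2 h3 h4] _] := h; apply: (@uniq5_le [:: b; s b; s (s b); c; s c]); ords.
Qed.

Lemma lf_pts i a b : uniq [:: a; b; i; s i] -> lf i (z a) (z b) != 0.
Proof. exact: gen. Qed.

(** At this line [l_i] vanishes for [i] equal to [a], [s a], [b], [s b], so a surviving term omits
    all four. Terms of neighbours omit only three. *)
Lemma sform_pts a b c d : nadj a b ->
  (sform [::] c d).@[wedge (z (s a)) (z (s b))] != 0 -> (c = a /\ d = b) \/ (c = b /\ d = a).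
Proof.
move=> ab.
have zero (e : seq 'I_n) x : x \in [:: a; s a; b; s b] -> x \notin e ->
    \prod_(i | i \notin e) lf i (z (s a)) (z (s b)) = 0.
  move=> hx hn; apply: prod_zero hn _; rewrite /lf.
  by case/mem4E: hx => ->; rewrite br_aabb.
have in_e (e : seq 'I_n) : \prod_(i | i \notin e) lf i (z (s a)) (z (s b)) != 0 ->
    [/\ a \in e, s a \in e, b \in e & s b \in e].
  move=> nz; split; apply: contraTT nz => hn; rewrite negbK; apply/eqP; apply: (zero e) hn;
    by rewrite !inE eqxx ?orbT.
have three (e' : seq 'I_n) : size e' = 3%N -> \prod_(i | i \notin e') lf i (z (s a)) (z (s b)) = 0.
  move=> e3; apply/eqP/negPn/negP => /in_e[h1 h2 h3 h4].
  have u4 : uniq [:: a; s a; b; s b] by ords.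
  have := uniq_leq_size u4; move=> /(_ e'); rewrite e3; move=> h; suff: false by [].
  by apply: h => x /mem4E[] ->.
rewrite sform_eval; have [|ncd] := eqVneq c d; first by rewrite eqxx.
have [dc|ndc] := eqVneq d (s c); first by rewrite three // mulr0 eqxx.
have [cd|ncd'] := eqVneq c (s d); first by rewrite three // mulr0 oppr0 eqxx.
rewrite mulf_eq0 negb_or mform_eval => /andP[nM /in_e[ha hsa hb hsb]].
have [n1 n2 _] := ordS_neq c n4; have [m1 m2 _] := ordS_neq d n4.
case/mem4E: ha => e1.
- left; split=> //; case/mem4E: hb => e2.
  + by rewrite -e1 in e2; move: ab; rewrite e2 nadj_irr.
  + by rewrite -e1 in e2; move: ab; rewrite e2 nadj_next.
  + by [].
  move: hsb; rewrite e2 => /mem4E[e3|/ordS_inj e3|/esym e3|/ordS_inj/esym e3].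
  + by move: ab; rewrite e1 -e3 e2 nadj_prev.
  + by rewrite e3 eqxx in ncd'.
  + by rewrite {1}e3 eqxx in m2.
  by rewrite {1}e3 eqxx in m1.
(* Here [a = s c]. The remaining possibility is [s a = d], where the planes [c] and [d] both contain
   [z (s a)] and [mform c d] vanishes. *)
- case/negP: nM; apply/eqP; rewrite e1 in hsa *.
  move: hsa => /mem4E[/esym e3|/ordS_inj/esym e3|e3|/ordS_inj e3].
  + by rewrite {1}e3 eqxx in n2.
  + by rewrite {1}e3 eqxx in n1.
  + by rewrite /pl -e3 !br_aabb; ring.
  by rewrite e3 eqxx in ndc.
- right; split=> //; case/mem4E: hb => e2.
  + by [].
  + move: hsb; rewrite e2 => /mem4E[/esym e3|/ordS_inj/esym e3|e3|/ordS_inj e3].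
    * by rewrite {1}e3 eqxx in n2.
    * by rewrite {1}e3 eqxx in n1.
    * by move: ab; rewrite e1 -e3 e2 nadj_prev.
    by rewrite e3 eqxx in ndc.
  + by rewrite -e1 in e2; move: ab; rewrite e2 nadj_irr.
  by rewrite -e1 in e2; move: ab; rewrite e2 nadj_next.
case/negP: nM; apply/eqP; rewrite e1 in hsa *.
move: hsa => /mem4E[e3|/ordS_inj e3|/esym e3|/ordS_inj/esym e3].
+ by rewrite /pl -e3 !br_aabb; ring.
+ by rewrite e3 eqxx in ncd'.
+ by rewrite {1}e3 eqxx in m2.
by rewrite {1}e3 eqxx in m1.
Qed.

Lemma sform_pt a b : nadj a b -> (sform [::] a b).@[wedge (z (s a)) (z (s b))] != 0.
Proof.
move=> ab; rewrite sform_eval.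
have [e|_] := eqVneq a b; first by rewrite e nadj_irr in ab.
have [e|_] := eqVneq b (s a); first by rewrite e nadj_next in ab.
have [e|_] := eqVneq a (s b); first by rewrite e nadj_prev in ab.
rewrite mulf_neq0 //.
  rewrite mform_eval /pl !br_aabb mul0r sub0r oppr_eq0 mulf_neq0 //; apply: gen; ords.
apply/prodf_neq0 => i; rewrite /= !inE !negb_or => /and4P[h1 h2 h3 h4].
by apply: lf_pts; ords.
Qed.

(** Only the terms [(a, b)] and [(b, a)] of [W] survive; they are equal by antisymmetry, so
    characteristic zero makes their sum nonzero. *)
Lemma adj_pt i j : nadj i j -> adj.@[wedge (z i) (z j)] != 0.
Proof.
have [a ->] := ordS_surj i; have [b ->] := ordS_surj j => sab.
have ab : nadj a b by ords.
have nab : a != b by apply: contraTneq ab => ->; rewrite nadj_irr.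
have [q nq] : exists q, wedge (z (s a)) (z (s b)) q != 0.
  by apply: (@br_wedge_nz _ _ _ (z a) (z b)); apply: gen; ords.
have S0 c d : ~ ((c = a /\ d = b) \/ (c = b /\ d = a)) ->
    (sform [::] c d).@[wedge (z (s a)) (z (s b))] = 0.
  by move=> no; apply/eqP/negPn/negP => nz; apply: no; apply: sform_pts nz.
have := wvecE (z (s a)) (z (s b)) q.
have row c d0 : (forall d, d != d0 -> ~ ((c = a /\ d = b) \/ (c = b /\ d = a))) ->
    \sum_d (sform [::] c d).@[wedge (z (s a)) (z (s b))] * wedge (z (s c)) (z (s d)) q =
    (sform [::] c d0).@[wedge (z (s a)) (z (s b))] * wedge (z (s c)) (z (s d0)) q.
  move=> no; rewrite (bigD1 d0) //= big1 ?addr0 // => d hd; rewrite S0 ?mul0r //; exact: no.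
rewrite /wvec (bigD1 a) //= (row a b); last first.
  by move=> d hd [[_ e]|[e _]]; [rewrite e eqxx in hd|rewrite e eqxx in nab].
rewrite [X in _ + X](bigD1 b) /=; last by rewrite eq_sym.
rewrite (row b a); last first.
  by move=> d hd [[e _]|[_ e]]; [rewrite e eqxx in nab|rewrite e eqxx in hd].
rewrite big1 => [|c /andP[ca cb]]; last first.
  by rewrite big1 // => d _; rewrite S0 ?mul0r // => -[[e _]|[e _]];
    [rewrite e eqxx in ca|rewrite e eqxx in cb].
rewrite addr0 (sform_antisym _ _ a b) [wedge (z (s b)) _ _]wedgeC mulrNN -mulr2n -mulrnAl => e.
apply/eqP => z0; move/eqP: e; rewrite z0 mul0r mulf_eq0 (negbTE nq) orbF -mulr_natl mulf_eq0.
by rewrite (negbTE (char0 1)) (negbTE (sform_pt ab)).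
Qed.
End Existence.

Theorem adjoint_exists (F : fieldType) n (z : 'I_n -> 'rV[F]_4) :
  (forall n, n.+1%:R != 0 :> F) -> (4 <= n)%N ->
  (forall a b c d, uniq [:: a; b; c; d] -> br (z a) (z b) (z c) (z d) != 0) ->
  exists f : {mpoly F[6]}, [/\ f \is (n - 4)%N.-homog,
    forall A B, bad z A B -> f.@[wedge A B] = 0 &
    forall i j, nadj i j -> f.@[wedge (z i) (z j)] != 0].
Proof.
move=> char0 n4 gen; have n0 : (0 < n)%N by apply: leq_trans n4.
exists (adj z (Ordinal n0)); split; first exact: adj_homog.
  by move=> A B; apply: adj_bad.
by move=> i j; apply: adj_pt.
Qed.

(** * Incidence loci *)

Section Incidence.
Variables (F : fieldType) (n : nat) (z : 'I_n -> 'rV[F]_4).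
Hypothesis n4 : (4 <= n)%N.
Hypothesis gen : forall a b c d, uniq [:: a; b; c; d] -> br (z a) (z b) (z c) (z d) != 0.
Local Notation s := ordS.
Local Notation vec := ('I_6 -> F).
Implicit Types (A B p q : 'rV[F]_4) (i j a b c d : 'I_n) (v w : 'I_6 -> F).

(* Linear conditions on bivectors: lines meeting [z_i z_(i+1)], lines through [z_a], lines in the
   plane [z_b z_(b+1) z_(b+2)]. *)
Definition KD i w := w = wedge (z i) (z (s i)).
Definition KP a w := exists x, w = wedge (z a) x.
Definition KQ b w := [\/ w = wedge (z b) (z (s b)), w = wedge (z (s b)) (z (s (s b)))
                       | w = wedge (z b) (z (s (s b)))].
Definition kills (K : vec -> Prop) v := forall w, K w -> pairing v w = 0.

Lemma killsD i A B : kills (KD i) (wedge A B) <-> lf z i A B = 0.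
Proof. by split=> [h|h w ->] //; apply: h. Qed.
Lemma killsP a A B : kills (KP a) (wedge A B) <-> forall x, br A B (z a) x = 0.
Proof. by split=> [h x|h w [x ->]] //; apply: h; exists x. Qed.
Lemma killsQ b A B : kills (KQ b) (wedge A B) <->
  [/\ lf z b A B = 0, lf z (s b) A B = 0 & br A B (z b) (z (s (s b))) = 0].
Proof.
split=> [h|[h1 h2 h3] w [] -> //].
by split; apply: h; [apply: Or31|apply: Or32|apply: Or33].
Qed.

Lemma killsP_D v i : kills (KP i) v -> kills (KD i) v.
Proof. by move=> h w ->; apply: h; exists (z (s i)). Qed.
Lemma killsP_Dp v i : kills (KP (s i)) v -> kills (KD i) v.
Proof.
move=> h w ->; have := h _ (ex_intro _ (z i) erefl).
have -> : pairing v (wedge (z i) (z (s i))) = - pairing v (wedge (z (s i)) (z i)).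
  by rewrite /pairing !(wedgeC (z i)); ring.
by move=> ->; rewrite oppr0.
Qed.
Lemma killsQ_D v b : kills (KQ b) v -> kills (KD b) v.
Proof. by move=> h w ->; apply: h; apply: Or31. Qed.
Lemma killsQ_Ds v b : kills (KQ b) v -> kills (KD (s b)) v.
Proof. by move=> h w ->; apply: h; apply: Or32. Qed.

Lemma two_others a b : a != b -> exists c d, uniq [:: a; b; c; d].
Proof.
move=> ab; pose T := [set c | c \notin [:: a; b]].
have cT : (2 <= #|T|)%N by apply: leq_trans (card_notin [:: a; b]); rewrite card_ord /=; lia.
case/card_gt1P: cT => c [d []]; rewrite !inE !negb_or => /andP[? ?] /andP[? ?] cd.
by exists c, d; ords.
Qed.

Lemma wedge_nz a b : a != b -> exists k, wedge (z a) (z b) k != 0.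
Proof.
move=> /two_others[c [d u4]].
by apply: (@br_wedge_nz _ _ _ (z c) (z d)); apply: gen.
Qed.

Lemma wedge_next i : exists k, wedge (z i) (z (s i)) k != 0.
Proof. by apply: wedge_nz; have [] := ordS_neq i n4. Qed.

Lemma parD i A B : kills (KD i) (wedge A B) -> exists x y C, wedge A B = wedge (ln z i x y) C.
Proof.
by have [k nz] := wedge_next i; move/killsD => h; exact: meet_line (elimN eqP nz) h.
Qed.

Lemma parDD i j A B k : wedge A B k != 0 -> nadj i j -> kills (KD i) (wedge A B) ->
  kills (KD j) (wedge A B) -> exists x y u t, wedge A B = wedge (ln z i x y) (ln z j u t).
Proof.
move=> nz ij /parD[x [y [C e]]] /killsD lj; exists x, y.
have nzs := br_skew n4 gen ij.
have [] := @meet_two F x y (z i) (z (s i)) (z j) (z (s j)) C k; rewrite -/(ln z i x y).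
- exact/eqP.
- by rewrite -e; apply/eqP.
- by move: lj; rewrite /lf /br e.
by move=> u [t e']; exists u, t; rewrite e e'.
Qed.

Lemma lmulVK (x y t : F) : x != 0 -> x * y = t -> y = x^-1 * t.
Proof. by move=> nx <-; rewrite mulKf. Qed.

(** In the basis of four consecutive vertices from [a] on, the coefficients of products without
    [z a] are pairings with products containing [z a], hence zero. *)
Lemma parP a A B : kills (KP a) (wedge A B) -> exists C, wedge A B = wedge (z a) C.
Proof.
move=> /killsP h; pose d := br (z a) (z (s a)) (z (s (s a))) (z (s (s (s a)))).
have dnz : d != 0 by apply: gen; ords.
pose e2 := z (s a); pose e3 := z (s (s a)); pose e4 := z (s (s (s a))).
exists (d^-1 *: (br A B e3 e4 *: e2 - br A B e2 e4 *: e3 + br A B e2 e3 *: e4)).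
apply: functional_extensionality => k.
rewrite wedgeZr; apply: (lmulVK dnz).
rewrite (bivector_expand (z a) e2 e3 e4) -/(br A B _ _) -!/(br _ _ _ _) !h.
rewrite -scaleNr !wedgeDr !wedgeZr; ring.
Qed.

Lemma par_thru e p q t B : br e p q t != 0 -> br e B p q = 0 ->
  exists x y, wedge e B = wedge e (x *: p + y *: q).
Proof.
move=> nz z0; have := br_cramer e p q t B.
have -> : br e p q B = 0 by rewrite br_swap34 br_swap23 z0 !oppr0.
rewrite scale0r addr0 => h.
exists ((br e p q t)^-1 * br e B q t), ((br e p q t)^-1 * br e p B t).
apply: functional_extensionality => k.
rewrite wedgeDr !wedgeZr -!mulrA -mulrDr; apply: (lmulVK nz).
have := congr1 (fun Y => wedge e Y k) h.
by rewrite !wedgeDr !wedgeZr wedgevv mulr0 add0r.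
Qed.

Lemma parPP a b A B : a != b -> kills (KP a) (wedge A B) -> kills (KP b) (wedge A B) ->
  exists x, wedge A B = wedge (z a) (x *: z b).
Proof.
move=> ab /parP[C e] hb; have [c [d u4]] := two_others ab.
rewrite e in hb *; move/killsP: hb => hb.
have := br_cramer (z a) (z b) (z c) (z d) C.
have -> : br (z a) (z b) C (z d) = 0 by rewrite br_swap23 hb oppr0.
have -> : br (z a) (z b) (z c) C = 0 by rewrite br_swap34 br_swap23 hb oppr0 oppr0.
rewrite !scale0r !addr0 => h; have dnz := gen u4.
exists ((br (z a) (z b) (z c) (z d))^-1 * br (z a) C (z c) (z d)).
apply: functional_extensionality => k; rewrite wedgeZr -mulrA; apply: (lmulVK dnz).
have := congr1 (fun Y => wedge (z a) Y k) h.
by rewrite !wedgeDr !wedgeZr wedgevv mulr0 add0r.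
Qed.

Definition pl3 b (x y t : F) := x *: z b + y *: z (s b) + t *: z (s (s b)).

Lemma wedge_pl3 b x y t x' y' t' k : wedge (pl3 b x y t) (pl3 b x' y' t') k =
  (x * y' - y * x') * wedge (z b) (z (s b)) k + (y * t' - t * y') * wedge (z (s b)) (z (s (s b))) k
  + (x * t' - t * x') * wedge (z b) (z (s (s b))) k.
Proof.
rewrite /pl3 !wedgeDl !wedgeDr !wedgeZl !wedgeZr !wedgevv.
rewrite (wedgeC (z (s b)) (z b)) (wedgeC (z (s (s b))) (z b)) (wedgeC (z (s (s b))) (z (s b))).
ring.
Qed.

Lemma killsQ_pl3 b x y t x' y' t' : kills (KQ b) (wedge (pl3 b x y t) (pl3 b x' y' t')).
Proof.
by move=> w [] ->; rewrite -/(br _ _ _ _) /pl3 !brE !br_aabb; ring.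
Qed.

(** Every bivector of a three-dimensional space is decomposable. *)
Lemma bivec3 b (x y t : F) : exists u : F * F * F * (F * F * F), forall k,
  x * wedge (z b) (z (s b)) k + y * wedge (z (s b)) (z (s (s b))) k
    + t * wedge (z b) (z (s (s b))) k =
  wedge (pl3 b u.1.1.1 u.1.1.2 u.1.2) (pl3 b u.2.1.1 u.2.1.2 u.2.2) k.
Proof.
have [->|nx] := eqVneq x 0.
  by exists ((t, y, 0), (0, 0, 1)) => k; rewrite wedge_pl3 /=; ring.
exists ((1, 0, - (y / x)), (0, x, t)) => k; rewrite wedge_pl3 /=; field; exact: nx.
Qed.

Lemma expandQ b A B : kills (KQ b) (wedge A B) -> exists x y t, forall k, wedge A B k =
  x * wedge (z b) (z (s b)) k + y * wedge (z (s b)) (z (s (s b))) k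
    + t * wedge (z b) (z (s (s b))) k.
Proof.
move=> /killsQ[h1 h2 h3].
pose e4 := z (s (s (s b))); pose d := br (z b) (z (s b)) (z (s (s b))) e4.
have dnz : d != 0 by apply: gen; ords.
exists (d^-1 * br A B (z (s (s b))) e4), (d^-1 * br A B (z b) e4), (- (d^-1 * br A B (z (s b)) e4)).
move=> k; rewrite (lmulVK dnz (bivector_expand _ _ _ e4 _ k)) -!/(br _ _ _ _).
rewrite -/(lf z (s b) A B) -/(lf z b A B) h1 h2 h3; ring.
Qed.

Lemma parQ b A B : kills (KQ b) (wedge A B) -> exists u : F * F * F * (F * F * F),
  wedge A B = wedge (pl3 b u.1.1.1 u.1.1.2 u.1.2) (pl3 b u.2.1.1 u.2.1.2 u.2.2).
Proof.
move=> /expandQ[x [y [t h]]]; have [u hu] := bivec3 b x y t; exists u.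
by apply: functional_extensionality => k; rewrite h hu.
Qed.

(** With first point [x z_i + y z_(i+1)], the condition for the next edge factors as [x] times the
    condition of lying in the plane [i]. *)
Lemma kills_adjacent i A B : kills (KD i) (wedge A B) -> kills (KD (s i)) (wedge A B) ->
  kills (KP (s i)) (wedge A B) \/ kills (KQ i) (wedge A B).
Proof.
move=> /parD[x [y [C ->]]] /killsD.
rewrite /lf /ln brDa !brZa br_aabb mulr0 addr0 => /eqP; rewrite mulf_eq0 => /orP[/eqP->|/eqP h].
  by left; apply/killsP => t; rewrite scale0r add0r brZa br_aabb mulr0.
right; apply/killsQ; rewrite /lf !brDa !brZa !br_aabb h; split; try ring.
by rewrite br_swap13 h; ring.
Qed.

Lemma killsPQ a b A B k : wedge A B k != 0 -> kills (KP a) (wedge A B) -> kills (KQ b) (wedge A B) ->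
  [|| a == b, a == s b | a == s (s b)].
Proof.
move=> nz /parP[C e]; rewrite e in nz *; move=> /killsQ[h1 h2 h3].
apply/negPn/negP; rewrite !negb_or => /and3P[ab asb assb].
case/negP: nz; apply/eqP.
have dnz : br (z a) (z b) (z (s b)) (z (s (s b))) != 0 by apply: gen; ords.
apply: (mulfI dnz); rewrite mulr0.
rewrite /lf in h1 h2; rewrite bivector_expand -!/(br _ _ _ _) !br_aabb h1 h2 h3; ring.
Qed.

Lemma killsPD_Q a A B : kills (KP a) (wedge A B) -> kills (KD (s a)) (wedge A B) ->
  kills (KQ a) (wedge A B).
Proof.
by move=> /parP[C ->] /killsD h; apply/killsQ; split; rewrite ?h // /lf br_aabb.
Qed.

Lemma killsPD_Qp b A B : kills (KP (s (s b))) (wedge A B) -> kills (KD b) (wedge A B) ->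
  kills (KQ b) (wedge A B).
Proof.
by move=> /parP[C ->] /killsD h; apply/killsQ; split; rewrite ?h // /lf br_aabb.
Qed.

Lemma br_thru e p q t B : br e p q t != 0 -> br e B p q = 0 -> br e B p t = 0 ->
  forall x, br e B p x = 0.
Proof.
move=> nz h1 h2 x; apply: (mulfI nz); rewrite mulr0 -brZb br_cramer.
have -> : br e p q B = 0 by rewrite br_swap34 br_swap23 h1 !oppr0.
have -> : br e p B t = 0 by rewrite br_swap23 h2 oppr0.
by rewrite !brE !br_aabb; ring.
Qed.

(** The plane [b] meets edge [b+2] only in [z_(b+2)], so a line of that plane meeting the edge
    passes through this vertex. [killsPQ_prev] is the mirror image. *)
Lemma killsPQ_next b A B : kills (KP (s b)) (wedge A B) -> kills (KQ b) (wedge A B) ->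
  kills (KD (s (s b))) (wedge A B) -> kills (KP (s (s b))) (wedge A B).
Proof.
move=> /parP[C ->] /killsQ[h1 h2 h3] /killsD h; apply/killsP.
apply: (br_thru (q := z (s (s (s b)))) (t := z b)); [by apply: gen; ords|by []|].
by rewrite br_swap34 h3 oppr0.
Qed.

Lemma killsPQ_prev c A B : kills (KP (s (s c))) (wedge A B) -> kills (KQ (s c)) (wedge A B) ->
  kills (KD c) (wedge A B) -> kills (KP (s c)) (wedge A B).
Proof.
move=> /parP[C ->] /killsQ[h1 h2 h3] /killsD h; apply/killsP.
apply: (br_thru (q := z c) (t := z (s (s (s c))))); [by apply: gen; ords| |by []].
by rewrite br_swap34; move: h; rewrite /lf => ->; rewrite oppr0.
Qed.

(** Two consecutive planes meet exactly in edge [b+1], so the line is that edge. *)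
Lemma killsQQ b A B : kills (KQ b) (wedge A B) -> kills (KQ (s b)) (wedge A B) ->
  kills (KP (s b)) (wedge A B).
Proof.
move=> /expandQ[x [y [t h]]] hQ.
pose e4 := z (s (s (s b))); pose d := br (z b) (z (s b)) (z (s (s b))) e4.
have dnz : d != 0 by apply: gen; ords.
have E w : pairing (wedge A B) w = x * pairing (wedge (z b) (z (s b))) w
   + y * pairing (wedge (z (s b)) (z (s (s b)))) w + t * pairing (wedge (z b) (z (s (s b)))) w.
  by rewrite {1}/pairing !h /pairing; ring.
have x0 : x = 0.
  apply: (mulIf dnz); rewrite mul0r; have := hQ _ (Or32 _ _ erefl).
  by rewrite E -!/(br _ _ _ _) !br_aabb -/e4 -/d => <-; ring.
have t0 : t = 0.
  apply: (mulIf dnz); rewrite mul0r; have := hQ _ (Or33 _ _ erefl).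
  rewrite E -!/(br _ _ _ _) !br_aabb -/e4 x0 => e.
  by rewrite -oppr0 -e /d br_swap23; ring.
move=> w [p ->]; rewrite E x0 t0 -!/(br _ _ _ _) !br_aabb; ring.
Qed.

(* The second point of the unique line through a point [A] of one line meeting two others. *)
Definition regulus j k A :=
  br A (z (s j)) (z k) (z (s k)) *: z j - br A (z j) (z k) (z (s k)) *: z (s j).

Lemma kills_regulus i j k x y t :
  [/\ kills (KD i) (wedge (ln z i x y) (t *: regulus j k (ln z i x y))),
      kills (KD j) (wedge (ln z i x y) (t *: regulus j k (ln z i x y))) &
      kills (KD k) (wedge (ln z i x y) (t *: regulus j k (ln z i x y)))].
Proof.
split; apply/killsD.
- exact: lf_lnl.
- move: (ln z i x y) => P; rewrite /lf /regulus brZb -scaleNr brDb !brZb.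
  have -> : br P (z j) (z j) (z (s j)) = 0 by rewrite br_aabb.
  have -> : br P (z (s j)) (z j) (z (s j)) = 0 by rewrite br_aabb.
  ring.
rewrite /lf /regulus brZb -scaleNr brDb !brZb; ring.
Qed.

Lemma parDDD i j k A B m : wedge A B m != 0 -> nadj i j -> nadj i k -> nadj j k ->
  kills (KD i) (wedge A B) -> kills (KD j) (wedge A B) -> kills (KD k) (wedge A B) ->
  exists x y t, wedge A B = wedge (ln z i x y) (t *: regulus j k (ln z i x y)).
Proof.
move=> nz ij ik jk hi hj hk; have [x [y [u [t e]]]] := parDD nz ij hi hj.
exists x, y; rewrite e in nz hk *; move/killsD: hk.
set P := ln z i x y in nz *; rewrite /lf /(ln z j u t) brDb !brZb => h.
have [b0|nb] := eqVneq (br P (z (s j)) (z k) (z (s k))) 0; last first.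
  exists (u / br P (z (s j)) (z k) (z (s k))).
  congr (wedge P _); rewrite /regulus scalerBr !scalerA divfK // -scaleNr; congr (_ + _ *: _).
  apply: (mulIf nb); rewrite -mulNr mulrAC -mulNr divfK // mulNr.
  by apply/eqP; rewrite -addr_eq0 addrC h.
have [a0|na] := eqVneq (br P (z j) (z k) (z (s k))) 0; last first.
  exists (- t / br P (z j) (z k) (z (s k))).
  congr (wedge P _); rewrite /regulus scalerBr !scalerA divfK // b0 mulr0 scale0r sub0r.
  have -> : u = 0 by apply: (mulIf na); rewrite mul0r -h b0 mulr0 addr0.
  by rewrite scale0r add0r scaleNr opprK.
(* Both coefficients of the regulus vanish, so Cramer's rule puts [P] on edge [k]. But [P] is on the
   skew edge [i], so [P] is zero. *)
case/negP: nz; apply/eqP.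
have d0 := br_skew n4 gen jk; have := br_cramer (z j) (z (s j)) (z k) (z (s k)) P.
rewrite br_swap12 in a0; have {}a0 : br (z j) P (z k) (z (s k)) = 0.
  by apply: oppr_inj; rewrite a0 oppr0.
rewrite b0 a0 !scale0r !add0r; set d := br _ _ _ _ in d0 *.
set c1 := br _ _ P _; set c2 := br _ _ _ P => E.
have [|xx yy _ _] := br_free (elimN eqP (br_skew n4 gen ik)) (x := d * x) (y := d * y)
  (z := - c1) (w := - c2).
  by rewrite -!scalerA -scalerDr -/(ln z i x y) -/P E !scaleNr -addrA -opprD subrr.
have x0 : x = 0 by apply: (mulfI d0); rewrite xx mulr0.
have y0 : y = 0 by apply: (mulfI d0); rewrite yy mulr0.
by rewrite /P /ln x0 y0 !scale0r addr0 wedge0l.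
Qed.

(** The lines of the plane [b] meeting edge [c]: the condition is linear in the three side
    coordinates, and it is solved for that of [z b], [z (s b)]. The result is linear in [y] and
    [t]. *)
Definition pencilQD b c (y t : F) k :=
  - (y * br (z (s b)) (z (s (s b))) (z c) (z (s c)) + t * br (z b) (z (s (s b))) (z c) (z (s c)))
    / br (z b) (z (s b)) (z c) (z (s c)) * wedge (z b) (z (s b)) k
  + y * wedge (z (s b)) (z (s (s b))) k + t * wedge (z b) (z (s (s b))) k.

Lemma pencilQD_wedge b c y t : exists A B, pencilQD b c y t = wedge A B.
Proof.
have [u hu] := bivec3 b (- (y * br (z (s b)) (z (s (s b))) (z c) (z (s c)) +
  t * br (z b) (z (s (s b))) (z c) (z (s c))) / br (z b) (z (s b)) (z c) (z (s c))) y t.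
by do 2!eexists; apply: functional_extensionality => k; apply: hu.
Qed.

Lemma nadjQ b c : c != b -> c != s b -> c != s (s b) -> s c != b ->
  br (z b) (z (s b)) (z c) (z (s c)) != 0.
Proof. by move=> *; apply: gen; ords. Qed.

Lemma kills_pencilQD b c y t : br (z b) (z (s b)) (z c) (z (s c)) != 0 ->
  kills (KQ b) (pencilQD b c y t) /\ kills (KD c) (pencilQD b c y t).
Proof.
move=> nz.
pose x := - (y * br (z (s b)) (z (s (s b))) (z c) (z (s c)) + t * br (z b) (z (s (s b))) (z c) (z (s c)))
    / br (z b) (z (s b)) (z c) (z (s c)).
have E w : pairing (pencilQD b c y t) w = x * pairing (wedge (z b) (z (s b))) w
   + y * pairing (wedge (z (s b)) (z (s (s b)))) w + t * pairing (wedge (z b) (z (s (s b)))) w.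
  by rewrite /pencilQD -/x /pairing; ring.
split=> w; first by case=> ->; rewrite E -!/(br _ _ _ _) !br_aabb; ring.
by move=> ->; rewrite E -!/(br _ _ _ _) /x; field.
Qed.

Lemma parQD b c A B : br (z b) (z (s b)) (z c) (z (s c)) != 0 ->
  kills (KQ b) (wedge A B) -> kills (KD c) (wedge A B) ->
  exists y t, wedge A B = pencilQD b c y t.
Proof.
move=> nz /expandQ[x [y [t h]]] hc; exists y, t.
have E w : pairing (wedge A B) w = x * pairing (wedge (z b) (z (s b))) w
   + y * pairing (wedge (z (s b)) (z (s (s b)))) w + t * pairing (wedge (z b) (z (s (s b)))) w.
  by rewrite {1}/pairing !h /pairing; ring.
have := hc _ erefl; rewrite E -!/(br _ _ _ _) => e.
apply: functional_extensionality => k; rewrite h /pencilQD; congr (_ * _ + _ + _).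
apply: (mulIf nz); rewrite divfK //; apply/eqP; rewrite -addr_eq0 addrA; exact/eqP.
Qed.

Lemma pencilQD_nz b c : exists k, pencilQD b c 0 1 k != 0.
Proof.
apply: NNPP => no.
have z0 k : pencilQD b c 0 1 k = 0 by apply/eqP/negPn/negP => nz; apply: no; exists k.
have nz : br (z b) (z (s (s b))) (z (s b)) (z (s (s (s b)))) != 0 by apply: gen; ords.
case/negP: nz; apply/eqP.
pose x := - (0 * br (z (s b)) (z (s (s b))) (z c) (z (s c)) + 1 * br (z b) (z (s (s b))) (z c) (z (s c)))
    / br (z b) (z (s b)) (z c) (z (s c)).
have <- : pairing (pencilQD b c 0 1) (wedge (z (s b)) (z (s (s (s b))))) = 0.
  by rewrite /pairing !z0; ring.
rewrite /pencilQD -/x.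
have -> : br (z b) (z (s (s b))) (z (s b)) (z (s (s (s b)))) =
  x * br (z b) (z (s b)) (z (s b)) (z (s (s (s b)))) +
  0 * br (z (s b)) (z (s (s b))) (z (s b)) (z (s (s (s b)))) +
  1 * br (z b) (z (s (s b))) (z (s b)) (z (s (s (s b)))).
  by rewrite !br_aabb; ring.
rewrite /br /pairing; ring.
Qed.

End Incidence.

(** * Irreducibility of the incidence loci *)

Section Loci.
Variables (n : nat) (z : 'I_n -> 'rV[C]_4).
Hypothesis n4 : (4 <= n)%N.
Hypothesis gen : forall a b c d, uniq [:: a; b; c; d] -> br (z a) (z b) (z c) (z d) != 0.
Local Notation s := ordS.
Local Notation vec := ('I_6 -> C).
Implicit Types (i j a b c d : 'I_n) (K : vec -> Prop).

Definition locus K : cset := fun v => Gr v /\ kills K v.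
Definition orK K K' : vec -> Prop := fun w => K w \/ K' w.

Lemma kills_or K K' v : kills (orK K K') v <-> kills K v /\ kills K' v.
Proof.
split=> [h|[h h'] w []]; [|exact: h|exact: h'].
by split=> w hw; apply: h; [left|right].
Qed.

Lemma cset_ext (S T : cset) : (forall v, S v <-> T v) -> S = T.
Proof.
by move=> h; apply: functional_extensionality => v; apply: propositional_extensionality.
Qed.

Lemma locus_or K K' : locus (orK K K') = fun v => locus K v /\ locus K' v.
Proof.
apply: cset_ext => v; rewrite /locus kills_or.
by split=> [[? []]|[[? ?] []]].
Qed.

Lemma zclosed_locus K : zclosed (locus K).
Proof.
exists (fun f => exists2 w, K w & f = linform (hodge w)) => v; split=> -[gv h]; split=> //.
  by move=> f [w Kw ->]; rewrite hodge_eval; apply: h.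
by move=> w Kw; rewrite -hodge_eval; apply: h; exists w.
Qed.

Lemma irreducible_wedge (V : lmodType C) (al be : V -> 'rV[C]_4) K :
  linevec al -> linevec be -> (forall u, kills K (wedge (al u) (be u))) ->
  (forall A B k, wedge A B k != 0 -> kills K (wedge A B) ->
     exists u, wedge A B = wedge (al u) (be u)) ->
  (exists v, locus K v) -> irreducible (locus K).
Proof.
move=> la lb into onto ne.
apply: (irreducible_param (phi := fun u => wedge (al u) (be u))) => //.
- by move=> k; apply: linepoly_wedge.
- exact: zclosed_locus.
- by move=> u k nz; split; [exact: wedge_Gr nz|exact: into].
move=> v [gv hv]; have [k nz] := Gr_nz gv; have [A [B e]] := GrP gv.
rewrite e in nz hv *; exact: onto nz hv.
Qed.

Lemma locus_wedge K A B k : wedge A B k != 0 -> kills K (wedge A B) -> exists v, locus K v.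
Proof. by move=> nz h; exists (wedge A B); split=> //; apply: wedge_Gr nz. Qed.

Lemma linevec_lc (V : lmodType C) (f g : V -> C) (p q : 'rV[C]_4) :
  linepoly f -> linepoly g -> linevec (fun u => f u *: p + g u *: q).
Proof. by move=> hf hg; apply: linevecD; apply: linevecZ => //; apply: linevec_cst. Qed.

Lemma irrD i : irreducible (locus (KD z i)).
Proof.
pose V := (C^o * C^o * 'rV[C]_4)%type.
apply: (irreducible_wedge (V := V) (al := fun u => ln z i u.1.1 u.1.2) (be := fun u => u.2)).
- have [l1 l2] := linepoly_pair C.
  exact: (linevec_lc _ _ (@linepoly_fst C (C^o * C^o)%type _ _ l1) (@linepoly_fst C (C^o * C^o)%type _ _ l2)).
- exact: linevec_snd.
- by move=> u; apply/killsD/lf_lnl.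
- by move=> A B k _ /(parD n4 gen)[x [y [X ->]]]; exists (x, y, X).
have [k nz] := wedge_next n4 gen i; apply: locus_wedge nz _.
by apply/killsD; rewrite /lf br_aabb.
Qed.

Lemma irrDD i j : nadj i j -> irreducible (locus (orK (KD z i) (KD z j))).
Proof.
move=> ij; pose V := (C^o * C^o * (C^o * C^o))%type.
apply: (irreducible_wedge (V := V) (al := fun u => ln z i u.1.1 u.1.2)
  (be := fun u => ln z j u.2.1 u.2.2)).
- by have [l1 l2 _ _] := linepoly_pair2 C; exact: (linevec_lc _ _ l1 l2).
- by have [_ _ l1 l2] := linepoly_pair2 C; exact: (linevec_lc _ _ l1 l2).
- by move=> u; apply/kills_or; split; apply/killsD; [exact: lf_lnl|exact: lf_lnr].
- move=> A B k nz /kills_or[hi hj].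
  by have [x [y [u [t ->]]]] := parDD n4 gen nz ij hi hj; exists (x, y, (u, t)).
have ne : i != j by case/and3P: ij.
have [k nz] := wedge_nz n4 gen ne; apply: locus_wedge nz _.
by apply/kills_or; split; apply/killsD; rewrite /lf br_aabb.
Qed.

Lemma irrP a : irreducible (locus (KP z a)).
Proof.
apply: (irreducible_wedge (V := 'rV[C]_4) (al := fun u => z a) (be := fun u => u)).
- exact: linevec_cst.
- exact: linevec_id.
- by move=> u; apply/killsP => x; rewrite br_aabb.
- by move=> A B k _ /(parP n4 gen)[X ->]; exists X.
have [k nz] := wedge_next n4 gen a; apply: locus_wedge nz _.
by apply/killsP => x; rewrite br_aabb.
Qed.

(** A pencil through a vertex; [t] only witnesses that [z a] is off the line [p q]. That line is an
    edge, or the side [z b z (b+2)] for the lines through [z (b+1)] in the plane [b]. *)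
Lemma irrPl a p q t : br (z a) p q t != 0 ->
  irreducible (locus (orK (KP z a) (fun w => w = wedge p q))).
Proof.
move=> nz; pose V := (C^o * C^o)%type.
apply: (irreducible_wedge (V := V) (al := fun u => z a) (be := fun u => (u.1 : C) *: p + (u.2 : C) *: q)).
- exact: linevec_cst.
- by have [l1 l2] := linepoly_pair C; exact: (linevec_lc _ _ l1 l2).
- move=> u; apply/kills_or; split; first by apply/killsP => x; rewrite br_aabb.
  by move=> w ->; rewrite -/(br _ _ _ _) brDb !brZb !br_aabb !mulr0 addr0.
- move=> A B k _ /kills_or[/(parP n4 gen)[X e] h].
  have h' := h _ erefl; rewrite e in h'.
  by have [x [y e']] := par_thru nz h'; exists (x, y); rewrite e e'.
have [k nzk] := br_wedge_nz nz; apply: locus_wedge nzk _.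
apply/kills_or; split; first by apply/killsP => x; rewrite br_aabb.
by move=> w ->; rewrite -/(br _ _ _ _) br_aabb.
Qed.

Lemma irrPP a b : a != b -> irreducible (locus (orK (KP z a) (KP z b))).
Proof.
move=> ab.
apply: (irreducible_wedge (V := (C^o : lmodType C)) (al := fun u => z a) (be := fun u : C => u *: z b)).
- exact: linevec_cst.
- by apply: (linevecZ (f := fun u : C^o => u)); [exact: linepoly_id|exact: linevec_cst].
- move=> u; apply/kills_or; split; apply/killsP => x; rewrite ?br_aabb //.
  by rewrite brZb br_aabb mulr0.
- by move=> A B k _ /kills_or[ha hb]; have [x ->] := parPP n4 gen ab ha hb; exists x.
have [k nz] := wedge_nz n4 gen ab; apply: locus_wedge nz _.
by apply/kills_or; split; apply/killsP => x; rewrite br_aabb.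
Qed.

Lemma irrQ b : irreducible (locus (KQ z b)).
Proof.
pose V := ((C^o * C^o * C^o) * (C^o * C^o * C^o))%type.
have lpl (f g h : V -> C) : linepoly f -> linepoly g -> linepoly h ->
    linevec (fun u => pl3 z b (f u) (g u) (h u)).
  by move=> hf hg hh; do ![apply: linevecD | apply: linevecZ => //; exact: linevec_cst].
apply: (irreducible_wedge (V := V) (al := fun u => pl3 z b u.1.1.1 u.1.1.2 u.1.2)
  (be := fun u => pl3 z b u.2.1.1 u.2.1.2 u.2.2)).
- by have [[l1 l2 l3] _] := linepoly_triple2 C; exact: lpl l1 l2 l3.
- by have [_ [l1 l2 l3]] := linepoly_triple2 C; exact: lpl l1 l2 l3.
- by move=> u; apply: killsQ_pl3.
- by move=> A B k _ /(parQ n4 gen)[u ->]; exists u.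
have [k nz] := wedge_next n4 gen b; apply: locus_wedge nz _.
by apply/killsQ; rewrite /lf !br_aabb.
Qed.

Lemma irrDDD i j k : nadj i j -> nadj i k -> nadj j k ->
  irreducible (locus (orK (orK (KD z i) (KD z j)) (KD z k))).
Proof.
move=> ij ik jk; pose V := (C^o * C^o * C^o)%type.
have l1 : linevec (fun u : V => ln z i u.1.1 u.1.2).
  by have [h1 h2 _] := linepoly_triple C; exact: (linevec_lc _ _ h1 h2).
apply: (irreducible_wedge (V := V) (al := fun u => ln z i u.1.1 u.1.2)
  (be := fun u => (u.2 : C) *: regulus z j k (ln z i u.1.1 u.1.2))) => //.
- apply: (linevecZ (f := fun u : V => u.2)); first by have [] := linepoly_triple C.
  apply: linevecD; first by apply: linevecZ; [apply: linepoly_br => //; exact: linevec_cst|exact: linevec_cst].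
  have -> : (fun u : V => - (br (ln z i u.1.1 u.1.2) (z j) (z k) (z (s k)) *: z (s j))) =
    (fun u : V => br (ln z i u.1.1 u.1.2) (z j) (z k) (z (s k)) *: (- z (s j))).
    by apply: functional_extensionality => u; rewrite scalerN.
  by apply: linevecZ; [apply: linepoly_br => //; exact: linevec_cst|exact: linevec_cst].
- move=> u; have [h1 h2 h3] := kills_regulus z i j k u.1.1 u.1.2 u.2.
  by apply/kills_or; split=> //; apply/kills_or.
- move=> A B m nz /kills_or[/kills_or[hi hj] hk].
  by have [x [y [t ->]]] := parDDD n4 gen nz ij ik jk hi hj hk; exists (x, y, t).
have n1 : br (z i) (z (s j)) (z k) (z (s k)) != 0 by apply: gen; ords.
have [m nz] : exists m, wedge (ln z i 1 0) (1 *: regulus z j k (ln z i 1 0)) m != 0.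
  have [||m nz] := ln_skew n4 gen (x := 1) (y := 0) (u := br (z i) (z (s j)) (z k) (z (s k)))
    (w := - br (z i) (z j) (z k) (z (s k))) ij.
  - by rewrite oner_eq0.
  - by rewrite n1.
  by exists m; rewrite scale1r /regulus ln10 -scaleNr -/(ln z j _ _) -{1}(ln10 z).
apply: locus_wedge nz _; have [h1 h2 h3] := kills_regulus z i j k 1 0 1.
by apply/kills_or; split=> //; apply/kills_or.
Qed.

Lemma irrQD b c : c != b -> c != s b -> c != s (s b) -> s c != b ->
  irreducible (locus (orK (KQ z b) (KD z c))).
Proof.
move=> h1 h2 h3 h4; have nz := nadjQ n4 gen h1 h2 h3 h4.
pose V := (C^o * C^o)%type.
have kp u : kills (orK (KQ z b) (KD z c)) (pencilQD z b c u.1 u.2).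
  by apply/kills_or; apply: kills_pencilQD.
apply: (irreducible_param (V := V) (phi := fun u => pencilQD z b c u.1 u.2)).
- move=> k; rewrite /pencilQD.
  pose f1 (u : V) : C := u.1; pose f2 (u : V) : C := u.2.
  have [l1 l2] : linepoly f1 /\ linepoly f2 by exact: linepoly_pair.
  have mulx (f : V -> C) x : linepoly f -> linepoly (fun u => f u * x).
    by move=> hf; apply: linepolyM => //; apply: linepoly_cst.
  apply: linepolyD; last exact: (mulx f2).
  apply: linepolyD; last exact: (mulx f1).
  apply: (mulx); apply: (mulx); apply: linepolyN; apply: linepolyD; [exact: (mulx f1)|exact: (mulx f2)].
- exact: zclosed_locus.
- have [k nzk] := pencilQD_nz n4 gen b c; exists (pencilQD z b c 0 1).
  have [A [B e]] := pencilQD_wedge z b c 0 1.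
  by split; [rewrite e in nzk *; exact: wedge_Gr nzk|exact: (kp (0, 1))].
- move=> u k nzk; split; last exact: kp.
  by have [A [B e]] := pencilQD_wedge z b c u.1 u.2; rewrite e in nzk *; apply: wedge_Gr nzk.
move=> v [gv hv]; have [A [B e]] := GrP gv; rewrite e in hv *.
by have [hq hd] := iffLR (kills_or _ _ _) hv; have [y [t ->]] := parQD n4 gen nz hq hd; exists (y, t).
Qed.

End Loci.

Lemma pairing_wedgeZ (F : comNzRingType) t (p q : 'rV[F]_4) w :
  pairing (wedge p (t *: q)) w = t * pairing (wedge p q) w.
Proof. by rewrite /pairing !wedgeZr; ring. Qed.

Lemma mul_eq0_or (F : fieldType) (x y : F) : x * y = 0 -> x = 0 \/ y = 0.
Proof. by move/eqP; rewrite mulf_eq0 => /orP[]/eqP; [left|right]. Qed.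

(** * Strata of the boundary *)

Section Strata.
Variables (n : nat) (Z : 'M[R]_(n, 4)).
Local Notation z := (fun i => row i (ZC Z)).
Hypothesis n4 : (4 <= n)%N.
Hypothesis gen : forall a b c d, uniq [:: a; b; c; d] -> br (z a) (z b) (z c) (z d) != 0.
Hypothesis ampl_vertex : forall a b : 'I_n, a != b -> Ampl Z (wedge (z a) (z b)).
Local Notation s := ordS.
Local Notation vec := ('I_6 -> C).
Local Notation KD := (KD z).
Local Notation KP := (KP z).
Local Notation KQ := (KQ z).
Implicit Types (i j a b c d : 'I_n) (K : vec -> Prop) (Y S : cset).

Lemma Dbound_locus i : Dbound Z i = locus (KD i).
Proof.
apply: cset_ext => v; split.
  case=> M [rM -> bM]; split; first by exists M.
  by move=> w ->; rewrite plucker_wedge -/(br _ _ _ _) -det_col_br.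
case=> -[M [rM ->]] h; exists M; split=> //.
by rewrite /bracket det_col_br /br -plucker_wedge; apply: h.
Qed.

Definition atom K := [\/ exists i, K = KD i, exists a, K = KP a | exists b, K = KQ b].
Definition on Y K := forall v, Y v -> kills K v.

(** The smallest locus cut out by atoms that contains [Y] when [Y] lies in [Gr]. All killed
    bivectors form one predicate, so that it is again a [locus]. *)
Definition hull Y : cset := locus (fun w => exists K, [/\ atom K, on Y K & K w]).

Lemma hullP Y v : hull Y v <-> Gr v /\ forall K, atom K -> on Y K -> kills K v.
Proof.
split=> -[gv h]; split=> //; first by move=> K aK oK w Kw; apply: h; exists K.
by move=> w [K [aK oK Kw]]; apply: h Kw.
Qed.

Lemma hull_mono Y S : csub Y S -> csub (hull Y) (hull S).
Proof.
move=> YS v /hullP[gv h]; apply/hullP; split=> // K aK oK; apply: h => //.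
by move=> u /YS; apply: oK.
Qed.

Definition badv v := exists A B, v = wedge A B /\ bad z A B.

Lemma badv3 i j k v : nadj i j -> nadj i k -> nadj j k -> Gr v ->
  kills (KD i) v -> kills (KD j) v -> kills (KD k) v -> badv v.
Proof.
move=> ij ik jk /GrP[A [B ->]] /killsD hi /killsD hj /killsD hk.
by exists A, B; split=> //; left; exists i, j, k.
Qed.

Lemma badvQ b c v : c != b -> c != s b -> c != s (s b) -> s c != b -> Gr v ->
  kills (KQ b) v -> kills (KD c) v -> badv v.
Proof.
move=> c1 c2 c3 c4 /GrP[A [B ->]] /killsQ[h1 h2 h3] /killsD hc.
by exists A, B; split=> //; right; exists b, c.
Qed.

Lemma zclosed_Gr Y v : zclosed Y -> Y v -> Gr v.
Proof. by case=> F' h /h []. Qed.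

Section Hull.
Variable Y : cset.
Hypothesis irrY : irreducible Y.
Hypothesis notbad : ~ (forall v, Y v -> badv v).

Lemma inY v : Y v -> Gr v.
Proof. by case: irrY => zY _ _; apply: zclosed_Gr. Qed.

Lemma on_nb3 i j k : nadj i j -> nadj i k -> nadj j k ->
  on Y (KD i) -> on Y (KD j) -> on Y (KD k) -> False.
Proof.
move=> ij ik jk hi hj hk; apply: notbad => v Yv.
by apply: (badv3 ij ik jk (inY Yv)); [exact: hi|exact: hj|exact: hk].
Qed.

Lemma on_nbQ b c : c != b -> c != s b -> c != s (s b) -> s c != b ->
  on Y (KQ b) -> on Y (KD c) -> False.
Proof.
move=> c1 c2 c3 c4 hb hc; apply: notbad => v Yv.
by apply: (badvQ c1 c2 c3 c4 (inY Yv)); [exact: hb|exact: hc].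
Qed.

Lemma on_PD i : on Y (KP i) -> on Y (KD i).
Proof. by move=> h v /h; apply: killsP_D. Qed.
Lemma on_PDp i : on Y (KP (s i)) -> on Y (KD i).
Proof. by move=> h v /h; apply: killsP_Dp. Qed.
Lemma on_QD b : on Y (KQ b) -> on Y (KD b).
Proof. by move=> h v /h; apply: killsQ_D. Qed.
Lemma on_QDs b : on Y (KQ b) -> on Y (KD (s b)).
Proof. by move=> h v /h; apply: killsQ_Ds. Qed.

(** Irreducibility of [Y] upgrades the dichotomy for each line in [kills_adjacent] to all of [Y]. *)
Lemma on_adjacent i : on Y (KD i) -> on Y (KD (s i)) -> on Y (KP (s i)) \/ on Y (KQ i).
Proof.
move=> hi hsi; case: irrY => _ _ /(_ (locus (KP (s i))) (locus (KQ i))).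
case; try exact: zclosed_locus.
- move=> v Yv; have gv := inY Yv; have [A [B e]] := GrP gv.
  have h1 := hi v Yv; have h2 := hsi v Yv; rewrite e in h1 h2 gv *.
  by case: (kills_adjacent n4 gen h1 h2); [left|right].
- by move=> h; left=> v /h [].
by move=> h; right=> v /h [].
Qed.

Lemma on_PQ a b : on Y (KP a) -> on Y (KQ b) -> [|| a == b, a == s b | a == s (s b)].
Proof.
move=> ha hb; case: irrY => _ [v Yv] _; have gv := inY Yv; have [A [B e]] := GrP gv.
have [k nz] := Gr_nz gv; have h1 := ha v Yv; have h2 := hb v Yv; rewrite e in nz h1 h2.
exact: (killsPQ n4 gen nz h1 h2).
Qed.

Lemma on_PQ_next b : on Y (KP (s b)) -> on Y (KQ b) -> on Y (KD (s (s b))) -> on Y (KP (s (s b))).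
Proof.
move=> h1 h2 h3 v Yv; have [A [B e]] := GrP (inY Yv).
move: (h1 v Yv) (h2 v Yv) (h3 v Yv); rewrite e; by apply: killsPQ_next.
Qed.

Lemma on_PQ_prev c : on Y (KP (s (s c))) -> on Y (KQ (s c)) -> on Y (KD c) -> on Y (KP (s c)).
Proof.
move=> h1 h2 h3 v Yv; have [A [B e]] := GrP (inY Yv).
move: (h1 v Yv) (h2 v Yv) (h3 v Yv); rewrite e; by apply: killsPQ_prev.
Qed.

Lemma on_PD_Q a : on Y (KP a) -> on Y (KD (s a)) -> on Y (KQ a).
Proof.
move=> h1 h2 v Yv; have [A [B e]] := GrP (inY Yv).
move: (h1 v Yv) (h2 v Yv); rewrite e; by apply: killsPD_Q.
Qed.

Lemma on_QQ b : on Y (KQ b) -> on Y (KQ (s b)) -> on Y (KP (s b)).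
Proof.
move=> h1 h2 v Yv; have [A [B e]] := GrP (inY Yv).
move: (h1 v Yv) (h2 v Yv); rewrite e; by apply: killsQQ.
Qed.

Definition hull_good := irreducible (hull Y) /\ exists v, hull Y v /\ Ampl Z v.

Lemma hull_good_locus K a b : irreducible (locus K) ->
  (forall v, Gr v -> (forall K', atom K' -> on Y K' -> kills K' v) -> kills K v) ->
  (forall K' v, atom K' -> on Y K' -> locus K v -> kills K' v) ->
  a != b -> kills K (wedge (z a) (z b)) -> hull_good.
Proof.
move=> irr h1 h2 ab hab.
have e : hull Y = locus K.
  apply: cset_ext => v; rewrite hullP; split=> [[gv h]|lv]; first by split=> //; apply: h1.
  by split=> [|K' aK' oK']; [case: lv|apply: h2].
rewrite /hull_good e; split=> //; exists (wedge (z a) (z b)); split; last exact: ampl_vertex.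
by have [k nz] := wedge_nz n4 gen ab; split=> //; apply: wedge_Gr nz.
Qed.

Lemma atomD i : atom (KD i). Proof. by apply: Or31; exists i. Qed.
Lemma atomP a : atom (KP a). Proof. by apply: Or32; exists a. Qed.
Lemma atomQ b : atom (KQ b). Proof. by apply: Or33; exists b. Qed.

(** All points of [Y] are multiples of one bivector, so an atom on [Y] holds on the whole locus as
    soon as it holds at one point. *)
Lemma hull_PP a b : a != b -> on Y (KP a) -> on Y (KP b) -> hull_good.
Proof.
move=> ab ha hb; apply: (hull_good_locus (irrPP n4 gen ab) _ _ ab).
- by move=> v _ h; apply/kills_or; split; apply: h => //; exact: atomP.
- move=> K' v aK oK [gv /kills_or[va vb]].
  case: irrY => _ [v0 Yv0] _; have g0 := inY Yv0; have [k nz0] := Gr_nz g0.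
  have h1 := ha _ Yv0; have h2 := hb _ Yv0; have h3 := oK _ Yv0.
  have [A0 [B0 e0]] := GrP g0; have [A [B e]] := GrP gv; rewrite e e0 in h1 h2 h3 va vb nz0 *.
  have [x ex] := parPP n4 gen ab h1 h2; have [y ey] := parPP n4 gen ab va vb.
  rewrite ex in h3 nz0; rewrite ey => w Kw; have := h3 w Kw.
  rewrite !pairing_wedgeZ => /mul_eq0_or[x0|->]; last by rewrite mulr0.
  by move: nz0; rewrite x0 wedgeZr mul0r eqxx.
by apply/kills_or; split; apply/killsP => x; rewrite br_aabb.
Qed.

Lemma other_index (e : seq 'I_n) : (size e <= 3)%N -> exists d, d \notin e.
Proof.
move=> e3; have := card_notin e; rewrite card_ord => le.
have /card_gt0P[d] : (0 < #|[set k | k \notin e]|)%N by apply: leq_trans _ le; rewrite subn_gt0; apply: leq_ltn_trans e3 n4.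
by rewrite inE; exists d.
Qed.

Lemma gen_point_line x c d : c != x -> s c != x -> d \notin [:: x; c; s c] ->
  br (z x) (z c) (z (s c)) (z d) != 0.
Proof.
by move=> c1 c2; rewrite !inE !negb_or => /and3P[? ? ?]; apply: gen; ords.
Qed.

Section ThroughPoint.
Variable a2 : 'I_n.
(** The vertex is presented as a second successor so that the edges before it have names. *)
Let a1 := s a2.
Let a := s a1.
Hypothesis onPa : on Y (KP a).
Hypothesis onlyP : forall b, on Y (KP b) -> b = a.

(** Adjacent [c], [d] would force a second common vertex or a plane missing [z a]. Nonadjacent ones
    form a disjoint triple with one of the two edges at [z a], except in the configuration [far]. *)
Lemma no_two_extra c d : c != a -> s c != a -> d != a -> s d != a -> c != d ->
  on Y (KD c) -> on Y (KD d) -> False.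
Proof.
have next e f : e != a -> s e != a -> f != a -> s f != a ->
    on Y (KD e) -> on Y (KD f) -> f = s e -> False.
  move=> e1 e2 f1 f2 he hf ef; rewrite ef in f1 f2 hf.
  case: (on_adjacent he hf) => [/onlyP h|/(on_PQ onPa)]; first by rewrite h eqxx in e2.
  by move/or3P=> []/eqP h; [rewrite h eqxx in e1|rewrite h eqxx in e2|rewrite h eqxx in f2].
(* One edge follows edge [a] and the other precedes [a1], so neither edge at [z a] is disjoint from
   both; instead [Y] lies in the plane [a] and meets [f]. *)
have far e f : e != a -> s e != a -> f != a -> s f != a -> nadj e f ->
    on Y (KD e) -> on Y (KD f) -> e = s a -> s f = a1 -> False.
  move=> e1 e2 f1 f2 ef he hf ea fa; rewrite ea in he ef.
  by apply: (@on_nbQ a f _ _ _ _ (on_PD_Q onPa he) hf) => //; ords.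
move=> c1 c2 d1 d2 cd hc hd.
have ncd : nadj c d.
  rewrite /nadj cd /=; apply/andP; split; apply/eqP => h.
    exact: (next c d c1 c2 d1 d2 hc hd (esym h)).
  exact: (next d c d1 d2 c1 c2 hd hc h).
have ndc : nadj d c by apply: nadj_sym.
have ha := on_PD onPa; have ha1 : on Y (KD a1) := on_PDp onPa.
have nadja e : e != a -> s e != a -> e != s a -> nadj a e.
  by move=> e1 e2 e3; apply/and3P; split; rewrite eq_sym.
have nadja1 e : e != a -> s e != a -> s e != a1 -> nadj a1 e.
  move=> e1 e2 e3; apply/and3P; split; [|by rewrite eq_sym|by rewrite eq_sym].
  by apply/eqP => h; rewrite -h in e2; case/negP: e2; apply/eqP.
have [ca|nca] := eqVneq c (s a); have [da1|nda1] := eqVneq (s d) a1;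
  have [da|nda] := eqVneq d (s a); have [ca1|nca1] := eqVneq (s c) a1;
  try (by exact: (far c d)); try (by exact: (far d c));
  try (by rewrite ca da eqxx in cd);
  try (by apply: (on_nb3 (nadja c _ _ _) (nadja d _ _ _) ncd ha hc hd));
  try (by apply: (on_nb3 (nadja1 c _ _ _) (nadja1 d _ _ _) ncd ha1 hc hd)).
- have [_ _] := ordS_neq a1 n4; by rewrite -/a -ca ca1 eqxx.
- have [_ _] := ordS_neq a1 n4; by rewrite -/a -da da1 eqxx.
Qed.

(** With exactly one vertex common to all lines of [Y], the hull is the pencil through it meeting
    one further edge, the pencil in the plane centred at it, or the full star. *)
Lemma hull_P : hull_good.
Proof.
have [n1 n2 n3] := ordS_neq a n4.
have a1a : a1 != a by have [] := ordS_neq a1 n4.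
have a2a : a2 != a by have [_ + _] := ordS_neq a2 n4.
have onlyPw b v : on Y (KP b) -> kills (KP a) v -> kills (KP b) v by move=> /onlyP ->.
have [[c [c1 c2 hc]]|noc] := classic (exists c, [/\ c != a, s c != a & on Y (KD c)]).
  have uc d : on Y (KD d) -> d != a -> s d != a -> d = c.
    move=> hd d1 d2; apply/eqP/negPn/negP => cd; exact: (no_two_extra d1 d2 c1 c2 cd hd hc).
  have [d hd] : exists d, d \notin [:: a; c; s c] by apply: other_index.
  have nz : br (z a) (z c) (z (s c)) (z d) != 0.
    exact: gen_point_line.
  apply: (hull_good_locus (irrPl n4 gen nz) (a := a) (b := c)).
  - by move=> v _ h; apply/kills_or; split; [exact: (h _ (atomP a) onPa)|exact: (h _ (atomD c) hc)].
  - move=> K' v [[e ->]|[e ->]|[e ->]] oK [gv /kills_or[va vc]].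
    + have [->|ea] := eqVneq e a; first exact: killsP_D.
      have [h|sea] := eqVneq (s e) a; first by apply: killsP_Dp; rewrite h.
      by rewrite (uc e oK ea sea).
    + exact: onlyPw.
    have [A [B ev]] := GrP gv; rewrite ev in va vc *.
    case/or3P: (on_PQ onPa oK) => /eqP h.
    + rewrite -h in oK *; have := uc _ (on_QDs oK); rewrite eq_sym n1 eq_sym n2 => /(_ isT isT) h'.
      by apply: killsPD_Q => //; rewrite h'.
    (* A plane with middle vertex [z a] is incompatible with the further edge [c]: a [c] next to the
       plane forces a second vertex, any other makes [Y] bad. *)
    + exfalso; have [ca|nca] := eqVneq c (s a).
        have := on_PQ_next _ oK; rewrite -h -ca => /(_ onPa hc)/onlyP h'.
        by rewrite h' eqxx in c1.
      have [ce|nce] := eqVneq (s c) e.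
        have := @on_PQ_prev c; rewrite ce -h => /(_ onPa oK hc)/onlyP h'.
        by rewrite ce h' eqxx in c2.
      apply: (on_nbQ _ _ _ nce oK hc); rewrite -?h //.
      by apply: contraNneq c2 => ->; rewrite h.
    have ee : e = c.
      apply: uc; first exact: on_QD.
        by rewrite h; have [_ + _] := ordS_neq e n4.
      by rewrite h; have [+ _ _] := ordS_neq (s e) n4.
    by apply: killsPD_Qp => //; rewrite -?h ?ee.
  - by rewrite eq_sym.
  apply/kills_or; split; first by apply/killsP => x; rewrite br_aabb.
  by move=> w ->; rewrite -/(br _ _ _ _) br_aabb.
have uD d : on Y (KD d) -> d != a -> s d != a -> False.
  by move=> hd d1 d2; apply: noc; exists d.
have atQ b : on Y (KQ b) -> a = s b.
  move=> hb; case/or3P: (on_PQ onPa hb) => /eqP h //; exfalso.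
    by apply: (uD _ (on_QDs hb)); rewrite -h eq_sym.
  apply: (uD _ (on_QD hb)); rewrite h; first by have [_ + _] := ordS_neq b n4.
  by have [+ _ _] := ordS_neq (s b) n4.
have hDa v e : on Y (KD e) -> kills (KP a) v -> kills (KD e) v.
  move=> oK va; have [->|ea] := eqVneq e a; first exact: killsP_D.
  have [h|sea] := eqVneq (s e) a; first by apply: killsP_Dp; rewrite h.
  by case: (uD e).
(* No further edge is left, so a plane containing [Y] has [z a] as its middle vertex; its remaining
   side cuts out the pencil. *)
have [[b hb]|noQ] := classic (exists b, on Y (KQ b)).
  have ab := atQ b hb.
  have nz : br (z a) (z b) (z (s (s b))) (z (s (s (s b)))) != 0 by apply: gen; rewrite ab; clear -n4; ords.
  apply: (hull_good_locus (irrPl n4 gen nz) (a := a) (b := s a)) => //.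
  - move=> v _ h; apply/kills_or; split; first exact: (h _ (atomP a) onPa).
    by move=> w ->; apply: (h _ (atomQ b) hb); apply: Or33.
  - move=> K' v [[e ->]|[e ->]|[e ->]] oK [gv /kills_or[va vc]]; [exact: hDa|exact: onlyPw|].
    have -> : e = b by apply: (@ordS_inj n); rewrite -ab -(atQ e).
    rewrite ab in va => w [] ew; [|by apply: va; exists (z (s (s b)))|exact: vc].
    exact: (killsP_Dp va).
  apply/kills_or; split; first by apply/killsP => x; rewrite br_aabb.
  by move=> w ->; rewrite ab -/(br _ _ _ _) br_aabb.
apply: (hull_good_locus (irrP n4 gen a) (a := a) (b := s a)) => //.
- by move=> v _ h; exact: (h _ (atomP a) onPa).
- move=> K' v [[e ->]|[e ->]|[e ->]] oK [gv va]; [exact: hDa|exact: onlyPw|].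
  by case: noQ; exists e.
by apply/killsP => x; rewrite br_aabb.
Qed.
End ThroughPoint.

(** Without a common vertex, adjacent edges force a plane, and a plane admits no edge besides its
    own two. What remains is one plane, two disjoint edges, or a single edge. *)
Lemma hull_noP i : on Y (KD i) -> (forall a, ~ on Y (KP a)) -> hull_good.
Proof.
move=> hi noP.
have adjQ c : on Y (KD c) -> on Y (KD (s c)) -> on Y (KQ c).
  by move=> h1 h2; case: (on_adjacent h1 h2) => // /noP.
have noQQ b : on Y (KQ b) -> on Y (KQ (s b)) -> False.
  by move=> h1 h2; apply: (noP (s b)); apply: on_QQ.
have [[b hb]|noQ] := classic (exists b, on Y (KQ b)).
  have cb c : on Y (KD c) -> c = b \/ c = s b.
    move=> hc; have [->|n1] := eqVneq c b; first by left.
    have [->|n2] := eqVneq c (s b); first by right.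
    exfalso; have [e|n3] := eqVneq c (s (s b)).
      rewrite e in hc; exact: (noQQ b hb (adjQ _ (on_QDs hb) hc)).
    have [e|n4'] := eqVneq (s c) b.
      by have := adjQ c hc; rewrite e => /(_ (on_QD hb)) h; apply: (noQQ c h); rewrite e.
    exact: (on_nbQ n1 n2 n3 n4' hb hc).
  apply: (hull_good_locus (irrQ n4 gen b) (a := b) (b := s b)).
  - by move=> v _ h; exact: (h _ (atomQ b) hb).
  - move=> K' v [[e ->]|[e ->]|[e ->]] oK [gv va]; last 1 first.
    + case: (cb e (on_QD oK)) => h; first by rewrite h.
      by rewrite h in oK; case: (noQQ b hb oK).
    + by case: (cb e oK) => ->; [apply: killsQ_D|apply: killsQ_Ds].
    by case: (noP e).
  - by have [] := ordS_neq b n4.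
  by apply/killsQ; rewrite /lf !br_aabb.
have nQ b : on Y (KQ b) -> False by move=> h; apply: noQ; exists b.
have nonadj c d : on Y (KD c) -> on Y (KD d) -> c != d -> nadj c d.
  move=> hc hd cd; rewrite /nadj cd /=; apply/andP; split; apply/eqP => h.
    by apply: (nQ c); apply: adjQ => //; rewrite h.
  by apply: (nQ d); apply: adjQ => //; rewrite -h.
have [[j [hj ij]]|noj] := classic (exists j, on Y (KD j) /\ i != j).
  have nij := nonadj i j hi hj ij.
  apply: (hull_good_locus (irrDD n4 gen nij) (a := i) (b := j)) => //.
  - by move=> v _ h; apply/kills_or; split; apply: h => //; exact: atomD.
  - move=> K' v [[e ->]|[e ->]|[e ->]] oK [gv /kills_or[vi vj]]; [|by case: (noP e)|by case: (nQ e)].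
    have [->|n1] := eqVneq e i; first by [].
    have [->|n2] := eqVneq e j; first by [].
    exfalso; apply: (on_nb3 nij (nonadj i e hi oK _) (nonadj j e hj oK _) hi hj oK); by rewrite eq_sym.
  by apply/kills_or; split; apply/killsD; rewrite /lf br_aabb.
apply: (hull_good_locus (irrD n4 gen i) (a := i) (b := s i)).
- by move=> v _ h; apply: h => //; exact: atomD.
- move=> K' v [[e ->]|[e ->]|[e ->]] oK [gv vi]; [|by case: (noP e)|by case: (nQ e)].
  have [->|n1] := eqVneq e i; first by [].
  by case: noj; exists e; split=> //; rewrite eq_sym.
- by have [] := ordS_neq i n4.
by apply/killsD; rewrite /lf br_aabb.
Qed.

Lemma hull_goodP i : on Y (KD i) -> hull_good.
Proof.
move=> hi; have [[a ha]|noP] := classic (exists a, on Y (KP a)); last first.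
  by apply: (hull_noP hi) => a ha; apply: noP; exists a.
have [[b [hb ab]]|uniqP] := classic (exists b, on Y (KP b) /\ a != b).
  exact: hull_PP ab ha hb.
have [a1 e1] := ordS_surj a; have [a2 e2] := ordS_surj a1; subst.
apply: (hull_P ha) => b hb; apply/eqP; rewrite eq_sym; apply/negPn/negP => ab.
by apply: uniqP; exists b.
Qed.

End Hull.

(** The induction invariant. Keeping [csub (hull S) S] in it is what places the hull of a component
    inside both intersected strata. *)
Lemma stratum_cases S : stratum Z S ->
  [/\ irreducible S, exists i, on S (KD i) &
      (forall v, S v -> badv v) \/ (csub (hull S) S /\ exists v, S v /\ Ampl Z v)].
Proof.
elim=> [i|S1 T Y _ [irrS [i hi] hS] _ [irrT _ hT] [irrY YST maxY]].
  rewrite Dbound_locus; have [k nz] := wedge_next n4 gen i.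
  have hk : kills (KD i) (wedge (z i) (z (s i))) by apply/killsD; rewrite /lf br_aabb.
  split; [exact: irrD|by exists i => v []|right; split].
    move=> v /hullP[gv h]; split=> //; apply: h; first exact: atomD.
    by move=> u [].
  exists (wedge (z i) (z (s i))); split; first by split=> //; apply: wedge_Gr nz.
  by apply: ampl_vertex; have [] := ordS_neq i n4.
have hYi : on Y (KD i) by move=> v /YST[/hi].
split=> //; first by exists i.
case: hS => [bS|[hullS _]]; first by left=> v /YST[/bS].
case: hT => [bT|[hullT _]]; first by left=> v /YST[_ /bT].
have [bY|nb] := classic (forall v, Y v -> badv v); first by left.
right; have [irrH [v [hv Av]]] := hull_goodP irrY nb hYi.
have YH : csub Y (hull Y).
  by move=> u Yu; apply/hullP; split; [exact: (inY irrY)|move=> K _ oK; apply: oK].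
(* The hull is irreducible, contains [Y], and lies in the intersection by monotonicity, so
   maximality of the component applies. *)
have HY : csub (hull Y) Y.
  apply: maxY => // u hu; split.
    by apply: hullS; apply: hull_mono hu => w /YST[].
  by apply: hullT; apply: hull_mono hu => w /YST[].
by split=> //; exists v; split=> //; apply: HY.
Qed.

Lemma residual_bad v : residual Z v -> badv v.
Proof.
case=> S [/stratum_cases[_ _ [bS _ Sv|[_ [u [Su Au]]] dis _]]]; first exact: bS.
by case: (dis u Su).
Qed.

Lemma irr_component_self Y X : irreducible Y -> (forall v, Y v <-> X v) -> irr_component Y X.
Proof. by move=> irrY e; split=> // [v /e|W _ _ h v /h /e]. Qed.

Lemma stratumDD i j : nadj i j -> stratum Z (locus (orK (KD i) (KD j))).
Proof.
move=> ij; apply: (stratum_comp (stratum_base Z i) (stratum_base Z j)).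
by rewrite !Dbound_locus; apply: irr_component_self; [exact: irrDD|rewrite locus_or].
Qed.

Lemma stratumDDD i j k : nadj i j -> nadj i k -> nadj j k ->
  stratum Z (locus (orK (orK (KD i) (KD j)) (KD k))).
Proof.
move=> ij ik jk; apply: (stratum_comp (stratumDD ij) (stratum_base Z k)).
by rewrite !Dbound_locus; apply: irr_component_self; [exact: irrDDD|rewrite locus_or].
Qed.

(** An irreducible set between the plane locus and [D_b /\ D_(b+1)] lies in the plane locus or in
    the star of [z (s b)]. *)
Lemma stratumQ b : stratum Z (locus (KQ b)).
Proof.
apply: (stratum_comp (stratum_base Z b) (stratum_base Z (s b))).
rewrite !Dbound_locus; split; first exact: irrQ.
  by move=> v [gv h]; split; split=> //; [apply: killsQ_D|apply: killsQ_Ds].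
move=> W irrW QW WX; case: (irrW) => _ _ /(_ (locus (KP (s b))) (locus (KQ b))).
case; try exact: zclosed_locus.
- move=> v /WX[[gv h1] [_ h2]]; have [A [B e]] := GrP gv; rewrite e in h1 h2 gv *.
  by case: (kills_adjacent n4 gen h1 h2); [left|right].
(* The side [z b z (b+2)] lies in the plane but misses [z (b+1)]. *)
- move=> WP; exfalso.
  have ne : b != s (s b) by have [] := ordS_neq b n4.
  have [m nz] := wedge_nz n4 gen ne.
  have : locus (KP (s b)) (wedge (z b) (z (s (s b)))).
    apply/WP/QW; split; first exact: wedge_Gr nz.
    by apply/killsQ; rewrite /lf !br_aabb.
  case=> _ /killsP/(_ (z (s (s (s b)))))/eqP.
  by apply/negP; apply: gen; clear -n4; ords.
by [].
Qed.

Lemma stratumQD b c : c != b -> c != s b -> c != s (s b) -> s c != b ->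
  stratum Z (locus (orK (KQ b) (KD c))).
Proof.
move=> c1 c2 c3 c4; apply: (stratum_comp (stratumQ b) (stratum_base Z c)).
by rewrite !Dbound_locus; apply: irr_component_self; [exact: irrQD|rewrite locus_or].
Qed.

Hypothesis ampl_bad : forall v, Ampl Z v -> ~ badv v.

Lemma bad_residual A B k : wedge A B k != 0 -> bad z A B -> residual Z (wedge A B).
Proof.
move=> nz [[i [j [l [[ij il jl] [hi hj hl]]]]]|[b [c [[c1 c2 c3 c4] [h1 h2 h3 h4]]]]].
  exists (locus (orK (orK (KD i) (KD j)) (KD l))); split; first exact: stratumDDD.
    by move=> w [gw /kills_or[/kills_or[? ?] ?]] /ampl_bad; apply; exact: (badv3 ij il jl).
  split; first exact: wedge_Gr nz.
  by apply/kills_or; split; [apply/kills_or; split|]; apply/killsD.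
exists (locus (orK (KQ b) (KD c))); split; first exact: stratumQD.
  by move=> w [gw /kills_or[? ?]] /ampl_bad; apply; exact: (badvQ c1 c2 c3 c4).
split; first exact: wedge_Gr nz.
by apply/kills_or; split; [apply/killsQ|apply/killsD].
Qed.

End Strata.

(** * Total positivity *)

Section Positivity.
Variables (n : nat) (Z : 'M[R]_(n, 4)).
Hypothesis n4 : (4 <= n)%N.
Hypothesis tp : totally_positive Z.
Local Notation s := ordS.
Local Notation zr := (fun i => row i Z).
Implicit Types (a b c d i j k x y : 'I_n).
Local Notation g a b c d := (br (row a Z) (row b Z) (row c Z) (row d Z)).

Lemma br_sorted a b c d : (a < b)%N -> (b < c)%N -> (c < d)%N -> 0 < g a b c d.
Proof.
move=> ab bc cd; pose f (k : 'I_4) := nth a [:: a; b; c; d] k.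
have mono (k l : 'I_4) : (k < l)%N -> (f k < f l)%N.
  by case: k l => -[|[|[|[|k]]]] hk [[|[|[|[|l]]]] hl] //= _; rewrite /f /=; lia.
have := tp mono; set X := (X in \det X); rewrite (det4_br X).
have e (k : 'I_4) : row k X = row (f k) Z by apply/rowP => l; rewrite !mxE.
by rewrite !e /f !inordK.
Qed.

Lemma br_ne12 a b c d : (g a b c d != 0) = (g b a c d != 0).
Proof. by rewrite br_swap12 oppr_eq0. Qed.
Lemma br_ne23 a b c d : (g a b c d != 0) = (g a c b d != 0).
Proof. by rewrite br_swap23 oppr_eq0. Qed.
Lemma br_ne34 a b c d : (g a b c d != 0) = (g a b d c != 0).
Proof. by rewrite br_swap34 oppr_eq0. Qed.

(** Insertion sort: in [Lk] the last [k] indices already increase. Signs are irrelevant, as only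
    nonvanishing is followed. *)
Lemma br_distinct a b c d : uniq [:: a; b; c; d] -> g a b c d != 0.
Proof.
have L4 (x y u v : 'I_n) : (x < y)%N -> (y < u)%N -> (u < v)%N -> g x y u v != 0.
  by move=> *; rewrite gt_eqF //; apply: br_sorted.
have L3 (x y u v : 'I_n) : (y < u)%N -> (u < v)%N -> uniq [:: x; y; u; v] -> g x y u v != 0.
  move=> yu uv; rewrite /= !inE !negb_or -!val_eqE /= !neq_ltn => /andP[/and3P[xy xu xv] _].
  case/orP: xy => xy; first exact: L4.
  rewrite br_ne12; case/orP: xu => xu; first exact: L4.
  rewrite br_ne23; case/orP: xv => xv; first exact: L4.
  by rewrite br_ne34; apply: L4.
have L2 (x y u v : 'I_n) : (u < v)%N -> uniq [:: x; y; u; v] -> g x y u v != 0.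
  move=> uv h.
  have [yu|yu] := ltnP y u; first exact: L3.
  have h1 : uniq [:: x; u; y; v] by move: h; rewrite /= !inE !negb_or ![u == y]eq_sym;
    do ![case: (_ == _) => //=].
  have ne : (u < y)%N.
    rewrite ltn_neqAle yu andbT; move: h1; rewrite /= !inE !negb_or => /and3P[_ /andP[]] //.
  rewrite br_ne23; have [yv|yv] := ltnP y v; first exact: L3.
  rewrite br_ne34; apply: L3 => //; last first.
    by move: h1; rewrite /= !inE !negb_or ![v == y]eq_sym; do ![case: (_ == _) => //=].
  rewrite ltn_neqAle yv andbT; move: h1; rewrite /= !inE !negb_or => /and4P[_ _ + _].
  by rewrite eq_sym.
move=> h; have [cd|cd] := ltnP c d; first exact: L2.
rewrite br_ne34; apply: L2.
  by rewrite ltn_neqAle cd andbT; move: h; rewrite /= !inE !negb_or => /and4P[_ _ + _]; rewrite eq_sym.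
by move: h; rewrite /= !inE !negb_or ![d == c]eq_sym; do ![case: (_ == _) => //=].
Qed.

(** Moving a consecutive pair past other rows is even. Only the wrapping edge, whose end 0 must pass
    three rows, gets the sign -1. *)
Lemma sign_line i : exists e : R, (e = 1 \/ e = -1) /\ forall a b, (a < b)%N ->
  a != i -> a != s i -> b != i -> b != s i -> 0 < e * g a b i (s i).
Proof.
move: (ordS_cases i) (ltn_ord (s i)); move: (s i) => j hj lj.
case: hj => [[e lt]|[e0 en]].
  exists 1; split; first by left.
  move=> a b ab; rewrite -!val_eqE /= => a1 a2 b1 b2; rewrite mul1r.
  have [bi|bi] := ltnP b i; first by apply: br_sorted; lia.
  have [ai|ai] := ltnP a i.
    by rewrite br_swap23 br_swap34 opprK; apply: br_sorted; lia.
  rewrite br_swap23 br_swap12 br_swap34 br_swap23 !opprK.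
  by apply: br_sorted; lia.
exists (-1); split; first by right.
move=> a b ab; rewrite -!val_eqE /= => a1 a2 b1 b2; rewrite mulN1r.
rewrite br_swap34 br_swap23 br_swap12 !opprK.
have := ltn_ord b; have := ltn_ord a => la lb.
by apply: br_sorted; lia.
Qed.

(** One of the two columns is [b+1], so no other index separates [b], [b+1], [b+2] cyclically and
    the sorting sign depends on [b] alone. *)
Lemma sign_plane b : exists e : R, (e = 1 \/ e = -1) /\ forall x y, (x < y)%N ->
  (x = s b \/ y = s b) -> x != b -> x != s (s b) -> y != b -> y != s (s b) ->
  0 < e * g x y b (s (s b)).
Proof.
move: (ordS_cases (s b)) (ltn_ord (s (s b))); move: (s (s b)) => t.
move: (ordS_cases b) (ltn_ord (s b)); move: (s b) => r hr lr ht lt.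
case: hr => [[e1 l1]|[e1 l1]]; case: ht => [[e2 l2]|[e2 l2]]; last by lia.
- exists (-1); split; first by right.
  move=> x y xy hs; rewrite -!val_eqE /= => x1 x2 y1 y2; rewrite mulN1r.
  case: hs => h; rewrite h in xy x1 x2 y1 y2 *.
    by rewrite br_swap23 br_swap12 br_swap34 !opprK; apply: br_sorted; lia.
  by rewrite br_swap23 opprK; apply: br_sorted; lia.
- exists 1; split; first by left.
  move=> x y xy hs; rewrite -!val_eqE /= => x1 x2 y1 y2; rewrite mul1r.
  have ly := ltn_ord y; case: hs => h; rewrite h in xy x1 x2 y1 y2 *.
    by exfalso; lia.
  by rewrite br_swap34 br_swap23 br_swap12 br_swap34 !opprK; apply: br_sorted; lia.
exists 1; split; first by left.
move=> x y xy hs; rewrite -!val_eqE /= => x1 x2 y1 y2; rewrite mul1r.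
have ly := ltn_ord y; case: hs => h; rewrite h in xy x1 x2 y1 y2 *; last by exfalso; lia.
by rewrite br_swap34 br_swap23 !opprK; apply: br_sorted; lia.
Qed.

Section Point.
Variable X : 'M[R]_(2, n).
Hypothesis rX : \rank X = 2%N.
Hypothesis posX : (forall a b, (a < b)%N -> 0 <= colminor X a b) \/
  (forall a b, (a < b)%N -> colminor X a b <= 0).
Local Notation m := (colminor X).
Local Notation XA := (row 0 (X *m Z)).
Local Notation XB := (row 1 (X *m Z)).

Lemma colminor_anti a b : m b a = - m a b.
Proof. by rewrite /colminor; ring. Qed.

Lemma row_mulmx_sum (i : 'I_2) : row i (X *m Z) = \sum_a X i a *: row a Z.
Proof.
rewrite row_mul mulmx_sum_row; apply: eq_bigr => a _; by rewrite mxE.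
Qed.

Lemma br_suml (I : finType) (f : I -> R) (t : I -> 'rV[R]_4) q u w :
  br (\sum_a f a *: t a) q u w = \sum_a f a * br (t a) q u w.
Proof.
elim/big_rec2: _ => [|a p r _ IH]; first by rewrite -(scale0r 0) brZa mul0r.
by rewrite brDa brZa IH.
Qed.

(* Cauchy-Binet; the sum runs over ordered pairs, hence the factor 2. *)
Lemma br_minors u w : br XA XB u w *+ 2 = \sum_a \sum_b m a b * br (row a Z) (row b Z) u w.
Proof.
have e : br XA XB u w = \sum_a \sum_b X 0 a * X 1 b * br (row a Z) (row b Z) u w.
  rewrite !row_mulmx_sum br_suml; apply: eq_bigr => a _.
  rewrite br_swap12 br_suml -sumrN mulr_sumr; apply: eq_bigr => b _.
  by rewrite [br (row b Z) _ _ _]br_swap12; ring.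
rewrite mulr2n {1}e e [X in _ + X]exchange_big -big_split /=; apply: eq_bigr => a _.
rewrite -big_split /=; apply: eq_bigr => b _.
by rewrite [br (row b Z) _ _ _]br_swap12 /colminor; ring.
Qed.

Lemma minor_sign : exists d : R, (d = 1 \/ d = -1) /\ forall a b, (a < b)%N -> 0 <= d * m a b.
Proof.
case: posX => h; [exists 1|exists (-1)]; split; try by [left|right].
  by move=> a b /h; rewrite mul1r.
by move=> a b /h; rewrite mulN1r oppr_ge0.
Qed.

(** A vanishing sum of terms of one sign vanishes termwise. The sign is demanded only where the
    minor is nonzero, so that earlier restrictions on the support can be used. *)
Lemma minors_vanish e u w : (e = 1 \/ e = -1) -> br XA XB u w = 0 ->
  (forall a b, (a < b)%N -> m a b != 0 -> 0 <= e * br (row a Z) (row b Z) u w) ->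
  forall a b, (a < b)%N -> 0 < e * br (row a Z) (row b Z) u w -> m a b = 0.
Proof.
move=> he z0 hpos; have [d [hd dpos]] := minor_sign.
pose T a b := (d * m a b) * (e * br (row a Z) (row b Z) u w).
have Tsym a b : T b a = T a b.
  by rewrite /T colminor_anti [br (row b Z) _ _ _]br_swap12; ring.
have T0 a b : 0 <= T a b.
  wlog ab : a b / (a < b)%N => [th|].
    have [ab|ba|eab] := ltngtP a b; [exact: th|by rewrite Tsym; apply: th|].
    have -> : a = b by apply: val_inj.
    by rewrite /T /colminor subrr mulr0 mul0r.
  have [m0|nm] := eqVneq (m a b) 0; first by rewrite /T m0 mulr0 mul0r.
  by apply: mulr_ge0; [exact: dpos|exact: hpos].
have S0 : \sum_a \sum_b T a b = 0.
  have -> : \sum_a \sum_b T a b = d * e * (br XA XB u w *+ 2).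
    rewrite br_minors mulr_sumr; apply: eq_bigr => a _; rewrite mulr_sumr; apply: eq_bigr => b _.
    by rewrite /T; ring.
  by rewrite z0 mul0rn mulr0.
move=> a b ab gp.
have Ra : \sum_b T a b = 0.
  by apply: (psumr_eq0P _ S0) => // i _; apply: sumr_ge0.
have : T a b = 0 by apply: (psumr_eq0P _ Ra).
rewrite /T => /eqP; rewrite mulf_eq0 (gt_eqF gp) orbF mulf_eq0 => /orP[/eqP d0|/eqP //].
by case: hd => hd; move: d0; rewrite hd => /eqP; rewrite ?oppr_eq0 oner_eq0.
Qed.

(** Terms with a column on edge [i] contribute nothing, and the remaining determinants are nonzero
    of one sign. *)
Lemma line_minor i a b : br XA XB (row i Z) (row (s i) Z) = 0 -> m a b != 0 ->
  (a \in [:: i; s i]) || (b \in [:: i; s i]).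
Proof.
move=> z0; have [e [he epos]] := sign_line i.
wlog ab : a b / (a < b)%N => [th nm|nm].
  have [ab|ba|eab] := ltngtP a b; [exact: th| |].
    by rewrite orbC; apply: th => //; rewrite colminor_anti oppr_eq0.
  by move: nm; have -> : a = b by [apply: val_inj]; rewrite /colminor subrr eqxx.
apply/negPn/negP; rewrite !inE !negb_or => /andP[/andP[a1 a2] /andP[b1 b2]].
case/negP: nm; apply/eqP; apply: (minors_vanish he z0 _ ab); last exact: epos.
move=> x y xy nxy.
have [hx|hx] := boolP (x \in [:: i; s i]).
  by move: hx; rewrite !inE => /orP[]/eqP->; rewrite br_aabb mulr0.
have [hy|hy] := boolP (y \in [:: i; s i]).
  by move: hy; rewrite !inE => /orP[]/eqP->; rewrite br_aabb mulr0.
move: hx hy; rewrite !inE !negb_or => /andP[x1 x2] /andP[y1 y2].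
by apply/ltW/epos.
Qed.

Lemma skew_point i j a : nadj i j -> a \in [:: i; s i] -> a \in [:: j; s j] -> False.
Proof.
rewrite /nadj !inE => /and3P[h1 h2 h3] /orP[]/eqP-> /orP[] /eqP h; [move: h1|move: h3|move: h2|];
  rewrite ?h ?eqxx //.
by move/ordS_inj: h => h; rewrite h eqxx in h1.
Qed.

Lemma minors_nz : exists a b, (a < b)%N /\ m a b != 0.
Proof.
have [a [b nz]] := rank2_minor rX.
have [ab|ba|eab] := ltngtP a b; first by exists a, b.
  by exists b, a; split=> //; rewrite colminor_anti oppr_eq0.
by move: nz; have -> : a = b by [apply: val_inj]; rewrite subrr eqxx.
Qed.

(** A nonzero minor has two columns, and three disjoint edges would each need one. *)
Lemma not_bad3 i j k : nadj i j -> nadj i k -> nadj j k ->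
  br XA XB (row i Z) (row (s i) Z) = 0 -> br XA XB (row j Z) (row (s j) Z) = 0 ->
  br XA XB (row k Z) (row (s k) Z) = 0 -> False.
Proof.
move=> ij ik jk hi hj hk; have [a [b [_ nm]]] := minors_nz.
have h1 := line_minor hi nm; have h2 := line_minor hj nm; have h3 := line_minor hk nm.
case/orP: h1 => h1; case/orP: h2 => h2; case/orP: h3 => h3;
  first [exact: skew_point ij h1 h2|exact: skew_point ik h1 h3|exact: skew_point jk h2 h3].
Qed.

(** Meeting edges [b], [b+1] and [c] forces every nonzero minor to use column [b+1] and a column on
    edge [c]. On this support the pairing with [z b], [z (b+2)] has terms of one strict sign, so it
    cannot vanish. *)
Lemma not_badQ b c : c != b -> c != s b -> c != s (s b) -> s c != b ->
  br XA XB (row b Z) (row (s b) Z) = 0 -> br XA XB (row (s b) Z) (row (s (s b)) Z) = 0 ->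
  br XA XB (row b Z) (row (s (s b)) Z) = 0 -> br XA XB (row c Z) (row (s c) Z) = 0 -> False.
Proof.
move=> c1 c2 c3 c4 h1 h2 h3 h4.
have [n1 n2 _] := ordS_neq b n4.
have key x y : m x y != 0 -> [/\ x = s b \/ y = s b, x != b, x != s (s b), y != b & y != s (s b)].
  move=> nm; have k1 := line_minor h1 nm; have k2 := line_minor h2 nm; have k4 := line_minor h4 nm.
  have out t : t \in [:: c; s c] -> [/\ t \notin [:: b; s b], t \notin [:: s b; s (s b)] &
      (t != b) && (t != s (s b))].
    rewrite !inE !negb_or => /orP[]/eqP ->; rewrite ?c1 ?c2 ?c3 ?c4 //.
    by rewrite !(inj_eq (@ordS_inj _)) c1 c2; split.
  have mid t : t \in [:: b; s b] -> t \in [:: s b; s (s b)] ->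
      [/\ t = s b, t != b & t != s (s b)].
    have [m1 _ _] := ordS_neq (s b) n4.
    rewrite !inE => /orP[]/eqP-> /orP[] => [e|e|_|_]; rewrite ?e in n1 n2 *; try by [].
      by rewrite eq_sym n1 m1.
    by rewrite eq_sym n1 m1.
  case/orP: k4 => k4; have [o1 o2 /andP[o3 o4]] := out _ k4.
    rewrite (negbTE o1) (negbTE o2) /= in k1 k2.
    by have [e e1 e2] := mid _ k1 k2; split=> //; right.
  rewrite (negbTE o1) (negbTE o2) !orbF in k1 k2.
  by have [e e1 e2] := mid _ k1 k2; split=> //; left.
have [e [he epos]] := sign_plane b; have [x [y [xy nm]]] := minors_nz.
have [k1 k2 k3 k4 k5] := key _ _ nm.
case/negP: nm; apply/eqP; apply: (minors_vanish he h3 _ xy); last exact: epos.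
move=> x' y' xy' nm'; have [k1' k2' k3' k4' k5'] := key _ _ nm'.
exact/ltW/epos.
Qed.
End Point.

End Positivity.

Section GenericVanishing.
Variable F : fieldType.

Lemma plmult_wedge (f : {mpoly F[6]}) A B : plmult f -> f.@[wedge A B] = 0.
Proof.
case=> q ->; rewrite mevalM plRel_eval !wedgeE (_ : _ - _ + _ = 0) ?mulr0 //; ring.
Qed.

(** Bad lines involve five distinct indices, so an adjoint has positive degree when they exist and
    vanishes at the zero bivector. *)
Lemma bad_n5 n (z : 'I_n -> 'rV[F]_4) A B : (4 <= n)%N -> bad z A B -> (5 <= n)%N.
Proof.
move=> n4 [[i [j [k [[ij ik jk] _]]]]|[b [c [[h1 h2 h3 h4] _]]]].
  by apply: (@uniq5_le _ [:: i; ordS i; j; ordS j; k]); ords.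
by apply: (@uniq5_le _ [:: b; ordS b; ordS (ordS b); c; ordS c]); ords.
Qed.
End GenericVanishing.

(** * Passage from real to complex coordinates, and conclusion *)

Lemma RtoCD x y : RtoC (x + y) = RtoC x + RtoC y.
Proof. by transitivity (Complex (x + y) (0 + 0) : C); rewrite // addr0. Qed.
Lemma RtoCN x : RtoC (- x) = - RtoC x.
Proof. by transitivity (Complex (- x) (- 0) : C); rewrite // oppr0. Qed.
Lemma RtoCM x y : RtoC (x * y) = RtoC x * RtoC y.
Proof.
transitivity (Complex (x * y - 0 * 0) (x * 0 + 0 * y) : C); last by [].
by rewrite !mul0r mulr0 subr0 addr0.
Qed.
Lemma RtoC_eq0 x : RtoC x = 0 -> x = 0.
Proof. by case. Qed.

Lemma RtoC_wedge (A B : 'rV[R]_4) k : wedge (map_mx RtoC A) (map_mx RtoC B) k = RtoC (wedge A B k).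
Proof. by rewrite /wedge !mxE RtoCD RtoCN !RtoCM. Qed.

Lemma RtoC_br (A B Y W : 'rV[R]_4) :
  br (map_mx RtoC A) (map_mx RtoC B) (map_mx RtoC Y) (map_mx RtoC W) = RtoC (br A B Y W).
Proof. by rewrite /br /pairing !RtoC_wedge !(RtoCD, RtoCN, RtoCM). Qed.

Section Main.
Variables (n : nat) (Z : 'M[R]_(n, 4)).
Hypothesis n4 : (4 <= n)%N.
Hypothesis tp : totally_positive Z.
Local Notation z := (fun i => row i (ZC Z)).
Local Notation s := ordS.
Implicit Types a b c d : 'I_n.

Lemma zE a : row a (ZC Z) = map_mx RtoC (row a Z).
Proof. by rewrite /ZC map_row. Qed.

Lemma z_general a b c d : uniq [:: a; b; c; d] -> br (z a) (z b) (z c) (z d) != 0.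
Proof.
move=> u /=; rewrite !zE RtoC_br; apply/eqP => /RtoC_eq0/eqP.
by apply/negP; apply: br_distinct.
Qed.

Lemma ampl_vertex a b : a != b -> Ampl Z (wedge (z a) (z b)).
Proof.
move=> ab; pose X : 'M[R]_(2, n) := \matrix_(i, j) (j == (if i == 0 then a else b))%:R.
have X0 j : X 0 j = (j == a)%:R by rewrite mxE.
have X1 j : X 1 j = (j == b)%:R by rewrite mxE.
exists X; split.
- apply: (minor_rank2 (a := a) (b := b)); rewrite !X0 !X1 !eqxx (negbTE ab) [b == a]eq_sym (negbTE ab).
  by rewrite mulr1 mulr0 subr0 oner_neq0.
- have [lt|lt|e] := ltngtP a b; last by rewrite (val_inj e) eqxx in ab.
    left=> x y xy; rewrite /colminor !X0 !X1.
    have [e'|_] := eqVneq y a; last by rewrite mul0r subr0 mulr_ge0 ?ler0n.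
    have [e|_] := eqVneq x b; last by rewrite mulr0 subr0 mulr_ge0 ?ler0n.
    by exfalso; move: xy; rewrite e e'; lia.
  right=> x y xy; rewrite /colminor !X0 !X1.
  have [e|_] := eqVneq x a; last by rewrite mul0r sub0r oppr_le0 mulr_ge0 ?ler0n.
  have [e'|_] := eqVneq y b; last by rewrite mulr0 sub0r oppr_le0 mulr_ge0 ?ler0n.
  by exfalso; move: xy; rewrite e e'; lia.
rewrite plucker_wedge; congr wedge; rewrite -map_row row_mul /= zE; congr (map_mx RtoC _).
  by rewrite [row a Z]rowE; congr (_ *m _); apply/rowP => j; rewrite !mxE.
by rewrite [row b Z]rowE; congr (_ *m _); apply/rowP => j; rewrite !mxE.
Qed.

Lemma ampl_bad v : Ampl Z v -> ~ badv Z v.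
Proof.
case=> X [rX pX ->] [A [B [e h]]].
have E a b : br A B (z a) (z b) = 0 -> br (row 0 (X *m Z)) (row 1 (X *m Z)) (row a Z) (row b Z) = 0.
  rewrite {1}/br -e plucker_wedge -/(br _ _ _ _) -!map_row /= ?zE RtoC_br; exact: RtoC_eq0.
case: h => [[i [j [k [[ij ik jk] [hi hj hk]]]]]|[b [c [[c1 c2 c3 c4] [h1 h2 h3 h4]]]]].
  by apply: (not_bad3 n4 tp rX pX ij ik jk); apply: E.
by apply: (not_badQ n4 tp rX pX c1 c2 c3 c4); apply: E.
Qed.

Hypothesis G : assumptionG Z.

Lemma five_lines A B k (e : seq 'I_n) : wedge A B k != 0 -> uniq e -> size e = 5%N ->
  (forall i, i \in e -> lf z i A B = 0) -> False.
Proof.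
move=> nz ue se h; have [M [rM eM]] := wedge_Gr nz.
have := G rM; apply/negP; rewrite -ltnNge -se -(card_uniqP ue).
apply/subset_leq_card/subsetP => i /h hi; rewrite inE; apply/eqP.
by rewrite /bracket det_col_br /br -plucker_wedge -eM.
Qed.

Lemma adjoint_vanish_bad f : adjoint Z f -> vanish_bad z f.
Proof.
case=> hf _ fr A B hb; have [[k nz]|no] := classic (exists k, wedge A B k != 0).
  exact: fr (bad_residual n4 z_general ampl_bad nz hb).
apply: (meval_homog_zero hf); first by have := bad_n5 n4 hb; lia.
by move=> k; apply/eqP/negPn/negP => nz; apply: no; exists k.
Qed.

End Main.
Theorem theorem5p2 (n : nat) (Z : 'M[R]_(n,4)) :
  (4 <= n)%N -> totally_positive Z -> assumptionG Z ->
  exists a : {mpoly C[6]},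
    adjoint Z a /\
    forall b : {mpoly C[6]}, adjoint Z b -> exists c : C, zeroR (b - c *: a).
Proof.
move=> n4 tp G.
have gen := z_general n4 tp.
have [f [hf fbad fnz]] := adjoint_exists C_char0 n4 gen.
have n0 : (0 < n)%N by apply: leq_trans n4.
pose o : 'I_n := Ordinal n0.
(* The line through [z o] and the vertex two steps on shows that [f] is not in the Plücker ideal. *)
have oo : nadj o (ordS (ordS o)) by ords.
have fadj : adjoint Z f.
  split=> //; first by move=> /plmult_wedge fz; have := fnz _ _ oo; rewrite fz eqxx.
  move=> v /(residual_bad n4 gen (@ampl_vertex n Z n4))[A [B [-> h]]]; exact: fbad.
exists f; split=> // b badj.
have [hb _ _] := badj.
have [c hc] := adjoint_unique C_char0 n4 gen (five_lines G) hf hb fbad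
  (adjoint_vanish_bad n4 tp badj) fnz.
by exists c; apply: (zeroR_vanish (sub_homog hf hb c) hc).
Qed.
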